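(* Let $\psi:\mathbb{D}\to\mathbb{D}$ be an analytic function. If the series $\sum_{n=0}^{\infty}\|\psi^n\|_{H^2}^2$ converges, then the composition operator $C_{\psi}$ is compact on $H^2$.
   Context: $\mathbb{D}=\{z\in\mathbb{C}:|z|<1\}$ and $\mathbb{T}=\{z\in\mathbb{C}:|z|=1\}$; $m$ is normalized Lebesgue measure on $\mathbb{T}$ (so $m(\mathbb{T})=1$). $H^2=H^2(\mathbb{D})$ is the Hardy space of analytic functions on $\mathbb{D}$, with $\|f\|_{H^2}^2=\int_{\mathbb{T}}|f|^2\,dm$ (nontangential boundary values of $f$). Here $\psi^n$ denotes the $n$-th power (pointwise product, not iterate) of $\psi$, with $\psi^0= 1$. The composition operator $C_\psi: H^2\to H^2$, $C_\psi(f)=f\circ\psi$, is bounded (Littlewood Subordination Principle). *)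

(* Defs.v *)
From HB Require Import structures.
From mathcomp Require Import all_boot all_order all_algebra.
From mathcomp Require Import all_classical all_reals all_analysis.
From mathcomp Require Import complex.

Set Implicit Arguments.
Unset Strict Implicit.
Unset Printing Implicit Defensive.

Import Order.TTheory GRing.Theory Num.Theory.
Import numFieldNormedType.Exports.
Import ComplexField.

Local Open Scope classical_set_scope.
Local Open Scope ring_scope.
Local Open Scope complex_scope.

(* [R[i]] seen as a [numFieldType], which gives it the topology of its norm. *)
Definition cplx (R : realType) : numFieldType := R[i].

Definition cmod (R : realType) (z : cplx R) : R := Normc.normc z.

Definition disk (R : realType) : set (cplx R) := [set z | cmod z < 1].
Arguments disk : clear implicits.

Definition analytic_on (R : realType) (D : set (cplx R))
    (f : cplx R -> cplx R) : Prop :=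
  forall z0, D z0 -> exists (a : nat -> cplx R) (r : R), 0 < r /\
    forall z, cmod (z - z0) < r ->
      series (fun n => a n * (z - z0) ^+ n) @ \oo --> f z.

Definition circle_pt (R : realType) (t : R) : cplx R := cos t +i* sin t.

(* Integration over the unit circle against normalized Lebesgue measure. *)
Definition circle_int (R : realType) (g : cplx R -> \bar R) : \bar R :=
  (((2 * pi)^-1)%:E *
    \int[lebesgue_measure]_(t in `[0%R, (2 * pi)%R]%classic) g (circle_pt t))%E.

(* The nontangential approach region (Stolz angle) of aperture [a] at [w]. *)
Definition stolz (R : realType) (a : R) (w : cplx R) : set (cplx R) :=
  [set z | disk R z /\ cmod (z - w) < a * (1 - cmod z)].

Definition nontangential (R : realType) (w : cplx R) : set_system (cplx R) :=
  \bigcap_(a in [set a : R | 1 < a]) within (stolz a w) (nbhs w).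

(* For [f] in [hardy] the nontangential limit exists at almost every point of
   the circle; [lim] returns a default value at the other points. *)
Definition boundary (R : realType) (f : cplx R -> cplx R) (w : cplx R)
    : cplx R :=
  lim (f z @[z --> nontangential w]).

(* Only the values on the disk matter for [hardy f] and [hardy_norm f]. *)
Definition hardy (R : realType) : set (cplx R -> cplx R) :=
  [set f | analytic_on (disk R) f /\
    exists M : R, forall r : R, 0 <= r < 1 ->
      (circle_int (fun w => (cmod (f (r%:C * w)) ^+ 2)%:E) <= M%:E)%E].
Arguments hardy : clear implicits.

Definition hardy_norm (R : realType) (f : cplx R -> cplx R) : \bar R :=
  (circle_int (fun w => (cmod (boundary f w) ^+ 2)%:E) `^ 2^-1)%E.

Definition comp_op (R : realType) (psi f : cplx R -> cplx R) : cplx R -> cplx R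
  := f \o psi.

(* [T] is a compact operator of the space [H] normed by [N]: it maps [H] into
   itself, and bounded sequences to sequences with a subsequence converging in
   [H]. *)
Definition compact_operator (R : realType) (V : zmodType) (H : set V)
    (N : V -> \bar R) (T : V -> V) : Prop :=
  (forall f, H f -> H (T f)) /\
  forall f : nat -> V, (forall n, H (f n)) ->
    (exists M : R, forall n, (N (f n) <= M%:E)%E) ->
    exists (k : nat -> nat) (g : V),
      [/\ {homo k : m n / (m < n)%N}, H g &
          N (T (f (k n)) - g) @[n --> \oo] --> 0%E].

(* Main.v *)
Require Import Defs.
From mathcomp Require Import all_boot all_order all_algebra.
From mathcomp Require Import all_classical all_reals all_analysis.
From mathcomp Require Import measurable_realfun complex ring lra.
Import Order.TTheory GRing.Theory Num.Theory.
Import numFieldNormedType.Exports.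

(** The powers z^n are an orthonormal basis of the Hardy space, so the hypothesis
  says that the composition operator is Hilbert-Schmidt, and such operators are
  compact. In concrete terms: a function f with Taylor coefficients a_n is in the
  Hardy space if and only if the |a_n|^2 are summable ([hardy_l2], [l2_hardy]), and
  its norm bounds their sum ([l2le_norm2]). A bounded sequence of functions
  therefore has a subsequence whose coefficients converge one by one
  ([l2_subsequence]), to the coefficients of some F in the Hardy space. Let d_n be
  the coefficients of the difference h of a term of the subsequence and F. Then
  h o psi is the sum of the d_n psi^n. The terms with n < K tend to 0 uniformly on
  the circle, and by Cauchy-Schwarz the square of the rest is at most the sum of the
  |d_n|^2 times the sum over n >= K of the |psi|^(2n), whose integral is a tail of
  the series assumed to converge ([block_bound], [norm2_comp_bound]). The same
  estimate on smaller circles shows that the operator maps the Hardy space to itself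
  ([comp_l2]).

  What remains is to connect coefficients, local power series and nontangential
  boundary values.

  Local to global: functions with local power series are holomorphic in the sense of
  [hol_at], a class which is stable under composition, and holomorphic functions have a
  power series on every disk in their domain by the Cauchy integral formula
  ([cauchy_formula], [hol_analytic], [hol_disk_ps]). Parseval's identity on circles
  turns the integral means of a function into sums of squares of its coefficients.

  Boundary values: Cauchy's formula for g(w)^2 / (1 - conj(z) w) bounds |g z|^2 by an
  integral of |g|^2 against the Poisson kernel ([poisson_bound]). In a Stolz angle this
  is at most a multiple of the Hardy-Littlewood maximal function of |g|^2 at the vertex
  ([stolz_maximal]), and the maximal inequality gives a weak-type bound for the
  supremum of g over the Stolz angle ([weak_type]). Applied to the difference of f
  and its partial sums, this proves that f has nontangential limits almost everywhere
  ([fatou_nontangential]); the lower bound [l2le_norm2] for the norm then follows from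
  Fatou's lemma. *)

Set Implicit Arguments.
Unset Strict Implicit.
Unset Printing Implicit Defensive.

Local Open Scope classical_set_scope.
Local Open Scope ring_scope.
Local Notation Re := complex.Re.
Local Notation Im := complex.Im.

(** * Complex numbers and their real-valued modulus *)

Section ComplexModulus.
Variable R : realType.
Implicit Types (z w : cplx R) (x : R).

Definition rc x : cplx R := real_complex R x.
Definition cconj z : cplx R := conjc z.

Lemma cReD z w : Re (z + w : cplx R) = Re z + Re w.
Proof. by move: z w => [a b] [c d]. Qed.
Lemma cImD z w : Im (z + w : cplx R) = Im z + Im w.
Proof. by move: z w => [a b] [c d]. Qed.
Lemma cReN z : Re (- z : cplx R) = - Re z. Proof. by case: z. Qed.
Lemma cImN z : Im (- z : cplx R) = - Im z. Proof. by case: z. Qed.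
Lemma cReM z w : Re (z * w : cplx R) = Re z * Re w - Im z * Im w.
Proof. by move: z w => [a b] [c d]. Qed.
Lemma cImM z w : Im (z * w : cplx R) = Re z * Im w + Im z * Re w.
Proof. by move: z w => [a b] [c d]. Qed.
Lemma cplxP z w : Re z = Re w -> Im z = Im w -> z = w.
Proof. by move: z w => [a b] [c d] /= -> ->. Qed.

Lemma rcD : {morph rc : x y / x + y}.
Proof. by move=> x y; apply: cplxP; rewrite ?(cReD, cImD) /= ?addr0. Qed.
Lemma rc1 : rc 1 = 1. Proof. by []. Qed.
Lemma rc0 : rc 0 = 0. Proof. by []. Qed.

Lemma cmodM z w : cmod (z * w) = cmod z * cmod w.
Proof. exact: Normc.normcM. Qed.
Lemma cmodD z w : cmod (z + w) <= cmod z + cmod w.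
Proof. exact: le_normcD. Qed.
Lemma cmodN z : cmod (- z) = cmod z. Proof. exact: normcN. Qed.
Lemma cmod0 : cmod (0 : cplx R) = 0. Proof. exact: Normc.normc0. Qed.
Lemma cmod1 : cmod (1 : cplx R) = 1. Proof. exact: Normc.normc1. Qed.
Lemma cmodV z : cmod z^-1 = (cmod z)^-1. Proof. exact: Normc.normcV. Qed.
Lemma cmodX z n : cmod (z ^+ n) = cmod z ^+ n.
Proof.
elim: n => [|n IH]; first by rewrite !expr0 cmod1.
by rewrite !exprS cmodM IH.
Qed.
Lemma cmod_eq0 z : cmod z = 0 -> z = 0. Proof. exact: Normc.eq0_normc. Qed.
Lemma cmod_sqr z : cmod z ^+ 2 = Re z ^+ 2 + Im z ^+ 2.
Proof.
by case: z => a b; rewrite /cmod /= sqr_sqrtr// addr_ge0// sqr_ge0.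
Qed.
Lemma cmod_ge0 z : 0 <= cmod z.
Proof. by case: z => a b; rewrite /cmod /= sqrtr_ge0. Qed.
Hint Resolve cmod_ge0 : core.
Lemma cmod_gt0 z : (0 < cmod z) = (z != 0).
Proof.
rewrite lt_neqAle cmod_ge0 andbT eq_sym; congr (~~ _).
by apply/eqP/eqP => [/cmod_eq0//|->]; exact: cmod0.
Qed.
Lemma cmodB z w : cmod (z - w) = cmod (w - z).
Proof. by rewrite -cmodN opprB. Qed.
Lemma cmod_rc x : cmod (rc x) = `|x|.
Proof. by rewrite /cmod /= expr0n /= addr0 sqrtr_sqr. Qed.
Lemma cmod_conj z : cmod (cconj z) = cmod z.
Proof. by case: z => a b; rewrite /cmod /= sqrrN. Qed.
Lemma mulcconj z : z * cconj z = rc (cmod z ^+ 2).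
Proof.
by apply: cplxP; rewrite ?cReM ?cImM cmod_sqr; case: z => a b /=; ring.
Qed.
Lemma Re_le z : `|Re z| <= cmod z.
Proof.
rewrite -(ler_pXn2r (n:=2)) ?nnegrE// cmod_sqr real_normK ?num_real//.
by rewrite lerDl sqr_ge0.
Qed.
Lemma Im_le z : `|Im z| <= cmod z.
Proof.
rewrite -(ler_pXn2r (n:=2)) ?nnegrE// cmod_sqr real_normK ?num_real//.
by rewrite lerDr sqr_ge0.
Qed.
Lemma cmod_le z : cmod z <= `|Re z| + `|Im z|.
Proof.
rewrite -(ler_pXn2r (n:=2)) ?nnegrE ?addr_ge0// cmod_sqr sqrrD.
by rewrite !real_normK ?num_real// -addrA (addrC (_ *+ 2)) addrA lerDl mulrn_wge0// mulr_ge0.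
Qed.
Lemma cmod_sub z w : cmod z - cmod w <= cmod (z - w).
Proof. by rewrite lerBlDr (le_trans _ (cmodD _ _))// subrK. Qed.
Lemma cmod_dist z w : `|cmod z - cmod w| <= cmod (z - w).
Proof.
by rewrite ler_norml cmod_sub andbT lerNl opprB cmodB cmod_sub.
Qed.
Lemma cmod_sum (I : Type) (s : seq I) (P : pred I) (F : I -> cplx R) :
  cmod (\sum_(i <- s | P i) F i) <= \sum_(i <- s | P i) cmod (F i).
Proof.
elim/big_ind2: _ => [|x1 x2 y1 y2 h1 h2|//]; first by have -> : cmod (0 : cplx R) = 0 := cmod0.
by rewrite (le_trans (cmodD _ _))// lerD.
Qed.
Lemma cRe_sum (I : Type) (s : seq I) (P : pred I) (F : I -> cplx R) :
  Re (\sum_(i <- s | P i) F i) = \sum_(i <- s | P i) Re (F i).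
Proof. by elim/big_rec2: _ => // i y x _ <-; rewrite cReD. Qed.
Lemma cIm_sum (I : Type) (s : seq I) (P : pred I) (F : I -> cplx R) :
  Im (\sum_(i <- s | P i) F i) = \sum_(i <- s | P i) Im (F i).
Proof. by elim/big_rec2: _ => // i y x _ <-; rewrite cImD. Qed.

Lemma normE z : `|z| = rc (cmod z).
Proof. by []. Qed.

(** The norm of [cplx R] takes its values in [cplx R] itself. This lemma and the
  ones that follow express its topology through the real number [cmod z]. *)
Lemma nbhs_cplxP z (A : set (cplx R)) :
  nbhs z A <-> exists2 e : R, 0 < e & forall w, cmod (w - z) < e -> A w.
Proof.
split.
  rewrite -nbhs_ballE => -[e /= e0 h].
  have eE : e = rc (Re e).
    apply: cplxP => //=; move: e0; rewrite ltcE => /andP[/eqP] /=.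
    by move=> ->.
  have e0' : 0 < Re e by move: e0; rewrite ltcE => /andP[_].
  exists (Re e) => // w we; apply: h; rewrite /ball /= /ball_ eE.
  by rewrite normE ltcR cmodB.
move=> [e e0 h]; rewrite -nbhs_ballE; exists (rc e) => /=; first by rewrite ltcR.
by move=> w; rewrite /ball /= /ball_ normE ltcR cmodB; exact: h.
Qed.

Lemma cvg_cplxP (T : Type) (F : set_system T) {FF : Filter F}
    (f : T -> cplx R) (l : cplx R) :
  f x @[x --> F] --> l <->
  forall e : R, 0 < e -> \forall x \near F, cmod (f x - l) < e.
Proof.
split=> [h e e0|h A /nbhs_cplxP[e e0 eA]].
  by apply: (h [set w | cmod (w - l) < e]); apply/nbhs_cplxP; exists e.
by apply: filterS (h _ e0) => x /eA.
Qed.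

Lemma cvg_cplx_modP (T : Type) (F : set_system T) {FF : Filter F}
    (f : T -> cplx R) (l : cplx R) :
  f x @[x --> F] --> l <-> cmod (f x - l) @[x --> F] --> (0 : R).
Proof.
split=> [/cvg_cplxP h|h].
  apply/cvgr0Pnorm_lt => e e0; apply: filterS (h _ e0) => x.
  by rewrite ger0_norm.
apply/cvg_cplxP => e e0; move/cvgr0Pnorm_lt: h => /(_ _ e0).
by apply: filterS => x; rewrite ger0_norm.
Qed.

Lemma cvg_ReIm (T : Type) (F : set_system T) {FF : Filter F}
    (f : T -> cplx R) (l : cplx R) :
  Re (f x) @[x --> F] --> Re l -> Im (f x) @[x --> F] --> Im l ->
  f x @[x --> F] --> l.
Proof.
move=> hr hi; apply/cvg_cplxP => e e0.
have e2 : 0 < e / 2 by rewrite divr_gt0.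
move/cvgrPdist_lt: hr => /(_ _ e2) hr; move/cvgrPdist_lt: hi => /(_ _ e2) hi.
apply: filterS2 hr hi => x h1 h2; apply: le_lt_trans (cmod_le _) _.
rewrite [ltRHS]splitr; apply: ltrD; [rewrite cReD cReN distrC; exact: h1|rewrite cImD cImN distrC; exact: h2].
Qed.

Lemma cvg_Re (T : Type) (F : set_system T) {FF : Filter F}
    (f : T -> cplx R) (l : cplx R) :
  f x @[x --> F] --> l -> Re (f x) @[x --> F] --> Re l.
Proof.
move=> /cvg_cplxP h; apply/cvgrPdist_lt => e e0; apply: filterS (h _ e0) => x.
by apply: le_lt_trans; rewrite distrC -cReN -cReD Re_le.
Qed.

Lemma cvg_Im (T : Type) (F : set_system T) {FF : Filter F}
    (f : T -> cplx R) (l : cplx R) :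
  f x @[x --> F] --> l -> Im (f x) @[x --> F] --> Im l.
Proof.
move=> /cvg_cplxP h; apply/cvgrPdist_lt => e e0; apply: filterS (h _ e0) => x.
by apply: le_lt_trans; rewrite distrC -cImN -cImD Im_le.
Qed.

Lemma cvg_cmod (T : Type) (F : set_system T) {FF : Filter F}
    (f : T -> cplx R) (l : cplx R) :
  f x @[x --> F] --> l -> cmod (f x) @[x --> F] --> cmod l.
Proof.
move=> /cvg_cplxP h; apply/cvgrPdist_lt => e e0; apply: filterS (h _ e0) => x.
by apply: le_lt_trans; rewrite distrC cmod_dist.
Qed.

Lemma cvg_cplx_unique (T : Type) (F : set_system T) {FF : ProperFilter F}
    (f : T -> cplx R) (l l' : cplx R) :
  f x @[x --> F] --> l -> f x @[x --> F] --> l' -> l = l'.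
Proof.
move=> h h'; apply: cplxP.
- exact: cvg_unique (cvg_Re h) (cvg_Re h').
- exact: cvg_unique (cvg_Im h) (cvg_Im h').
Qed.

Lemma lim_cplxP (T : Type) (F : set_system T) {FF : ProperFilter F}
    (f : T -> cplx R) (l : cplx R) :
  f x @[x --> F] --> l -> lim (f x @[x --> F]) = l.
Proof.
move=> h; have c : cvg (f x @[x --> F]) by apply: (cvgP l); exact: h.
exact: (@cvg_cplx_unique T F FF f _ _ c h).
Qed.

End ComplexModulus.
#[global] Hint Extern 0 (is_true (@Order.le _ _ _ (@cmod _ _))) => exact: cmod_ge0 : core.

(** * Integrals over a period *)

Section CircleIntegrals.
Variable R : realType.
Implicit Types (a t s x : R) (f g : R -> R) (u v : R -> cplx R) (z c l : cplx R).
Notation mu := (@lebesgue_measure R).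

Definition period a : set R := `[a, a + 2 * pi]%classic.

Definition pint a f : R := (\int[mu]_(t in period a) f t)%R.

Lemma measurable_period a : measurable (period a : set (measurableTypeR R)).
Proof. exact: measurable_itv. Qed.

Lemma continuous_integrable a f : continuous f ->
  mu.-integrable (period a) (EFin \o f).
Proof.
move=> cf; apply: continuous_compact_integrable; first exact: segment_compact.
exact: continuous_subspaceT.
Qed.
Hint Resolve measurable_period continuous_integrable : core.

Lemma twopi_gt0 : 0 < 2 * pi :> R.
Proof. by rewrite mulr_gt0// pi_gt0. Qed.

Lemma mu_period a : mu (period a) = (2 * pi)%:E.
Proof.
rewrite /period lebesgue_measure_itv/= lte_fin ltrDl twopi_gt0.
by rewrite -EFinB addrAC subrr add0r.
Qed.

Lemma pint_EFin a f : continuous f ->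
  (\int[mu]_(t in period a) (f t)%:E = (pint a f)%:E)%E.
Proof.
move=> cf; rewrite fineK//.
exact: (integrable_fin_num (measurable_period a) (continuous_integrable a cf)).
Qed.

Lemma pintD a f g : continuous f -> continuous g ->
  pint a (fun t => f t + g t) = pint a f + pint a g.
Proof. by move=> cf cg; rewrite /pint RintegralD//; exact: continuous_integrable. Qed.

Lemma pintZ a x f : continuous f -> pint a (fun t => x * f t) = x * pint a f.
Proof. by move=> cf; rewrite /pint RintegralZl//; exact: continuous_integrable. Qed.

Lemma pint_cst a x : pint a (fun=> x) = x * (2 * pi).
Proof.
rewrite /pint Rintegral_cst; last exact: measurable_period.
by congr (_ * _); exact: (congr1 fine (mu_period a)).
Qed.

Lemma pint_le a f g : continuous f -> continuous g ->
  (forall t, period a t -> f t <= g t) -> pint a f <= pint a g.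
Proof.
by move=> cf cg fg; apply: le_Rintegral => //; exact: continuous_integrable.
Qed.

Lemma pint_ge0 a f : (forall t, 0 <= f t) -> 0 <= pint a f.
Proof. by move=> f0; apply: Rintegral_ge0. Qed.

Lemma pint_norm a f : continuous f -> `|pint a f| <= pint a (fun t => `|f t|).
Proof.
by move=> cf; apply: le_normr_Rintegral => //; exact: continuous_integrable.
Qed.

Lemma pint_FTC a f F : continuous f -> (forall t, is_derive t 1 F (f t)) ->
  pint a f = F (a + 2 * pi) - F a.
Proof.
move=> cf dF; rewrite /pint /Rintegral (@continuous_FTC2 _ f F) ?ltrDl ?twopi_gt0//.
- exact: continuous_subspaceT.
- split => [x _|//|//].
  + by have := dF x => -[].
  + apply: cvg_at_right_filter; apply: differentiable_continuous.
    by apply/derivable1_diffP; have := dF a => -[].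
  + apply: cvg_at_left_filter; apply: differentiable_continuous.
    by apply/derivable1_diffP; have := dF (a + 2 * pi) => -[].
- by move=> x _; rewrite derive1E; have := dF x => -[_ ->].
Qed.

Lemma continuousRe u : continuous u -> continuous (fun t => Re (u t)).
Proof. by move=> cu t; apply: cvg_Re; exact: cu. Qed.
Lemma continuousIm u : continuous u -> continuous (fun t => Im (u t)).
Proof. by move=> cu t; apply: cvg_Im; exact: cu. Qed.
Lemma continuous_cmod u : continuous u -> continuous (fun t => cmod (u t)).
Proof. by move=> cu t; apply: cvg_cmod; exact: cu. Qed.

Lemma continuous_ReIm u : continuous (fun t => Re (u t)) ->
  continuous (fun t => Im (u t)) -> continuous u.
Proof. by move=> cr ci t; apply: cvg_ReIm; [exact: cr|exact: ci]. Qed.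

Lemma cplx_contD u v : continuous u -> continuous v -> continuous (fun t => u t + v t).
Proof. by move=> cu cv t; apply: (@cvgD _ (cplx R)); [exact: cu|exact: cv]. Qed.
Lemma cplx_contM u v : continuous u -> continuous v -> continuous (fun t => u t * v t).
Proof. by move=> cu cv t; apply: cvgM; [exact: cu|exact: cv]. Qed.
Lemma cplx_contN u : continuous u -> continuous (fun t => - u t).
Proof. by move=> cu t; apply: (@cvgN _ (cplx R)); exact: cu. Qed.
Lemma cplx_cont_cst c : continuous (fun _ : R => c).
Proof. by move=> t; exact: cvg_cst. Qed.
Lemma cplx_contX u n : continuous u -> continuous (fun t => u t ^+ n).
Proof.
move=> cu; elim: n => [|n IH]; first exact: cplx_cont_cst.
have -> : (fun t => u t ^+ n.+1) = (fun t => u t * u t ^+ n).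
  by apply/funext => t; rewrite exprS.
exact: cplx_contM.
Qed.
Lemma cplx_contV u : continuous u -> (forall t, u t != 0) -> continuous (fun t => (u t)^-1).
Proof. by move=> cu u0 t; apply: cvgV => //; exact: cu. Qed.

(** Componentwise, because the Lebesgue integral is real-valued. The triangle
  inequality [cint_le] then costs a factor 2, which never matters below. *)
Definition cint a u : cplx R :=
  Complex (pint a (fun t => Re (u t))) (pint a (fun t => Im (u t))).

Lemma eq_cint a u v : u =1 v -> cint a u = cint a v.
Proof. by move=> /funext ->. Qed.

Lemma cintD a u v : continuous u -> continuous v ->
  cint a (fun t => u t + v t) = cint a u + cint a v.
Proof.
move=> cu cv; apply: cplxP; rewrite ?cReD ?cImD /= -pintD.
- by congr pint; apply/funext => t; rewrite cReD.
- exact: continuousRe.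
- exact: continuousRe.
- by congr pint; apply/funext => t; rewrite cImD.
- exact: continuousIm.
- exact: continuousIm.
Qed.

Lemma cintZ a c u : continuous u -> cint a (fun t => c * u t) = c * cint a u.
Proof.
move=> cu; have cr := continuousRe cu; have ci := continuousIm cu.
have cZ k f : continuous f -> continuous (fun t => k * f t : R).
  by move=> cf t; apply: cvgM; [exact: cvg_cst|exact: cf].
apply: cplxP; rewrite ?cReM ?cImM /= -!pintZ//.
- rewrite -mulN1r -pintZ; last exact: cZ.
  rewrite -pintD; [|exact: cZ|by apply: (cZ); apply: (cZ)].
  by congr pint; apply/funext => t; rewrite cReM mulN1r.
- rewrite -pintD; [|exact: cZ|exact: cZ].
  by congr pint; apply/funext => t; rewrite cImM.
Qed.

Lemma cint_cst a c : cint a (fun=> c) = rc (2 * pi) * c.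
Proof. by apply: cplxP; rewrite ?cReM ?cImM /= pint_cst; ring. Qed.

Lemma cplx_cont_sum (I : Type) (r : seq I) (F : I -> R -> cplx R) :
  (forall i, continuous (F i)) -> continuous (fun t => \sum_(i <- r) F i t).
Proof.
move=> cF; elim: r => [|i r IH].
  have E : (fun t => \sum_(i <- [::]) F i t) = (fun=> 0).
    by apply/funext => t; rewrite big_nil.
  by rewrite E; exact: cplx_cont_cst.
have E : (fun t => \sum_(i <- i :: r) F i t) = (fun t => F i t + \sum_(i <- r) F i t).
  by apply/funext => t; rewrite big_cons.
by rewrite E; exact: (cplx_contD (cF i) IH).
Qed.

Lemma cint_sum a (I : Type) (r : seq I) (F : I -> R -> cplx R) :
  (forall i, continuous (F i)) ->
  cint a (fun t => \sum_(i <- r) F i t) = \sum_(i <- r) cint a (F i).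
Proof.
move=> cF; elim: r => [|i r IH].
  rewrite big_nil (@eq_cint a _ (fun=> 0)) ?cint_cst ?mulr0// => t.
  by rewrite big_nil.
rewrite big_cons -IH -cintD//; last exact: cplx_cont_sum.
by apply: eq_cint => t; rewrite big_cons.
Qed.

Lemma cint_le a u g : continuous u -> continuous g ->
  (forall t, period a t -> cmod (u t) <= g t) -> cmod (cint a u) <= 2 * pint a g.
Proof.
move=> cu cg ug; have cr := continuousRe cu; have ci := continuousIm cu.
rewrite (le_trans (cmod_le _))//= mulrDl mul1r lerD//.
- rewrite (le_trans (pint_norm _ _))// pint_le//.
  + by move=> t; apply: cvg_norm; exact: cr.
  + by move=> t at'; apply: le_trans (ug t at'); exact: Re_le.
- rewrite (le_trans (pint_norm _ _))// pint_le//.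
  + by move=> t; apply: cvg_norm; exact: ci.
  + by move=> t at'; apply: le_trans (ug t at'); exact: Im_le.
Qed.

(** Componentwise, so that the real fundamental theorem of calculus applies;
  [cderivP] recovers the usual first-order expansion. *)
Definition cderiv u t l :=
  is_derive t 1 (fun t => Re (u t)) (Re l) /\ is_derive t 1 (fun t => Im (u t)) (Im l).

Lemma is_deriveP f t x : is_derive t 1 f x <->
  forall e, 0 < e -> exists2 d, 0 < d &
    forall h, `|h| < d -> `|f (t + h) - f t - h * x| <= e * `|h|.
Proof.
split=> [[df <-] e e0|H].
  have dc : h^-1 *: (f (h *: 1 + t) - f t) @[h --> 0^'] --> 'D_1 f t.
    exact: df.
  move/cvgrPdist_le : dc => /(_ _ e0); rewrite /prop_near1 /dnbhs /within /=.
  rewrite -nbhs_ballE => -[d /= d0 hd]; exists d => // h hd'.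
  have [->|h0] := eqVneq h 0; first by rewrite addr0 subrr mul0r subrr normr0 mulr0.
  have := hd h; rewrite /ball /= sub0r normrN => /(_ hd' h0).
  rewrite /GRing.scale /= mulr1 (addrC h t) => hh.
  have -> : f (t + h) - f t - h * 'D_1 f t =
      - (h * ('D_1 f t - h^-1 * (f (t + h) - f t))).
    by rewrite mulrBr mulrA divff// mul1r; ring.
  by rewrite normrN normrM mulrC ler_wpM2r.
have cv : h^-1 *: (f (h *: 1 + t) - f t) @[h --> 0^'] --> x.
  apply/cvgrPdist_le => e e0; have [d d0 hd] := H _ e0.
  rewrite /prop_near1 /dnbhs /within /= -nbhs_ballE; exists d => // h.
  rewrite /ball /= sub0r normrN => hd' h0.
  have := hd _ hd'; rewrite /GRing.scale /= mulr1 (addrC h t) => hh.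
  have -> : x - h^-1 * (f (t + h) - f t) = - (f (t + h) - f t - h * x) / h.
    by field.
  by rewrite normrM normrN normfV ler_pdivrMr ?normr_gt0.
by apply: DeriveDef; [apply/cvg_ex; exists x|exact: cvg_lim cv].
Qed.

Lemma cderivP u t l : cderiv u t l <->
  forall e, 0 < e -> exists2 d, 0 < d &
    forall h : R, `|h| < d -> cmod (u (t + h) - u t - rc h * l) <= e * `|h|.
Proof.
split=> [[/is_deriveP hr /is_deriveP hi] e e0|H].
  have e2 : 0 < e / 2 by rewrite divr_gt0.
  have [d d0 hd] := hr _ e2; have [d' d'0 hd'] := hi _ e2.
  exists (Num.min d d') => [|h]; first by rewrite lt_min d0.
  rewrite lt_min => /andP[/hd h1 /hd' h2].
  rewrite (le_trans (cmod_le _))// (splitr e) mulrDl lerD//.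
  - by rewrite !(cReD, cReN, cReM) /= mul0r subr0.
  - by rewrite !(cImD, cImN, cImM) /= mul0r addr0.
split; apply/is_deriveP => e e0; have [d d0 hd] := H _ e0; exists d => // h /hd.
- by move=> hh; apply: le_trans hh; rewrite (le_trans _ (Re_le _))// !(cReD, cReN, cReM) /= mul0r subr0.
- by move=> hh; apply: le_trans hh; rewrite (le_trans _ (Im_le _))// !(cImD, cImN, cImM) /= mul0r addr0.
Qed.

Lemma cint_FTC a u v : continuous u -> (forall t, cderiv v t (u t)) ->
  cint a u = v (a + 2 * pi) - v a.
Proof.
move=> cu dv; apply: cplxP; rewrite ?(cReD, cImD, cReN, cImN) /=.
- apply: (@pint_FTC a _ (fun t => Re (v t))); first exact: continuousRe.
  by move=> t; have [] := dv t.
- apply: (@pint_FTC a _ (fun t => Im (v t))); first exact: continuousIm.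
  by move=> t; have [] := dv t.
Qed.

Lemma cderivM u v t l m : cderiv u t l -> cderiv v t m ->
  cderiv (fun t => u t * v t) t (l * v t + u t * m).
Proof.
move=> [ur ui] [vr vi]; split.
- rewrite (_ : (fun _ => _) = (fun t => Re (u t)) \* (fun t => Re (v t)) -
      (fun t => Im (u t)) \* (fun t => Im (v t))).
    apply: is_derive_eq; rewrite !(cReD, cReM) /GRing.scale /=; ring.
  by apply/funext => y; rewrite cReM.
- rewrite (_ : (fun _ => _) = (fun t => Re (u t)) \* (fun t => Im (v t)) +
      (fun t => Im (u t)) \* (fun t => Re (v t))).
    apply: is_derive_eq; rewrite !(cImD, cImM) /GRing.scale /=; ring.
  by apply/funext => y; rewrite cImM.
Qed.

Lemma cderiv_cst c t : cderiv (fun=> c) t 0.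
Proof. by split; exact: is_derive_cst. Qed.

Lemma cderivD u v t l m : cderiv u t l -> cderiv v t m ->
  cderiv (fun t => u t + v t) t (l + m).
Proof.
move=> [ur ui] [vr vi]; split.
- rewrite (_ : (fun _ => _) = (fun t => Re (u t)) + (fun t => Re (v t))).
    by apply: is_derive_eq; rewrite cReD.
  by apply/funext => y; rewrite cReD.
- rewrite (_ : (fun _ => _) = (fun t => Im (u t)) + (fun t => Im (v t))).
    by apply: is_derive_eq; rewrite cImD.
  by apply/funext => y; rewrite cImD.
Qed.

Lemma cderivZ c u t l : cderiv u t l -> cderiv (fun t => c * u t) t (c * l).
Proof.
move=> ul; have := cderivM (cderiv_cst c t) ul.
by rewrite mul0r add0r.
Qed.

End CircleIntegrals.
Arguments cplx_contX {R u} n _.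
Arguments cplx_cont_cst {R} c.

(** * Complex series *)

Section Series.
Variable R : realType.
Implicit Types (x y e r B : R) (z w h l : cplx R) (c d : nat -> cplx R).

Lemma cvgnP (u : nat -> cplx R) l : u @ \oo --> l <->
  forall e : R, 0 < e -> exists N, forall n, (N <= n)%N -> cmod (u n - l) < e.
Proof.
split=> [/cvg_cplxP h e e0|h]; first by have [N _ hN] := h e e0; exists N => n /hN.
by apply/cvg_cplxP => e e0; have [N hN] := h e e0; exists N.
Qed.

Lemma cvgn_cmod_le (u : nat -> cplx R) l B : u @ \oo --> l ->
  (forall n, cmod (u n) <= B) -> cmod l <= B.
Proof.
move=> ul uB; apply: (@closed_cvg _ _ \oo _ (fun n => cmod (u n)) [set x | x <= B]).
- exact: closed_le.
- by apply: nearW.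
- exact: cvg_cmod ul.
Qed.

Lemma cvgn_cplxD (u v : nat -> cplx R) l m : u @ \oo --> l -> v @ \oo --> m ->
  (fun n => u n + v n) @ \oo --> l + m.
Proof. move=> ul vm; exact: (cvgD ul vm). Qed.
Lemma cvgn_cplxZ (u : nat -> cplx R) l z : u @ \oo --> l ->
  (fun n => z * u n) @ \oo --> z * l.
Proof. move=> ul; exact: (cvgM (cvg_cst z) ul). Qed.
Lemma cvgn_cplxN (u : nat -> cplx R) l : u @ \oo --> l ->
  (fun n => - u n) @ \oo --> - l.
Proof. move=> ul; exact: (cvgN ul). Qed.

Lemma abs_cvg_series c B : (forall n, \sum_(i < n) cmod (c i) <= B) ->
  exists l, series c @ \oo --> l.
Proof.
move=> cB.
have cvc : cvgn (series (fun n => cmod (c n))).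
  apply: nondecreasing_is_cvgn.
    by apply/nondecreasing_seqP => n; rewrite seriesSr lerDl; exact: cmod_ge0.
  by exists B => _ [n _ <-]; rewrite /series /= big_mkord.
have cvr (f : cplx R -> R) : (forall z, `|f z| <= cmod z) ->
    cvgn (series (fun n => f (c n))).
  move=> fc; apply: normed_cvg; apply: series_le_cvg cvc => // n //=.
have /cvg_ex[/= lr hr] := cvr _ (@Re_le R).
have /cvg_ex[/= li hi] := cvr _ (@Im_le R).
exists (Complex lr li); apply: cvg_ReIm => /=.
- rewrite (_ : (fun _ => _) = series (fun n => Re (c n)))//.
  by apply/funext => n; rewrite /series /= cRe_sum.
- rewrite (_ : (fun _ => _) = series (fun n => Im (c n)))//.
  by apply/funext => n; rewrite /series /= cIm_sum.
Qed.

Lemma geo_le (q : R) n : 0 <= q -> q < 1 -> \sum_(i < n) q ^+ i <= (1 - q)^-1.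
Proof.
move=> q0 q1; have q1' : 0 < 1 - q by rewrite subr_gt0.
rewrite -[leRHS]mul1r ler_pdivlMr// mulrC.
have -> : (1 - q) * \sum_(i < n) q ^+ i = 1 - q ^+ n.
  by rewrite -[RHS]opprB subrX1; ring.
by rewrite gerBl exprn_ge0.
Qed.

Lemma series_terms_bounded c l : series c @ \oo --> l -> exists2 B, 0 <= B & forall n, cmod (c n) <= B.
Proof.
move=> /cvgnP /(_ 1 ltr01)[N hN].
exists (2 + \sum_(i < N) cmod (c i)) => [|n]; first by rewrite addr_ge0// sumr_ge0.
have [nN|Nn] := ltnP n N.
  rewrite (bigD1 (Ordinal nN))//= addrCA lerDl addr_ge0// sumr_ge0//.
have -> : c n = (series c n.+1 - l) - (series c n - l).
  by rewrite seriesSr; ring.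
rewrite (le_trans (cmodD _ _))// cmodN.
have h1 := hN n.+1 (leqW Nn); have h2 := hN n Nn.
have h3 : 0 <= \sum_(i < N) cmod (c i) by rewrite sumr_ge0.
lra.
Qed.

End Series.

(** * Holomorphic functions *)

Section Holomorphic.
Variable R : realType.
Implicit Types (x y e r s K : R) (z w h k l A : cplx R) (f g : cplx R -> cplx R).

Definition cdiff f z A := exists d, exists2 K, 0 < d &
  forall h, cmod h < d -> cmod (f (z + h) - f z - A * h) <= K * cmod h ^+ 2.

(** If both A and A' are derivatives then |A - A'| |h| <= M |h|^2 for small h;
  a real h below b / M, where b = |A - A'|, contradicts this. *)
Lemma cdiff_unique f z A A' : cdiff f z A -> cdiff f z A' -> A = A'.
Proof.
move=> [d [K d0 H]] [d' [K' d'0 H']]; apply/eqP; rewrite -subr_eq0.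
apply/negP => /negP AA'; set b := cmod (A - A').
have b0 : 0 < b by rewrite cmod_gt0.
set M := `|K| + `|K'| + 1.
have M0 : 0 < M by rewrite ltr_wpDl.
set h := Num.min (Num.min d d') (b / M) / 2.
have mn : 0 < Num.min (Num.min d d') (b / M) by rewrite !lt_min d0 d'0 divr_gt0.
have h0 : 0 < h by rewrite divr_gt0.
have [hd [hd' hb]] : h < d /\ h < d' /\ h < b / M.
  have : h < Num.min (Num.min d d') (b / M).
    by rewrite ltr_pdivrMr// ltr_pMr// ltr1n.
  by rewrite !lt_min => /andP[/andP[-> ->] ->].
have ch : cmod (rc h) = h by rewrite cmod_rc gtr0_norm.
have h1 := H (rc h); have h2 := H' (rc h); rewrite !ch in h1 h2.
have h3 : b * h <= M * h ^+ 2.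
  rewrite -ch -cmodM.
  have -> : (A - A') * rc h = (f (z + rc h) - f z - A' * rc h) - (f (z + rc h) - f z - A * rc h).
    by ring.
  rewrite (le_trans (cmodD _ _))// cmodN ch (le_trans (lerD (h2 hd') (h1 hd)))//.
  have := ler_norm K; have := ler_norm K'; have := sqr_ge0 h.
  by rewrite -mulrDl /M; nra.
have : b <= M * h by rewrite -(ler_pM2r h0) -mulrA.
by rewrite leNgt mulrC -ltr_pdivlMr// hb.
Qed.

Definition cderivative f z : cplx R := xget 0 [set A | cdiff f z A].

Lemma cderivativeE f z A : cdiff f z A -> cderivative f z = A.
Proof.
move=> fA; rewrite /cderivative; case: xgetP => [B _ fB|/(_ A)//].
exact: cdiff_unique fB fA.
Qed.

(** Holomorphy near a point, as a quadratic remainder that is uniform near the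
  point. This form passes to products and composites by plain algebra, and it
  contains the regularity of the derivative: see [hol_at_bound]. *)
Definition hol_at f z0 := exists f' : cplx R -> cplx R, exists d, exists2 K, 0 < d &
  forall z h, cmod (z - z0) < d -> cmod h < d ->
    cmod (f (z + h) - f z - f' z * h) <= K * cmod h ^+ 2.

Lemma hol_atP f z0 : hol_at f z0 -> exists d, exists K, [/\ 0 < d, 0 <= K &
  forall z h, cmod (z - z0) < d -> cmod h < d ->
    cmod (f (z + h) - f z - cderivative f z * h) <= K * cmod h ^+ 2].
Proof.
move=> [f' [d [K d0 H]]]; exists d, `|K|; split=> // z h zd hd.
rewrite (@cderivativeE f z (f' z)); last by exists d, K => // h'; exact: H.
by rewrite (le_trans (H _ _ zd hd))// ler_wpM2r ?sqr_ge0// ler_norm.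
Qed.

(** Expanding f from z0 to z and from z back to z0 and adding the two remainders
  leaves (f'(z) - f'(z0)) (z - z0), so the derivative is Lipschitz near z0. *)
Lemma hol_at_bound f z0 : hol_at f z0 -> exists d, exists B, [/\ 0 < d, 0 <= B,
  forall z, cmod (z - z0) < d -> cmod (cderivative f z) <= B,
  forall z, cmod (z - z0) < d ->
    cmod (cderivative f z - cderivative f z0) <= B * cmod (z - z0) &
  forall z h, cmod (z - z0) < d -> cmod h < d -> cmod (f (z + h) - f z) <= B * cmod h].
Proof.
move=> /hol_atP[d [K [d0 K0 H]]].
have L z : cmod (z - z0) < d ->
    cmod (cderivative f z - cderivative f z0) <= 2 * K * cmod (z - z0).
  move=> zd; have [->|zz] := eqVneq z z0; first by rewrite !subrr cmod0 mulr0.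
  have h0 : 0 < cmod (z - z0) by rewrite cmod_gt0 subr_eq0.
  rewrite -(ler_pM2r h0) -cmodM.
  have z00 : cmod (z0 - z0) < d by rewrite subrr cmod0.
  have zd' : cmod (- (z - z0)) < d by rewrite cmodN.
  have := H _ _ z00 zd; have := H _ _ zd zd'; rewrite cmodN.
  have -> : z + - (z - z0) = z0 by ring.
  have -> : z0 + (z - z0) = z by ring.
  move=> h1 h2.
  have -> : (cderivative f z - cderivative f z0) * (z - z0) =
     (f z0 - f z - cderivative f z * - (z - z0)) + (f z - f z0 - cderivative f z0 * (z - z0)).
    by ring.
  by rewrite (le_trans (cmodD _ _))// (le_trans (lerD h1 h2))//; lra.
set B0 := cmod (cderivative f z0) + 2 * K * d.
have B0p : 0 <= B0 by rewrite addr_ge0// !mulr_ge0// ltW.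
have D z : cmod (z - z0) < d -> cmod (cderivative f z) <= B0.
  move=> zd; rewrite -(subrK (cderivative f z0) (cderivative f z)).
  rewrite (le_trans (cmodD _ _))// addrC /B0 lerD2l (le_trans (L _ zd))//.
  by rewrite ler_wpM2l ?mulr_ge0// ltW.
exists d, (B0 + K * d + 2 * K); have Kd : 0 <= K * d by rewrite mulr_ge0// ltW.
have K2 : 0 <= 2 * K by rewrite mulr_ge0.
split=> //; first exact: (addr_ge0 (addr_ge0 B0p Kd) K2).
- by move=> z zd; rewrite (le_trans (D _ zd))// -addrA lerDl addr_ge0// mulr_ge0.
- by move=> z zd; rewrite (le_trans (L _ zd))// ler_wpM2r// lerDr addr_ge0.
move=> z h zd hd.
have -> : f (z + h) - f z = (f (z + h) - f z - cderivative f z * h) + cderivative f z * h.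
  by ring.
rewrite (le_trans (cmodD _ _))// cmodM.
have h1 := H _ _ zd hd; have h2 := D _ zd; have := cmod_ge0 h.
have : K * cmod h ^+ 2 <= K * d * cmod h.
  by rewrite expr2 mulrA ler_wpM2r// ler_wpM2l// ltW.
by nra.
Qed.

Lemma cvg_cplx_atP f z0 l : f z @[z --> z0] --> l <-> forall e, 0 < e ->
  exists2 d, 0 < d & forall z, cmod (z - z0) < d -> cmod (f z - l) < e.
Proof.
have FF : Filter (nbhs (z0 : cplx R)) by exact: nbhs_filter.
split=> [/(@cvg_cplxP R _ (nbhs z0) FF f l).1 H e e0|H].
  exact: (nbhs_cplxP z0 _).1 (H e e0).
apply/(@cvg_cplxP R _ (nbhs z0) FF f l).2 => e e0.
exact: (nbhs_cplxP z0 _).2 (H e e0).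
Qed.

Lemma hol_at_continuous f z0 : hol_at f z0 -> f z @[z --> z0] --> f z0.
Proof.
move=> /hol_at_bound[d [B [d0 B0 _ _ H]]]; apply/cvg_cplx_atP => e e0.
exists (Num.min d (e / (B + 1))).
  by rewrite lt_min d0 divr_gt0// ltr_wpDl.
move=> z; rewrite lt_min => /andP[zd ze].
have := H z0 (z - z0); rewrite subrr cmod0 (_ : z0 + (z - z0) = z); last by ring.
move=> /(_ d0 zd) h; apply: le_lt_trans h _.
rewrite ltr_pdivlMr in ze; last by rewrite ltr_wpDl.
apply: le_lt_trans ze; rewrite mulrC ler_wpM2l// lerDl//.
Qed.

Lemma cderivative_continuous f z0 : hol_at f z0 ->
  cderivative f z @[z --> z0] --> cderivative f z0.
Proof.
move=> /hol_at_bound[d [B [d0 B0 _ H _]]]; apply/cvg_cplx_atP => e e0.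
exists (Num.min d (e / (B + 1))).
  by rewrite lt_min d0 divr_gt0// ltr_wpDl.
move=> z; rewrite lt_min => /andP[zd ze].
apply: le_lt_trans (H _ zd) _.
rewrite ltr_pdivlMr in ze; last by rewrite ltr_wpDl.
apply: le_lt_trans ze; rewrite mulrC ler_wpM2l// lerDl//.
Qed.

Lemma hol_atM f g z0 : hol_at f z0 -> hol_at g z0 -> hol_at (fun z => f z * g z) z0.
Proof.
move=> hf hg.
have [d1 [K1 [d10 K10 H1]]] := hol_atP hf.
have [d2 [K2 [d20 K20 H2]]] := hol_atP hg.
have [d3 [B3 [d30 B30 D3 _ L3]]] := hol_at_bound hf.
have [d4 [B4 [d40 B40 D4 _ L4]]] := hol_at_bound hg.
set f' := cderivative f; set g' := cderivative g.
set M1 := cmod (f z0) + B3 * d3; set M2 := cmod (g z0) + B4 * d4.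
have M10 : 0 <= M1 by rewrite addr_ge0// mulr_ge0// ltW.
have M20 : 0 <= M2 by rewrite addr_ge0// mulr_ge0// ltW.
exists (fun z => f' z * g z + f z * g' z), (Num.min (Num.min d1 d2) (Num.min d3 d4)),
  (K1 * M2 + M1 * K2 + B3 * B4) => [|z h].
  by rewrite !lt_min d10 d20 d30 d40.
rewrite !lt_min => /andP[/andP[z1 z2] /andP[z3 z4]] /andP[/andP[h1 h2] /andP[h3 h4]].
have fz : cmod (f z) <= M1.
  have := L3 z0 (z - z0); rewrite subrr cmod0 (_ : z0 + (z - z0) = z); last by ring.
  move=> /(_ d30 z3) h5; rewrite -(subrK (f z0) (f z)) (le_trans (cmodD _ _))// addrC.
  by rewrite lerD2l (le_trans h5)// ler_wpM2l// ltW.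
have gz : cmod (g z) <= M2.
  have := L4 z0 (z - z0); rewrite subrr cmod0 (_ : z0 + (z - z0) = z); last by ring.
  move=> /(_ d40 z4) h5; rewrite -(subrK (g z0) (g z)) (le_trans (cmodD _ _))// addrC.
  by rewrite lerD2l (le_trans h5)// ler_wpM2l// ltW.
have -> : f (z + h) * g (z + h) - f z * g z - (f' z * g z + f z * g' z) * h =
   (f (z + h) - f z - f' z * h) * g z + f z * (g (z + h) - g z - g' z * h) +
   (f (z + h) - f z) * (g (z + h) - g z) by ring.
rewrite [leRHS](_ : _ = K1 * M2 * cmod h ^+ 2 + M1 * K2 * cmod h ^+ 2 +
    B3 * B4 * cmod h ^+ 2); last by ring.
apply: le_trans (cmodD _ _) _; apply: lerD.
  apply: le_trans (cmodD _ _) _; rewrite !cmodM; apply: lerD.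
    by rewrite [leRHS]mulrAC ler_pM// H1.
  by rewrite -[leRHS]mulrA ler_pM// H2.
rewrite cmodM expr2 [leRHS]mulrACA ler_pM//; [exact: L3|exact: L4].
Qed.

Lemma hol_at_comp f g z0 : hol_at f (g z0) -> hol_at g z0 -> hol_at (f \o g) z0.
Proof.
move=> hf hg.
have [d1 [K1 [d10 K10 H1]]] := hol_atP hf.
have [d2 [K2 [d20 K20 H2]]] := hol_atP hg.
have [d3 [B3 [d30 B30 D3 _ L3]]] := hol_at_bound hf.
have [d4 [B4 [d40 B40 D4 _ L4]]] := hol_at_bound hg.
set f' := cderivative f; set g' := cderivative g.
set m := Num.min (Num.min d2 d4) (Num.min d1 d3 / (B4 + 1)).
have B41 : 0 < B4 + 1 by rewrite ltr_wpDl.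
have m0 : 0 < m by rewrite !lt_min d20 d40 divr_gt0// lt_min d10.
exists (fun z => f' (g z) * g' z), m, (K1 * B4 ^+ 2 + B3 * K2) => // z h.
rewrite !lt_min => /andP[/andP[z2 z4] z1] /andP[/andP[h2 h4] h1].
have sm k : cmod k < Num.min d1 d3 / (B4 + 1) -> B4 * cmod k < Num.min d1 d3.
  rewrite ltr_pdivlMr// => hk; apply: le_lt_trans hk.
  by rewrite mulrC ler_wpM2l// lerDl.
have gz : cmod (g z - g z0) < Num.min d1 d3.
  have := L4 z0 (z - z0); rewrite subrr cmod0 (_ : z0 + (z - z0) = z); last by ring.
  by move=> /(_ d40 z4) h5; apply: le_lt_trans h5 _; exact: sm.
have gh := L4 _ _ z4 h4.
have gh' : cmod (g (z + h) - g z) < Num.min d1 d3 by apply: le_lt_trans gh _; exact: sm.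
move: gz gh'; rewrite !lt_min => /andP[gz1 gz3] /andP[gh1 gh3].
have := H1 _ _ gz1 gh1.
have -> : g z + (g (z + h) - g z) = g (z + h) by ring.
move=> h5 /=.
have -> : f (g (z + h)) - f (g z) - f' (g z) * g' z * h =
  (f (g (z + h)) - f (g z) - f' (g z) * (g (z + h) - g z)) +
  f' (g z) * (g (z + h) - g z - g' z * h) by ring.
rewrite [leRHS](_ : _ = K1 * B4 ^+ 2 * cmod h ^+ 2 + B3 * K2 * cmod h ^+ 2); last by ring.
apply: le_trans (cmodD _ _) _; apply: lerD.
  apply: le_trans h5 _; rewrite -mulrA ler_wpM2l// -exprMn lerXn2r ?nnegrE//.
  by rewrite mulr_ge0.
by rewrite cmodM -[leRHS]mulrA ler_pM//; [exact: D3|exact: H2].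
Qed.

End Holomorphic.

(** * Power series *)

Section PowerSeries.
Variable R : realType.
Implicit Types (x y e r s B : R) (z w h k l A : cplx R) (f g : cplx R -> cplx R) (a : nat -> cplx R).

Definition ps_on a z0 r f := forall z, cmod (z - z0) < r ->
  series (fun n => a n * (z - z0) ^+ n) @ \oo --> f z.

Lemma ps_coef_bound a z0 r s f : ps_on a z0 r f -> 0 <= s -> s < r ->
  exists2 B, 0 <= B & forall n, cmod (a n) * s ^+ n <= B.
Proof.
move=> af s0 sr; have h := af (z0 + rc s).
have E : z0 + rc s - z0 = rc s by ring.
rewrite E cmod_rc ger0_norm// in h; have [B B0 hB] := series_terms_bounded (h sr).
by exists B => // n; have := hB n; rewrite cmodM cmodX cmod_rc ger0_norm.
Qed.

Lemma geo_sum_le a B r s N : 0 <= B -> 0 < r -> (forall n, cmod (a n) * r ^+ n <= B) ->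
  0 <= s -> s < r -> \sum_(i < N) cmod (a i) * s ^+ i <= B / (1 - s / r).
Proof.
move=> B0 r0 aB s0 sr.
have q0 : 0 <= s / r by rewrite divr_ge0// ltW.
have q1 : s / r < 1 by rewrite ltr_pdivrMr// mul1r.
apply: (@le_trans _ _ (\sum_(i < N) B * (s / r) ^+ i)).
  apply: ler_sum => i _; rewrite expr_div_n mulrA ler_pdivlMr ?exprn_gt0//.
  by rewrite mulrAC ler_wpM2r ?exprn_ge0.
by rewrite -mulr_sumr ler_wpM2l// geo_le.
Qed.

(** This bound and the next are homogeneous in h, with the power (x + y)^n on the
  right: summed against the coefficients of a power series they give a geometric
  series as soon as x + y is below the radius of convergence. *)
Lemma pow_diff1 w h x y n : 0 < y -> cmod w <= x -> cmod h <= y ->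
  cmod ((w + h) ^+ n - w ^+ n) <= cmod h / y * (x + y) ^+ n.
Proof.
move=> y0 wx hy; have x0 : 0 <= x := le_trans (cmod_ge0 w) wx.
have whxy : cmod (w + h) <= x + y by rewrite (le_trans (cmodD _ _))// lerD.
have hy0 : 0 <= cmod h / y by rewrite divr_ge0// ltW.
elim: n => [|n IH]; first by rewrite !expr0 subrr cmod0 mulr1.
have -> : (w + h) ^+ n.+1 - w ^+ n.+1 = w * ((w + h) ^+ n - w ^+ n) + h * (w + h) ^+ n.
  by rewrite !exprS; ring.
rewrite (le_trans (cmodD _ _))// !cmodM cmodX exprS.
have -> : cmod h / y * ((x + y) * (x + y) ^+ n) =
   x * (cmod h / y * (x + y) ^+ n) + cmod h * (x + y) ^+ n.
  by field; rewrite gt_eqF.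
apply: lerD; first exact: ler_pM.
have xy0 : 0 <= x + y := le_trans (cmod_ge0 _) whxy.
by rewrite ler_wpM2l// lerXn2r// nnegrE.
Qed.

Lemma pow_diff2 w h x y n : 0 < y -> cmod w <= x -> cmod h <= y ->
  cmod ((w + h) ^+ n - w ^+ n - n%:R * w ^+ n.-1 * h) <=
  (cmod h / y) ^+ 2 * (x + y) ^+ n.
Proof.
move=> y0 wx hy; have x0 : 0 <= x := le_trans (cmod_ge0 w) wx.
elim: n => [|n IH].
  by rewrite !expr0 subrr !mul0r subr0 cmod0 mulr_ge0// sqr_ge0.
have E : n.+1%:R * w ^+ n * h = w * (n%:R * w ^+ n.-1 * h) + w ^+ n * h.
  by case: n {IH} => [|n]; rewrite ?expr0 /= -?natr1 ?exprS; ring.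
have -> : (w + h) ^+ n.+1 - w ^+ n.+1 - n.+1%:R * w ^+ n.+1.-1 * h =
    w * ((w + h) ^+ n - w ^+ n - n%:R * w ^+ n.-1 * h) + h * ((w + h) ^+ n - w ^+ n).
  by rewrite [_.+1.-1]/= E !exprS; ring.
rewrite (le_trans (cmodD _ _))// !cmodM (exprS (x + y)).
have -> : (cmod h / y) ^+ 2 * ((x + y) * (x + y) ^+ n) =
   x * ((cmod h / y) ^+ 2 * (x + y) ^+ n) + cmod h * (cmod h / y * (x + y) ^+ n).
  by field; rewrite gt_eqF.
apply: lerD; first exact: ler_pM.
by rewrite ler_wpM2l// pow_diff1.
Qed.

Lemma pow_deriv_le x y n : 0 <= x -> 0 <= y ->
  n%:R * x ^+ n.-1 * y <= (x + y) ^+ n.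
Proof.
move=> x0 y0; elim: n => [|n IH]; first by rewrite !mul0r expr0.
have -> : n.+1%:R * x ^+ n.+1.-1 * y = x * (n%:R * x ^+ n.-1 * y) + y * x ^+ n.
  by case: n {IH} => [|n]; rewrite ?expr0 /= -?natr1 ?exprS; ring.
rewrite exprS mulrDl lerD// ?ler_wpM2l//.
by rewrite lerXn2r ?nnegrE// ?addr_ge0// lerDl.
Qed.

(** Termwise differentiation: [pow_diff2] bounds the remainder of each monomial at
  radius x + y < rho < r, and |a n| rho^n stays bounded. *)
Lemma ps_hol a z0 r f z1 : ps_on a z0 r f -> cmod (z1 - z0) < r -> hol_at f z1.
Proof.
move=> af z1r; set s := cmod (z1 - z0); pose rho := (s + r) / 2.
have s0 : 0 <= s by exact: cmod_ge0.
have sr0 : s < r by [].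
have sr : s < rho by rewrite /rho; lra.
have rr : rho < r by rewrite /rho; lra.
have rho0 : 0 < rho by apply: le_lt_trans sr.
have [B B0 aB] := ps_coef_bound af (ltW rho0) rr.
pose y := (rho - s) / 4; pose x := s + y.
have y0 : 0 < y by rewrite /y; lra.
have x0 : 0 <= x by rewrite addr_ge0// ltW.
have xy0 : 0 <= x + y by rewrite addr_ge0// ltW.
have xyr : x + y < rho by rewrite /x /y; lra.
have S N : \sum_(i < N) cmod (a i) * (x + y) ^+ i <= B / (1 - (x + y) / rho).
  exact: geo_sum_le.
set C := B / (1 - (x + y) / rho) in S.
pose f' z := lim (series (fun n => a n * (n%:R * (z - z0) ^+ n.-1)) @ \oo).
exists f', y, (C / y ^+ 2) => // z h zy hy.
have wx : cmod (z - z0) <= x.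
  rewrite (_ : z - z0 = (z1 - z0) + (z - z1)); last by ring.
  by rewrite (le_trans (cmodD _ _))// lerD2l ltW.
have c1 : series (fun n => a n * (n%:R * (z - z0) ^+ n.-1)) @ \oo --> f' z.
  have [|l hl] := @abs_cvg_series R (fun n => a n * (n%:R * (z - z0) ^+ n.-1)) (C / y).
    move=> N; rewrite ler_pdivlMr// mulr_suml; apply: le_trans (S N).
    apply: ler_sum => i _; rewrite cmodM -mulrA ler_wpM2l//.
    have e1 : cmod (i%:R : cplx R) = i%:R.
      have -> : (i%:R : cplx R) = rc i%:R.
        by elim: (i : nat) => // n IH; rewrite -!natr1 rcD IH.
      by rewrite cmod_rc ger0_norm.
    rewrite cmodM cmodX e1; apply: le_trans (pow_deriv_le i x0 (ltW y0)).
    by rewrite ler_wpM2r ?(ltW y0)// ler_wpM2l// lerXn2r ?nnegrE.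
  by have -> : f' z = l by apply: lim_cplxP hl.
have c2 : series (fun n => a n * (z - z0) ^+ n) @ \oo --> f z.
  by apply: af; apply: le_lt_trans wx _; rewrite (lt_trans _ rr)// /x /y; lra.
have c3 : series (fun n => a n * (z + h - z0) ^+ n) @ \oo --> f (z + h).
  apply: af; rewrite (_ : z + h - z0 = (z - z0) + h); last by ring.
  apply: le_lt_trans (cmodD _ _) _; apply: le_lt_trans (lerD wx (ltW hy)) _.
  by apply: lt_trans rr.
have c4 := cvgn_cplxD (cvgn_cplxD c3 (cvgn_cplxN c2)) (cvgn_cplxN (@cvgn_cplxZ _ _ _ h c1)).
rewrite (mulrC (f' z)); apply: (cvgn_cmod_le c4) => N.
have -> : series (fun n => a n * (z + h - z0) ^+ n) N +
   - series (fun n => a n * (z - z0) ^+ n) N +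
   - (h * series (fun n => a n * (n%:R * (z - z0) ^+ n.-1)) N) =
   \sum_(i < N) a i * ((z - z0 + h) ^+ i - (z - z0) ^+ i - i%:R * (z - z0) ^+ i.-1 * h).
  rewrite /series /= !big_mkord mulr_sumr -!sumrB; apply: eq_bigr => i _.
  by rewrite (_ : z + h - z0 = z - z0 + h); ring.
rewrite (le_trans (cmod_sum _ _ _))//.
rewrite (_ : C / y ^+ 2 * cmod h ^+ 2 = (cmod h / y) ^+ 2 * C); last first.
  by field; rewrite gt_eqF.
apply: le_trans (_ : (cmod h / y) ^+ 2 * \sum_(i < N) cmod (a i) * (x + y) ^+ i <= _).
  rewrite mulr_sumr; apply: ler_sum => i _; rewrite cmodM mulrCA ler_wpM2l//.
  by apply: pow_diff2 => //; exact: ltW.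
by rewrite ler_wpM2l// sqr_ge0.
Qed.

Lemma analytic_hol D f z : analytic_on D f -> D z -> hol_at f z.
Proof.
move=> fD /fD[a [r [r0 h]]]; apply: (@ps_hol a z r) => //.
by rewrite subrr cmod0.
Qed.

Lemma hol_at_shift f z0 z : hol_at f (z0 + z) -> hol_at (fun w => f (z0 + w)) z.
Proof.
move=> [f' [d [K d0 H]]]; exists (fun w => f' (z0 + w)), d, K => // w h wd hd.
rewrite addrA; apply: H => //.
by rewrite (_ : _ - _ = w - z)//; ring.
Qed.

End PowerSeries.

(** * The Cauchy integral formula *)

Section Circle.
Variable R : realType.
Implicit Types (x y e r s t B : R) (z w h k l A : cplx R) (f g : cplx R -> cplx R).

Notation circ := (@circle_pt R).
Notation ci := (Complex 0 1 : cplx R).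

Lemma cmod_circ t : cmod (circ t) = 1.
Proof.
apply/eqP; rewrite -(@eqrXn2 _ 2)// ?cmod_ge0// cmod_sqr /= cos2Dsin2 expr1n.
by [].
Qed.

Lemma circ_neq0 t : circ t != 0.
Proof. by rewrite -cmod_gt0 cmod_circ. Qed.

Lemma circ_cont : continuous circ.
Proof.
by apply: continuous_ReIm => t /=; [exact: continuous_cos|exact: continuous_sin].
Qed.

Lemma circ_period t : circ (t + 2 * pi) = circ t.
Proof.
by apply: cplxP => /=; rewrite (_ : 2 * pi = pi *+ 2) ?mulr_natl// ?cosD2pi ?sinD2pi.
Qed.

Lemma conj_circ t : cconj (circ t) = (circ t)^-1.
Proof.
apply: (mulfI (circ_neq0 t)); rewrite mulcconj cmod_circ expr1n divff//.
exact: circ_neq0.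
Qed.

Lemma cderiv_circ t : cderiv circ t (ci * circ t).
Proof.
split => /=.
- by apply: is_derive_eq; rewrite mul0r mul1r sub0r.
- by apply: is_derive_eq; rewrite mul0r mul1r add0r.
Qed.

Lemma cderiv_circX n t : cderiv (fun t => circ t ^+ n) t (n%:R * ci * circ t ^+ n).
Proof.
elim: n => [|n IH]; first by rewrite !mul0r; exact: (cderiv_cst 1).
rewrite (_ : (fun _ => _) = (fun t => circ t * circ t ^+ n)); last first.
  by apply/funext => y; rewrite exprS.
have -> : n.+1%:R * ci * circ t ^+ n.+1 =
    ci * circ t * circ t ^+ n + circ t * (n%:R * ci * circ t ^+ n).
  by rewrite exprS -natr1; ring.
exact: (cderivM (@cderiv_circ t) IH).
Qed.

Lemma cint_circX a n : (0 < n)%N -> cint a (fun t => circ t ^+ n) = 0.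
Proof.
move=> n0; have cn := cplx_contX n circ_cont.
have := @cint_FTC _ a (fun t => n%:R * ci * circ t ^+ n) _
  (cplx_contM (cplx_cont_cst _) cn) (cderiv_circX n).
rewrite cintZ// circ_period subrr => /eqP; rewrite mulf_eq0 => /orP[|/eqP//].
rewrite mulf_eq0 => /orP[|/eqP[/eqP]]; last by rewrite oner_eq0.
by rewrite pnatr_eq0 -[n == _]negbK -lt0n n0.
Qed.

Lemma cint_conj a (u : R -> cplx R) : continuous u ->
  cint a (fun t => cconj (u t)) = cconj (cint a u).
Proof.
move=> cu; apply: cplxP => /=.
  by congr pint; apply/funext => t; case: (u t).
rewrite -mulN1r -pintZ; last exact: continuousIm.
by congr pint; apply/funext => t; case: (u t) => /= *; rewrite mulN1r.
Qed.

Lemma cconjX z n : cconj (z ^+ n) = cconj z ^+ n.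
Proof. by rewrite /cconj; elim: n => [|n IH]; rewrite ?expr0 ?conjc1 // !exprS -IH rmorphM. Qed.

Lemma cint_circVX a n : (0 < n)%N -> cint a (fun t => (circ t)^-1 ^+ n) = 0.
Proof.
move=> n0; rewrite (@eq_cint _ a _ (fun t => cconj (circ t ^+ n))).
  by rewrite cint_conj ?cint_circX//; [exact: conjc0|exact: cplx_contX circ_cont].
by move=> t; rewrite cconjX conj_circ.
Qed.

(** The Cauchy kernel zeta / (zeta - z) is the sum of the powers (z / zeta)^i, with
  remainder (z / zeta)^N zeta / (zeta - z). *)
Lemma cauchy_expand a (g : R -> cplx R) r z : continuous g -> 0 < r -> cmod z < r ->
  exists C, forall N,
    cmod (cint a (fun t => g t * (rc r * circ t / (rc r * circ t - z))) -
      \sum_(i < N) cint a (fun t => g t * (rc r * circ t)^-1 ^+ i) * z ^+ i) <=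
    C * (cmod z / r) ^+ N.
Proof.
move=> cg r0 zr.
have mr t : cmod (rc r * circ t) = r.
  by rewrite cmodM cmod_circ mulr1 cmod_rc gtr0_norm.
have r_neq0 t : rc r * circ t != 0 by rewrite -cmod_gt0 mr.
have rr0 : rc r != 0 by rewrite -cmod_gt0 cmod_rc normr_gt0 gt_eqF.
have rz t : r - cmod z <= cmod (rc r * circ t - z).
  by rewrite -[X in X - _](mr t) cmod_sub.
have rz0 t : rc r * circ t - z != 0.
  by rewrite -cmod_gt0 (lt_le_trans _ (rz t))// subr_gt0.
have crc : continuous (fun t => rc r * circ t).
  exact: (cplx_contM (cplx_cont_cst _) circ_cont).
have cinv : continuous (fun t => (rc r * circ t)^-1) by exact: (cplx_contV crc r_neq0).
have ck : continuous (fun t => rc r * circ t / (rc r * circ t - z)).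
  exact: (cplx_contM crc (cplx_contV (cplx_contD crc (cplx_cont_cst (- z))) rz0)).
pose M := pint a (fun t => cmod (g t)).
exists (2 * (M * (r / (r - cmod z)))) => N.
have E t : g t * (rc r * circ t / (rc r * circ t - z)) =
   \sum_(i < N) z ^+ i * (g t * (rc r * circ t)^-1 ^+ i) +
   (z / (rc r * circ t)) ^+ N * (g t * (rc r * circ t / (rc r * circ t - z))).
  set k := _ / _.
  have kE : k * (1 - z / (rc r * circ t)) = 1.
    by rewrite /k; field; rewrite ?rz0 ?circ_neq0 ?rr0.
  have -> : \sum_(i < N) z ^+ i * (g t * (rc r * circ t)^-1 ^+ i) =
     g t * \sum_(i < N) (z / (rc r * circ t)) ^+ i.
    by rewrite mulr_sumr; apply: eq_bigr => i _; rewrite exprMn; ring.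
  set q := z / _ in kE *.
  have sq : (1 - q) * \sum_(i < N) q ^+ i = 1 - q ^+ N.
    by rewrite -[RHS]opprB subrX1; ring.
  have -> : \sum_(i < N) q ^+ i = k * (1 - q ^+ N) by rewrite -sq mulrA kE mul1r.
  by ring.
have cgk : continuous (fun t => g t * (rc r * circ t / (rc r * circ t - z))).
  exact: (cplx_contM cg ck).
have cgi i : continuous (fun t => z ^+ i * (g t * (rc r * circ t)^-1 ^+ i)).
  exact: (cplx_contM (cplx_cont_cst _) (cplx_contM cg (cplx_contX i cinv))).
have cq : continuous (fun t => (z / (rc r * circ t)) ^+ N).
  exact: (cplx_contX N (cplx_contM (cplx_cont_cst z) cinv)).
rewrite (eq_cint a E) cintD; [|exact: (@cplx_cont_sum _ 'I_N _ (fun i : 'I_N => _) (fun i => cgi i))|exact: (cplx_contM cq cgk)].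
rewrite (@cint_sum _ a 'I_N _ (fun (i : 'I_N) t => z ^+ i * (g t * (rc r * circ t)^-1 ^+ i)) (fun i => cgi i)).
have -> : \sum_(i < N) cint a (fun t => z ^+ i * (g t * (rc r * circ t)^-1 ^+ i)) =
  \sum_(i < N) cint a (fun t => g t * (rc r * circ t)^-1 ^+ i) * z ^+ i.
  apply: eq_bigr => i _; rewrite mulrC.
  exact: (@cintZ _ a (z ^+ i) _ (cplx_contM cg (cplx_contX i cinv))).
rewrite addrAC subrr add0r.
have cgm := continuous_cmod cg.
have crm c : continuous (fun t => c * cmod (g t) : R).
  by move=> t; apply: cvgM; [exact: cvg_cst|exact: cgm].
apply: le_trans (@cint_le _ a _ (fun t => (cmod z / r) ^+ N * (r / (r - cmod z)) * cmod (g t)) _ _ _) _.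
- exact: (cplx_contM cq cgk).
- exact: crm.
- move=> t _; rewrite cmodM cmodX (cmodM z) cmodV mr (cmodM (g t)) (cmodM (rc r * circ t)) mr cmodV.
  rewrite -mulrA ler_wpM2l ?exprn_ge0 ?divr_ge0 ?cmod_ge0 ?(ltW r0)//.
  rewrite mulrC ler_wpM2r ?cmod_ge0// ler_wpM2l ?(ltW r0)//.
  by rewrite lef_pV2 ?posrE ?subr_gt0// (lt_le_trans _ (rz t))// subr_gt0.
rewrite pintZ// /M le_eqVlt; apply/orP; left; apply/eqP; ring.
Qed.

Lemma geo_le0 x C q : 0 <= q -> q < 1 -> (forall N, x <= C * q ^+ N) -> x <= 0.
Proof.
move=> q0 q1 H.
have lim0 : (fun n => C * q ^+ n) @ \oo --> (0 : R).
  rewrite -[X in _ --> X](mulr0 C); apply: cvgM; first exact: cvg_cst.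
  by apply: cvg_expr; rewrite ger0_norm.
apply: (@closed_cvg _ _ \oo _ (fun n => C * q ^+ n) [set y | x <= y] _ _ _ lim0).
  exact: closed_ge.
exact: nearW.
Qed.

Lemma cint_cauchy_kernel a r z : 0 < r -> cmod z < r ->
  cint a (fun t => rc r * circ t / (rc r * circ t - z)) = rc (2 * pi).
Proof.
move=> r0 zr.
have [C hC] := @cauchy_expand a (fun=> 1) r z (cplx_cont_cst 1) r0 zr.
have E : cint a (fun t => 1 * (rc r * circ t / (rc r * circ t - z))) =
   cint a (fun t => rc r * circ t / (rc r * circ t - z)).
  by apply: eq_cint => t; rewrite mul1r.
rewrite E in hC; set I := cint a _ in hC *.
apply/eqP; rewrite -subr_eq0; apply/eqP/cmod_eq0/eqP.
rewrite eq_le cmod_ge0 andbT.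
have q0 : 0 <= cmod z / r by rewrite divr_ge0// ltW.
have q1 : cmod z / r < 1 by rewrite ltr_pdivrMr// mul1r.
apply: (@geo_le0 _ (C * (cmod z / r)) _ q0 q1) => N.
rewrite -mulrA -exprS; apply: le_trans (hC N.+1); rewrite big_ord_recl big1 ?addr0.
  rewrite (@eq_cint _ a _ (fun=> 1)) ?cint_cst ?mulr1 ?expr0 ?mulr1// => t.
  by rewrite expr0 mulr1.
move=> i _; rewrite (@eq_cint _ a _ (fun t => (rc r)^-1 ^+ i.+1 * (circ t)^-1 ^+ i.+1)).
  rewrite (@cintZ _ a _ _ (cplx_contX i.+1 (cplx_contV circ_cont circ_neq0))) cint_circVX//.
  by rewrite mulr0 mul0r.
by move=> t; rewrite mul1r invfM exprMn.
Qed.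

(** The remainder bounds at the points of a closed curve are made uniform by
  compactness of the period. One number e serves both as the size allowed for h
  and as the inverse of the constant. *)
Lemma uniform_remainder a f (p : R -> cplx R) : continuous p ->
  (forall t, period a t -> hol_at f (p t)) -> exists2 e, 0 < e &
  forall t h, period a t -> cmod h < e ->
    e * cmod (f (p t + h) - f (p t) - cderivative f (p t) * h) <= cmod h ^+ 2.
Proof.
move=> cp fp.
have := (compact_near_coveringP (period a)).1 (@segment_compact R a (a + 2 * pi)).
pose P e t := forall h, cmod h < e ->
    e * cmod (f (p t + h) - f (p t) - cderivative f (p t) * h) <= cmod h ^+ 2.
move=> /(_ R 0^'+ P _)[].
  move=> t /fp/hol_atP[d [K [d0 K0 H]]].
  exists ([set s | cmod (p s - p t) < d], [set e | 0 < e /\ e < Num.min d (K + 1)^-1]) => /=.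
    split; first exact: (@cvg_cplxP R _ (nbhs t) _ p (p t)).1 (cp t) _ d0.
    have m0 : 0 < Num.min d (K + 1)^-1 by rewrite lt_min d0 invr_gt0 ltr_wpDl.
    near=> e; split; near: e; [exact: nbhs_right_gt|exact: nbhs_right_lt].
  move=> [s e] /= [sd [e0]]; rewrite lt_min => /andP[ed eK] h he.
  apply: le_trans (ler_wpM2l (ltW e0) (H _ _ sd (lt_trans he ed))) _.
  rewrite mulrA ler_piMl// ?sqr_ge0//.
  have : e * (K + 1) < 1 by rewrite -ltr_pdivlMr ?mul1r// ltr_wpDl.
  by rewrite mulrDr mulr1; lra.
move=> e0 [/= e0p H].
have : 0^'+ [set e : R | 0 < e /\ period a `<=` P e].
  near=> e; split; near: e; first exact: nbhs_right_gt.
  by exists e0.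
move=> /filter_ex[e [ep eP]]; exists e => // t h at'.
exact: eP.
Unshelve. all: by end_near. Qed.

Lemma cderiv_comp f (p : R -> cplx R) t l : hol_at f (p t) -> cderiv p t l ->
  cderiv (fun t => f (p t)) t (cderivative f (p t) * l).
Proof.
move=> /hol_atP[d [K [d0 K0 H]]] pt; apply/cderivP => e e0.
set D := cderivative f (p t) in H *.
have DD : 0 < cmod D + 1 by rewrite ltr_wpDl// cmod_ge0.
have [d1 d10 H1] := (cderivP p t l).1 pt _ ltr01.
have [d2 d20 H2] := (cderivP p t l).1 pt _ (divr_gt0 (divr_gt0 e0 (ltr0Sn R 1)) DD).
pose L := cmod l + 1.
have L0 : 0 < L by rewrite ltr_wpDl// cmod_ge0.
have KL : 0 < K * L ^+ 2 + 1 by rewrite ltr_wpDl// mulr_ge0// sqr_ge0.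
exists (Num.min (Num.min d1 d2) (Num.min (d / L) (e / 2 / (K * L ^+ 2 + 1)))).
  by rewrite !lt_min d10 d20 !divr_gt0.
move=> h; rewrite !lt_min => /andP[/andP[h1 h2] /andP[h3 h4]].
have {}H1 := H1 _ h1; have {}H2 := H2 _ h2.
have h4' : `|h| * (K * L ^+ 2 + 1) < e / 2 by rewrite -ltr_pdivlMr.
have pL : cmod (p (t + h) - p t) <= L * `|h|.
  rewrite -[p _ - _](subrK (rc h * l)) (le_trans (cmodD _ _))//.
  by rewrite cmodM cmod_rc /L; lra.
have pd : cmod (p (t + h) - p t) < d.
  by apply: le_lt_trans pL _; rewrite mulrC -ltr_pdivlMr.
have := H (p t) (p (t + h) - p t); rewrite subrr cmod0 => /(_ d0 pd).
have -> : p t + (p (t + h) - p t) = p (t + h) by ring.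
move=> H3.
have -> : f (p (t + h)) - f (p t) - rc h * (D * l) =
  (f (p (t + h)) - f (p t) - D * (p (t + h) - p t)) + D * (p (t + h) - p t - rc h * l).
  by ring.
rewrite (le_trans (cmodD _ _))// [leRHS](_ : _ = e / 2 * `|h| + e / 2 * `|h|); last by field.
apply: lerD.
  apply: le_trans H3 _; apply: le_trans (_ : K * (L * `|h|) ^+ 2 <= _).
    by rewrite ler_wpM2l// lerXn2r ?nnegrE ?cmod_ge0// mulr_ge0// ltW.
  rewrite [leLHS](_ : _ = K * L ^+ 2 * `|h| * `|h|); last by ring.
  rewrite ler_wpM2r// (le_trans _ (ltW h4'))// mulrDr mulr1 mulrC lerDl//.
rewrite cmodM; apply: le_trans (ler_wpM2l (cmod_ge0 D) H2) _.
rewrite mulrA ler_wpM2r//.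
by rewrite mulrA ler_pdivrMr// mulrDr mulr1 mulrC lerDl divr_ge0// ltW.
Qed.

(** Contract the circle to z along segments: p s t = z + s (zeta t - z), and let
  phi s be the integral of f (p s t) against the Cauchy kernel. The kernel times
  (zeta t - z) is zeta t, so the derivative of phi at s is the integral of
  f' (p s t) zeta t, which is up to a factor the integral of the derivative of
  t |-> f (p s t) over a period, hence 0. So phi 1, the Cauchy integral, equals
  phi 0, which is f z times the integral of the kernel. *)
Lemma cauchy_formula a f r0 r z :
  (forall w, cmod w < r0 -> hol_at f w) -> 0 < r -> r < r0 -> cmod z < r ->
  cint a (fun t => f (rc r * circ t) * (rc r * circ t / (rc r * circ t - z))) =
  rc (2 * pi) * f z.
Proof.
move=> holf rp rr0 zr.
have mr t : cmod (rc r * circ t) = r.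
  by rewrite cmodM cmod_circ mulr1 cmod_rc gtr0_norm.
have rz t : r - cmod z <= cmod (rc r * circ t - z).
  by rewrite -[X in X - _](mr t) cmod_sub.
have rz0 t : rc r * circ t - z != 0.
  by rewrite -cmod_gt0 (lt_le_trans _ (rz t))// subr_gt0.
have crc : continuous (fun t => rc r * circ t).
  exact: (cplx_contM (cplx_cont_cst _) circ_cont).
have ck : continuous (fun t => rc r * circ t / (rc r * circ t - z)).
  exact: (cplx_contM crc (cplx_contV (cplx_contD crc (cplx_cont_cst (- z))) rz0)).
pose p s t := z + rc s * (rc r * circ t - z).
have cp s : continuous (p s).
  exact: (cplx_contD (cplx_cont_cst z) (cplx_contM (cplx_cont_cst (rc s)) (cplx_contD crc (cplx_cont_cst (- z))))).
pose dom s := (`|1 - s| + `|s|) * r < r0.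
have pr s t : dom s -> cmod (p s t) < r0.
  apply: le_lt_trans.
  have -> : p s t = rc (1 - s) * z + rc s * (rc r * circ t).
    by rewrite /p; apply: cplxP; rewrite ?(cReD, cImD, cReM, cImM, cReN, cImN) /=; ring.
  rewrite (le_trans (cmodD _ _))// cmodM (cmodM (rc s)) mr !cmod_rc mulrDl lerD//.
  by rewrite ler_wpM2l// ltW.
(* phi is differentiated at the ends of [0, 1] too, so s has to move a little
   outside: dom s says that the contracted circle stays where f is holomorphic. *)
have dom01 s (h : R) : 0 <= s <= 1 -> `|h| < (r0 - r) / (2 * r) -> dom (s + h).
  move=> /andP[s0 s1]; rewrite ltr_pdivlMr ?mulr_gt0// => hr.
  apply: (@le_lt_trans _ _ ((1 + 2 * `|h|) * r)); last by lra.
  rewrite ler_wpM2r// ?(ltW rp)//.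
  have := ler_normD (1 - s) (- h); have := ler_normD s h.
  rewrite normrN (ger0_norm s0) (ger0_norm (_ : 0 <= 1 - s)) ?subr_ge0// opprD addrA.
  by lra.
have dom01' s : 0 <= s <= 1 -> dom s.
  by move=> s01; rewrite -(addr0 s); apply: dom01 => //; rewrite normr0 divr_gt0 ?mulr_gt0// subr_gt0.
have cfp s : dom s -> continuous (fun t => f (p s t)).
  move=> s01 t; apply: (cvg_comp (p s) f (cp s t)).
  exact: hol_at_continuous (holf _ (pr s t s01)).
have cdp s : dom s -> continuous (fun t => cderivative f (p s t)).
  move=> s01 t; apply: (cvg_comp (p s) (cderivative f) (cp s t)).
  exact: cderivative_continuous (holf _ (pr s t s01)).
pose phi s := cint a (fun t => f (p s t) * (rc r * circ t / (rc r * circ t - z))).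
(* For s <> 0 the integrand is the t-derivative of f (p s t) up to the factor
   i s; for s = 0 it is a multiple of zeta. *)
have zero s : dom s ->
    cint a (fun t => cderivative f (p s t) * (rc r * circ t)) = 0.
  move=> s01; have [s0|s0] := eqVneq s 0.
    rewrite (@eq_cint _ a _ (fun t => cderivative f z * rc r * circ t ^+ 1)).
      by rewrite (@cintZ _ a _ _ (cplx_contX 1 circ_cont)) cint_circX// mulr0.
    by move=> t; rewrite /p s0 rc0 mul0r addr0 expr1 mulrA.
  have dp t : cderiv (fun t => f (p s t)) t
      (cderivative f (p s t) * (rc s * (rc r * (ci * circ t)))).
    apply: cderiv_comp; first exact: holf (pr s t s01).
    have h1 := cderivD (cderivZ (rc r) (cderiv_circ t)) (cderiv_cst (- z) t).
    have h2 := cderivD (cderiv_cst z t) (cderivZ (rc s) h1).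
    by rewrite add0r addr0 in h2.
  have cd : continuous (fun t => cderivative f (p s t) * (rc s * (rc r * (ci * circ t)))).
    apply: (cplx_contM (cdp s s01)).
    exact: (cplx_contM (cplx_cont_cst _) (cplx_contM (cplx_cont_cst _) (cplx_contM (cplx_cont_cst _) circ_cont))).
  have := cint_FTC a cd dp.
  rewrite /p circ_period subrr.
  rewrite (@eq_cint _ a _ (fun t => rc s * ci * (cderivative f (p s t) * (rc r * circ t)))).
    rewrite (@cintZ _ a _ _ (cplx_contM (cdp s s01) crc)) => /eqP.
    rewrite !mulf_eq0 => /orP[/orP[|]|/eqP//].
      by move=> /eqP[/eqP]; rewrite (negbTE s0).
    by move=> /eqP[/eqP]; rewrite oner_eq0.
  by move=> t; rewrite /p; ring.
have ckk : continuous (fun t => cmod (rc r * circ t / (rc r * circ t - z)) : R).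
  exact: continuous_cmod ck.
have dphi s : 0 <= s <= 1 -> cderiv phi s 0.
  move=> /[dup] s01 /dom01' ds.
  have [e0 e0p He] := @uniform_remainder a f (p s) (cp s) (fun t _ => holf _ (pr s t ds)).
  pose g t := e0^-1 * (2 * r) ^+ 2 * cmod (rc r * circ t / (rc r * circ t - z)).
  have cg : continuous g by move=> t; exact: (cvgM (cvg_cst _) (ckk t)).
  have cgc (c : R) : continuous (fun t => c * g t).
    by move=> t; exact: (cvgM (cvg_cst _) (cg t)).
  pose M := 2 * pint a g.
  have M0 : 0 <= M.
    rewrite mulr_ge0// pint_ge0// => t.
    by rewrite !mulr_ge0 ?cmod_ge0 ?invr_ge0 ?exprn_ge0 ?mulr_ge0 ?ltW.
  apply/cderivP => e ep.
  exists (Num.min (Num.min ((r0 - r) / (2 * r)) (e0 / (2 * r))) (e / (M + 1))).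
    by rewrite !lt_min !divr_gt0 ?mulr_gt0 ?subr_gt0// ltr_wpDl.
  move=> h; rewrite !lt_min mulr0 subr0 => /andP[/andP[h1 h2] h3].
  have dsh := dom01 s h s01 h1.
  rewrite ltr_pdivlMr ?mulr_gt0// in h2.
  rewrite ltr_pdivlMr ?ltr_wpDl// in h3.
  pose k t := rc h * (rc r * circ t - z).
  have ckt : continuous k by exact: (cplx_contM (cplx_cont_cst _) (cplx_contD crc (cplx_cont_cst (- z)))).
  have kb t : cmod (k t) <= `|h| * (2 * r).
    rewrite cmodM cmod_rc ler_wpM2l// (le_trans (cmodD _ _))// cmodN mr.
    by have := ltW zr; lra.
  have pk t : p (s + h) t = p s t + k t by rewrite /p /k rcD; ring.
  pose rem t := f (p (s + h) t) - f (p s t) - cderivative f (p s t) * k t.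
  have crem : continuous rem.
    exact: (cplx_contD (cplx_contD (cfp _ dsh) (cplx_contN (cfp _ ds))) (cplx_contN (cplx_contM (cdp _ ds) ckt))).
  have -> : phi (s + h) - phi s = cint a (fun t => rem t * (rc r * circ t / (rc r * circ t - z))).
    apply/eqP; rewrite subr_eq; apply/eqP.
    rewrite -(cintD a (cplx_contM crem ck) (cplx_contM (cfp _ ds) ck)).
    rewrite -[RHS]addr0 -(mulr0 (rc h)) -(zero _ ds).
    rewrite -(@cintZ _ a (rc h) _ (cplx_contM (cdp s ds) crc)).
    rewrite -(cintD a (cplx_contD (cplx_contM crem ck) (cplx_contM (cfp _ ds) ck)) (cplx_contM (cplx_cont_cst (rc h)) (cplx_contM (cdp s ds) crc))).
    apply: eq_cint => t; rewrite /rem /k; field; exact: rz0.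
  have rb t : period a t -> cmod (rem t * (rc r * circ t / (rc r * circ t - z))) <=
      `|h| ^+ 2 * g t.
    move=> at'; rewrite cmodM /g !mulrA ler_wpM2r ?cmod_ge0//.
    have kt : cmod (k t) < e0 by apply: le_lt_trans h2.
    have := He t (k t) at' kt; rewrite -pk -/(rem t) => Hr.
    rewrite [leRHS](_ : _ = (`|h| * (2 * r)) ^+ 2 / e0) ?ler_pdivlMr 1?mulrC//; last first.
      by rewrite [in RHS]mulrC; field; rewrite gt_eqF.
    apply: le_trans Hr _; rewrite lerXn2r ?nnegrE ?cmod_ge0//.
    by rewrite mulr_ge0// mulr_ge0// ltW.
  apply: le_trans (cint_le (cplx_contM crem ck) (cgc _) rb) _.
  rewrite pintZ//.
  rewrite [leLHS](_ : _ = `|h| * M * `|h|); last by rewrite /M; ring.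
  rewrite ler_wpM2r// (le_trans _ (ltW h3))// mulrDr mulr1 lerDl//.
have cst01 : phi 1 = phi 0.
  apply: cplxP.
  - have [] := @MVT R (fun s => Re (phi s)) (fun=> 0) 0 1 ltr01.
    + by move=> x; rewrite in_itv/= => /andP[x0 x1]; have [] := dphi x; rewrite ?ltW.
    + apply: continuous_in_subspaceT => x; rewrite inE/= in_itv/= => x01.
      have [[dx _] _] := dphi x x01.
      exact/differentiable_continuous/derivable1_diffP.
    + by move=> c _ /eqP; rewrite mul0r subr_eq0 => /eqP.
  - have [] := @MVT R (fun s => Im (phi s)) (fun=> 0) 0 1 ltr01.
    + by move=> x; rewrite in_itv/= => /andP[x0 x1]; have [] := dphi x; rewrite ?ltW.
    + apply: continuous_in_subspaceT => x; rewrite inE/= in_itv/= => x01.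
      have [_ [dx _]] := dphi x x01.
      exact/differentiable_continuous/derivable1_diffP.
    + by move=> c _ /eqP; rewrite mul0r subr_eq0 => /eqP.
have -> : cint a (fun t => f (rc r * circ t) * (rc r * circ t / (rc r * circ t - z))) = phi 1.
  apply: eq_cint => t; congr (f _ * _); rewrite /p rc1; ring.
rewrite cst01 /phi (@eq_cint _ a _ (fun t => f z * (rc r * circ t / (rc r * circ t - z)))).
  by rewrite (@cintZ _ a _ _ ck) cint_cauchy_kernel// mulrC.
by move=> t; rewrite /p rc0 mul0r addr0.
Qed.

(** Cauchy's formula for the Taylor coefficients at 0. *)
Definition taylor f r n : cplx R :=
  (rc (2 * pi))^-1 * cint 0 (fun t => f (rc r * circ t) * (rc r * circ t)^-1 ^+ n).

Lemma hol_ps0 f r0 r : (forall w, cmod w < r0 -> hol_at f w) -> 0 < r -> r < r0 ->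
  ps_on (taylor f r) 0 r f.
Proof.
move=> holf rp rr0 z; rewrite subr0 => zr.
have mr t : cmod (rc r * circ t) = r.
  by rewrite cmodM cmod_circ mulr1 cmod_rc gtr0_norm.
have crc : continuous (fun t => rc r * circ t).
  exact: (cplx_contM (cplx_cont_cst _) circ_cont).
have cfp : continuous (fun t => f (rc r * circ t)).
  move=> t; apply: (cvg_comp (fun t => rc r * circ t) f (crc t)).
  by apply: hol_at_continuous; apply: holf; rewrite mr.
have [C hC] := @cauchy_expand 0 _ r z cfp rp zr.
rewrite (cauchy_formula 0 holf rp rr0 zr) in hC.
have p0 : rc (2 * pi : R) != 0 by rewrite -cmod_gt0 cmod_rc normr_gt0 gt_eqF// twopi_gt0.
have q0 : 0 <= cmod z / r by rewrite divr_ge0 ?cmod_ge0// ltW.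
have q1 : cmod z / r < 1 by rewrite ltr_pdivrMr// mul1r.
apply/cvg_cplx_modP.
have lim0 : (fun n => C / (2 * pi) * (cmod z / r) ^+ n) @ \oo --> (0 : R).
  rewrite -[X in _ --> X](mulr0 (C / (2 * pi))); apply: cvgM; first exact: cvg_cst.
  by apply: cvg_expr; rewrite ger0_norm.
apply: (squeeze_cvgr _ (cvg_cst 0) lim0); apply: nearW => N; rewrite cmod_ge0/=.
have -> : \sum_(0 <= k < N) taylor f r k * z ^+ k - f z =
  - ((rc (2 * pi))^-1 * (rc (2 * pi) * f z -
     \sum_(i < N) cint 0 (fun t => f (rc r * circ t) * (rc r * circ t)^-1 ^+ i) * z ^+ i)).
  rewrite mulrBr mulKf // opprB; congr (_ - _).
  rewrite big_mkord mulr_sumr; apply: eq_bigr => i _.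
  by rewrite /taylor mulrA.
rewrite cmodN cmodM cmodV cmod_rc gtr0_norm ?twopi_gt0//.
by rewrite mulrC ler_pdivrMr ?twopi_gt0// (le_trans (hC N))// mulrAC divfK ?gt_eqF ?twopi_gt0.
Qed.

Lemma hol_ps f z0 r0 r : (forall w, cmod (w - z0) < r0 -> hol_at f w) -> 0 < r -> r < r0 ->
  exists a, ps_on a z0 r f.
Proof.
move=> holf rp rr0; exists (taylor (fun w => f (z0 + w)) r) => z zr.
have := @hol_ps0 (fun w => f (z0 + w)) r0 r _ rp rr0 (z - z0).
rewrite !subr0 (_ : z0 + (z - z0) = z); last by ring.
apply => // w wr; apply: hol_at_shift; apply: holf.
by rewrite (_ : _ - _ = w)//; ring.
Qed.

Lemma hol_analytic f : (forall w, disk R w -> hol_at f w) -> analytic_on (disk R) f.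
Proof.
move=> holf z0 z01; pose r := (1 - cmod z0) / 2.
have rp : 0 < r by rewrite divr_gt0// subr_gt0.
have rr : r < 1 - cmod z0 by rewrite /r; have : cmod z0 < 1 := z01; lra.
have [|a ha] := @hol_ps f z0 (1 - cmod z0) r _ rp rr.
  move=> w wr; apply: holf; rewrite /disk /= -[w](subrK z0).
  by rewrite (le_lt_trans (cmodD _ _))// -ltrBrDr.
by exists a, r.
Qed.

End Circle.

(** * Parseval's identity *)

Section Parseval.
Variable R : realType.
Implicit Types (x y e r s t B T : R) (z w l : cplx R) (f g : cplx R -> cplx R) (a b c : nat -> cplx R).
Notation circ := (@circle_pt R).

Lemma pint_bounded_cvg p (F : nat -> R -> R) (f : R -> R) B :
  (forall n, continuous (F n)) -> continuous f ->
  (forall n t, `|F n t| <= B) -> (forall t, F n t @[n --> \oo] --> f t) ->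
  pint p (F n) @[n --> \oo] --> pint p f.
Proof.
move=> cF cf FB Ff.
have H : (\int[@lebesgue_measure R]_(t in period p) (F n t)%:E)%E @[n --> \oo] -->
    (\int[@lebesgue_measure R]_(t in period p) (f t)%:E)%E.
  apply: (@dominated_cvg _ (measurableTypeR R) R (@lebesgue_measure R) (period p) (measurable_period p)
     (fun n t => (F n t)%:E) (fun t => (f t)%:E) (fun=> B%:E)).
  - by move=> n; have /integrableP[] := continuous_integrable p (cF n).
  - by move=> t _; apply/cvg_EFin; [exact: nearW|exact: Ff].
  - by [].
  - by apply: (continuous_integrable p (f := fun=> B)) => t; exact: cvg_cst.
  - by move=> n t _; rewrite lee_fin.
rewrite pint_EFin// in H.
by move/fine_cvgP: H => [_]; apply: cvg_trans; apply: near_eq_cvg; apply: nearW => n; rewrite /= .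
Qed.

Lemma cmod_sqrD z w : cmod (z + w) ^+ 2 = cmod z ^+ 2 + cmod w ^+ 2 + 2 * Re (z * cconj w).
Proof. by rewrite !cmod_sqr cReD cImD cReM; case: w => u v /=; ring. Qed.

Lemma cont_tpoly c N : continuous (fun t => \sum_(i < N) c i * circ t ^+ i).
Proof.
apply: (@cplx_cont_sum R 'I_N _ (fun (i : 'I_N) t => c i * circ t ^+ i)) => i.
exact: (cplx_contM (cplx_cont_cst (c i)) (cplx_contX i (@circ_cont R))).
Qed.

Lemma continuous_cmod2 (u : R -> cplx R) : continuous u -> continuous (fun t => cmod (u t) ^+ 2 : R).
Proof.
by move=> cu t; have h := continuous_cmod cu (x := t); exact: (cvgM h h).
Qed.

Lemma continuous_conj (u : R -> cplx R) : continuous u -> continuous (fun t => cconj (u t)).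
Proof.
move=> cu; apply: continuous_ReIm.
- rewrite (_ : (fun _ => _) = (fun t => Re (u t))); first exact: continuousRe.
  by apply/funext => t; case: (u t).
- rewrite (_ : (fun _ => _) = (fun t => - Im (u t))).
    by move=> t; apply: cvgN; exact: continuousIm.
  by apply/funext => t; case: (u t).
Qed.

(** By induction on N: the new term is orthogonal to the previous ones, because
  a nonzero power of zeta has integral 0. *)
Lemma parseval_poly p c N :
  pint p (fun t => cmod (\sum_(i < N) c i * circ t ^+ i) ^+ 2) =
  2 * pi * \sum_(i < N) cmod (c i) ^+ 2.
Proof.
elim: N => [|N IH].
  rewrite big_ord0 mulr0 (_ : (fun _ => _) = fun=> 0) ?pint_cst ?mul0r//.
  by apply/funext => t; rewrite big_ord0 cmod0 expr0n.
rewrite big_ord_recr /= mulrDr -IH.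
set S := fun t => \sum_(i < N) c i * circ t ^+ i.
set v := fun t => c N * circ t ^+ N.
have cS : continuous S by exact: cont_tpoly.
have cv : continuous v by exact: (cplx_contM (cplx_cont_cst _) (cplx_contX N (@circ_cont R))).
have cSv : continuous (fun t => S t * cconj (v t)) by exact: (cplx_contM cS (continuous_conj cv)).
have c1 := continuous_cmod2 cS.
have c2 : continuous (fun t => 2 * Re (S t * cconj (v t)) : R).
  by move=> t; exact: (cvgM (cvg_cst _) (continuousRe cSv (x := t))).
have c3 : continuous (fun _ : R => cmod (c N) ^+ 2 : R) by move=> t; exact: cvg_cst.
have c4 : continuous (fun t => cmod (S t) ^+ 2 + cmod (c N) ^+ 2 : R).
  by move=> t; exact: (cvgD (c1 t) (c3 t)).
rewrite (_ : (fun t => _) = (fun t => (cmod (S t) ^+ 2 + cmod (c N) ^+ 2) + 2 * Re (S t * cconj (v t)))); last first.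
  apply/funext => t; rewrite big_ord_recr /= cmod_sqrD -/(S t) -/(v t) (cmodM (c N)) cmodX.
  by rewrite cmod_circ expr1n mulr1.
rewrite (pintD p c4 c2) (pintD p c1 c3) pint_cst pintZ; last exact: continuousRe.
rewrite (_ : pint p (fun t => Re (S t * cconj (v t))) = 0).
  by rewrite mulr0 addr0 (mulrC (2 * pi)).
have -> : pint p (fun t => Re (S t * cconj (v t))) = Re (cint p (fun t => S t * cconj (v t))) by [].
rewrite (@eq_cint _ p _ (fun t => \sum_(i < N) c i * cconj (c N) * (circ t)^-1 ^+ (N - i))); last first.
  move=> t; rewrite /S mulr_suml; apply: eq_bigr => i _.
  rewrite /v {1}/cconj rmorphM /= -/(cconj _) -/(cconj _) cconjX conj_circ.
  have -> : (circ t)^-1 ^+ N = (circ t)^-1 ^+ i * (circ t)^-1 ^+ (N - i).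
    by rewrite -exprD subnKC// ltnW.
  have : circ t ^+ i * (circ t)^-1 ^+ i = 1.
    by rewrite -exprMn divff ?expr1n// circ_neq0.
  move=> h; rewrite [RHS](_ : _ = c i * cconj (c N) * (circ t ^+ i * (circ t)^-1 ^+ i) * (circ t)^-1 ^+ (N - i)).
    by ring.
  by rewrite h mulr1.
have cc k : continuous (fun t => (circ t)^-1 ^+ k) by exact: (cplx_contX k (cplx_contV (@circ_cont R) (@circ_neq0 R))).
rewrite (@cint_sum _ p 'I_N _ (fun (i : 'I_N) t => c i * cconj (c N) * (circ t)^-1 ^+ (N - i))
  (fun i => cplx_contM (cplx_cont_cst _) (cc (N - i)%N))).
rewrite big1// => i _; rewrite (@cintZ _ p _ _ (cc (N - i)%N)) cint_circVX ?mulr0//.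
by rewrite subn_gt0.
Qed.

Lemma parseval_cvg p c B (G : R -> cplx R) : continuous G ->
  (forall N, \sum_(i < N) cmod (c i) <= B) ->
  (forall t, series (fun n => c n * circ t ^+ n) @ \oo --> G t) ->
  2 * pi * \sum_(i < N) cmod (c i) ^+ 2 @[N --> \oo] --> pint p (fun t => cmod (G t) ^+ 2).
Proof.
move=> cG cB cvG.
under eq_fun do rewrite -(parseval_poly p).
apply: (@pint_bounded_cvg p _ _ (B ^+ 2)).
- by move=> N; apply: continuous_cmod2; exact: cont_tpoly.
- exact: continuous_cmod2.
- move=> N t; rewrite ger0_norm ?sqr_ge0// lerXn2r ?nnegrE ?cmod_ge0//.
    by apply: le_trans (cB 0%N); rewrite big_ord0.
  apply: le_trans (cmod_sum _ _ _) _; apply: le_trans (cB N).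
  by apply: ler_sum => i _; rewrite cmodM cmodX cmod_circ expr1n mulr1.
- move=> t.
  have h : cmod (series (fun n => c n * circ t ^+ n) N) @[N --> \oo] --> cmod (G t).
    by apply: cvg_cmod; exact: cvG.
  have -> : (fun N => cmod (\sum_(i < N) c i * circ t ^+ i) ^+ 2) =
      (fun N => cmod (series (fun n => c n * circ t ^+ n) N) *
        cmod (series (fun n => c n * circ t ^+ n) N)).
    by apply/funext => N; rewrite /series /= big_mkord expr2.
  exact: (cvgM h h).
Qed.

Lemma sum_sqr_nd c : nondecreasing_seq (fun N => 2 * pi * \sum_(i < N) cmod (c i) ^+ 2).
Proof.
apply/nondecreasing_seqP => N; rewrite ler_wpM2l ?(ltW (twopi_gt0 R))//.
by rewrite big_ord_recr lerDl sqr_ge0.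
Qed.

Lemma parseval_ge p c B (G : R -> cplx R) N : continuous G ->
  (forall N, \sum_(i < N) cmod (c i) <= B) ->
  (forall t, series (fun n => c n * circ t ^+ n) @ \oo --> G t) ->
  2 * pi * \sum_(i < N) cmod (c i) ^+ 2 <= pint p (fun t => cmod (G t) ^+ 2).
Proof.
move=> cG cB cvG; have h := @parseval_cvg p c B G cG cB cvG.
rewrite -(cvg_lim _ h)//; apply: (nondecreasing_cvgn_le (sum_sqr_nd c)).
by apply/cvg_ex; eexists; exact: h.
Qed.

Lemma parseval_le p c B (G : R -> cplx R) T : continuous G ->
  (forall N, \sum_(i < N) cmod (c i) <= B) ->
  (forall t, series (fun n => c n * circ t ^+ n) @ \oo --> G t) ->
  (forall N, \sum_(i < N) cmod (c i) ^+ 2 <= T) ->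
  pint p (fun t => cmod (G t) ^+ 2) <= 2 * pi * T.
Proof.
move=> cG cB cvG cT; have h := @parseval_cvg p c B G cG cB cvG.
apply: (@closed_cvg _ _ \oo _ _ [set x | x <= 2 * pi * T] _ _ _ h).
  exact: closed_le.
by apply: nearW => N /=; apply: ler_wpM2l; [exact: ltW (twopi_gt0 R)|exact: cT].
Qed.

End Parseval.

(** * Square summable coefficients and the Hardy space *)

Section PowerSeriesCircle.
Variable R : realType.
Implicit Types (x y e r s t B T : R) (z w l : cplx R) (f g : cplx R -> cplx R) (a b c : nat -> cplx R).
Notation circ := (@circle_pt R).

Lemma cmod_rcirc r t : 0 <= r -> cmod (rc r * circ t) = r.
Proof. by move=> r0; rewrite cmodM cmod_circ mulr1 cmod_rc ger0_norm. Qed.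

Section OnCircle.
Variables (a : nat -> cplx R) (r0 : R) (f : cplx R -> cplx R).
Hypothesis af : ps_on a 0 r0 f.
Variable r : R.
Hypotheses (rp : 0 <= r) (rr0 : r < r0).

Lemma ps_circ_cont : continuous (fun t => f (rc r * circ t)).
Proof.
have crc : continuous (fun t => rc r * circ t).
  exact: (cplx_contM (cplx_cont_cst _) (@circ_cont R)).
move=> t; apply: (cvg_comp (fun t => rc r * circ t) f (crc t)).
by apply: hol_at_continuous; apply: (ps_hol af); rewrite subr0 cmod_rcirc.
Qed.

Lemma ps_circ_abs : exists B, forall N, \sum_(i < N) cmod (a i * rc r ^+ i) <= B.
Proof.
have h := rr0; pose s := (r + r0) / 2; have rs : r < s by rewrite /s; lra.
have sr : s < r0 by rewrite /s; lra.
have sp : 0 < s by apply: le_lt_trans rs.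
have [B B0 hB] := ps_coef_bound af (ltW sp) sr.
exists (B / (1 - r / s)) => N.
rewrite (_ : \sum_(i < N) _ = \sum_(i < N) cmod (a i) * r ^+ i); first exact: geo_sum_le.
by apply: eq_bigr => i _; rewrite cmodM cmodX cmod_rc ger0_norm.
Qed.

Lemma ps_circ_cvg t : series (fun n => a n * rc r ^+ n * circ t ^+ n) @ \oo --> f (rc r * circ t).
Proof.
have E : (fun n => a n * rc r ^+ n * circ t ^+ n) = (fun n => a n * (rc r * circ t - 0) ^+ n).
  by apply/funext => n; rewrite subr0 exprMn mulrA.
by rewrite E; apply: af; rewrite subr0 cmod_rcirc.
Qed.

Lemma ps_parseval_ge p N :
  2 * pi * \sum_(i < N) cmod (a i) ^+ 2 * r ^+ (2 * i) <= pint p (fun t => cmod (f (rc r * circ t)) ^+ 2).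
Proof.
have [B hB] := ps_circ_abs.
apply: le_trans (@parseval_ge R p _ B _ N ps_circ_cont hB ps_circ_cvg).
rewrite ler_wpM2l ?(ltW (twopi_gt0 R))//; apply: ler_sum => i _.
by rewrite cmodM cmodX cmod_rc ger0_norm// exprMn -exprM mulnC.
Qed.

Lemma ps_parseval_le p T : (forall N, \sum_(i < N) cmod (a i) ^+ 2 * r ^+ (2 * i) <= T) ->
  pint p (fun t => cmod (f (rc r * circ t)) ^+ 2) <= 2 * pi * T.
Proof.
move=> hT; have [B hB] := ps_circ_abs.
apply: (@parseval_le R p _ B _ T ps_circ_cont hB ps_circ_cvg) => N.
apply: le_trans (hT N); apply: ler_sum => i _.
by rewrite cmodM cmodX cmod_rc ger0_norm// exprMn -exprM mulnC.
Qed.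
End OnCircle.

(** Parseval's identity for the difference, whose sum is 0. *)
Lemma ps_unique a b r f : 0 < r -> ps_on a 0 r f -> ps_on b 0 r f -> a = b.
Proof.
move=> r0 af bf; have dz : ps_on (fun n => a n - b n) 0 r (fun=> 0).
  move=> z zr; have := cvgn_cplxD (af z zr) (cvgn_cplxN (bf z zr)).
  rewrite subrr.
  have -> : series (fun n => (a n - b n) * (z - 0) ^+ n) = (fun N =>
     series (fun n => a n * (z - 0) ^+ n) N + - series (fun n => b n * (z - 0) ^+ n) N).
    apply/funext => N.
    by rewrite /series /= -sumrB; apply: eq_bigr => i _; rewrite mulrBl.
  exact.
apply/funext => n; apply/eqP; rewrite -subr_eq0; apply/eqP/cmod_eq0.
have r2 : 0 <= r / 2 by rewrite divr_ge0// ltW.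
have r2r : r / 2 < r by lra.
have := ps_parseval_ge dz r2 r2r 0 n.+1.
rewrite (_ : (fun t => _) = fun=> 0); last by apply/funext => t; rewrite cmod0 expr0n.
rewrite pint_cst mul0r pmulr_rle0 ?twopi_gt0// big_ord_recr /= => h.
have s0 : 0 <= \sum_(i < n) cmod (a i - b i) ^+ 2 * (r / 2) ^+ (2 * i).
  by apply: sumr_ge0 => i _; rewrite mulr_ge0 ?sqr_ge0 ?exprn_ge0.
have h2 : cmod (a n - b n) ^+ 2 * (r / 2) ^+ (2 * n) <= 0.
  by apply: le_trans h; rewrite lerDr.
have : 0 < (r / 2) ^+ (2 * n) by rewrite exprn_gt0// divr_gt0.
move=> p0; rewrite pmulr_lle0// in h2.
apply/eqP; rewrite -sqrf_eq0 eq_le h2 sqr_ge0//.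
Qed.

(** Each circle of radius r < 1 gives a power series on the disk of radius r.
  By uniqueness all those with r >= 1/2 have the coefficients obtained for 1/2. *)
Lemma hol_disk_ps f : (forall z, disk R z -> hol_at f z) -> exists a, ps_on a 0 1 f.
Proof.
move=> holf.
have h w : cmod w < 1 -> hol_at f w by exact: holf.
have h2 : 0 < 2^-1 :> R by rewrite invr_gt0.
exists (taylor f 2^-1) => z z1'; have z1 : cmod z < 1 by rewrite subr0 in z1'.
pose r := Num.max 2^-1 ((1 + cmod z) / 2).
have r2 : 2^-1 <= r by rewrite le_max lexx.
have r1 : r < 1 by rewrite gt_max; apply/andP; split; lra.
have zr : cmod z < r by rewrite lt_max; apply/orP; right; lra.
have r0 : 0 < r by apply: lt_le_trans r2.
have hr := hol_ps0 h r0 r1.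
have h12 : 2^-1 < 1 :> R by lra.
have E : taylor f 2^-1 = taylor f r.
  apply: (ps_unique h2 (hol_ps0 h h2 h12)) => w wr; apply: hr.
  exact: lt_le_trans wr r2.
by rewrite E; apply: hr; rewrite subr0.
Qed.

Lemma cvg_fsum (F : nat -> nat -> R) (l : nat -> R) N :
  (forall i, F i k @[k --> \oo] --> l i) ->
  \sum_(i < N) F i k @[k --> \oo] --> \sum_(i < N) l i.
Proof.
move=> Fl; elim: N => [|N IH].
  rewrite big_ord0; under eq_fun do rewrite big_ord0; exact: cvg_cst.
rewrite big_ord_recr; under eq_fun do rewrite big_ord_recr.
exact: (cvgD IH (Fl N)).
Qed.

(** Square summability with an explicit bound, in terms of finite sums. *)
Definition l2le a T := forall N, \sum_(i < N) cmod (a i) ^+ 2 <= T.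

Lemma l2le_of_means a f T p : ps_on a 0 1 f ->
  (forall r, 0 <= r < 1 -> pint p (fun t => cmod (f (rc r * circ t)) ^+ 2) <= 2 * pi * T) ->
  l2le a T.
Proof.
move=> af fT N.
have h : \sum_(i < N) cmod (a i) ^+ 2 * (1 - k.+1%:R^-1 : R) ^+ (2 * i) @[k --> \oo] -->
    \sum_(i < N) cmod (a i) ^+ 2.
  have hr : (1 - k.+1%:R^-1 : R) @[k --> \oo] --> (1 : R).
    rewrite -[X in _ --> X]subr0; apply: cvgB; first exact: cvg_cst.
    exact: cvg_harmonic.
  have hp n : (1 - k.+1%:R^-1 : R) ^+ n @[k --> \oo] --> (1 : R).
    elim: n => [|n IH]; first exact: cvg_cst.
    have -> : (fun k => (1 - k.+1%:R^-1 : R) ^+ n.+1) =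
        (fun k => (1 - k.+1%:R^-1 : R) * (1 - k.+1%:R^-1) ^+ n).
      by apply/funext => k; rewrite exprS.
    by rewrite -[X in _ --> X]mulr1; exact: (cvgM hr IH).
  apply: (@cvg_fsum (fun i k => cmod (a i) ^+ 2 * (1 - k.+1%:R^-1 : R) ^+ (2 * i))
    (fun i => cmod (a i) ^+ 2)) => i.
  by rewrite -[X in _ --> X]mulr1; apply: cvgM; [exact: cvg_cst|exact: hp].
apply: (@closed_cvg _ _ \oo _ _ [set x | x <= T] _ _ _ h).
  exact: closed_le.
apply: nearW => k /=.
have r0 : 0 <= 1 - k.+1%:R^-1 :> R by rewrite subr_ge0 invf_le1// ler1n.
have r1 : 1 - k.+1%:R^-1 < 1 :> R by rewrite gtrBl invr_gt0.
have := le_trans (ps_parseval_ge af r0 r1 p N) (fT _ _).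
by rewrite r0 r1 ler_pM2l ?twopi_gt0// => /(_ isT).
Qed.

Lemma means_of_l2le a f T p r : ps_on a 0 1 f -> l2le a T -> 0 <= r -> r < 1 ->
  pint p (fun t => cmod (f (rc r * circ t)) ^+ 2) <= 2 * pi * T.
Proof.
move=> af aT r0 r1; apply: (ps_parseval_le af r0 r1) => N.
apply: le_trans (aT N); apply: ler_sum => i _.
by rewrite ler_piMr ?sqr_ge0// exprn_ile1// ltW.
Qed.

Lemma circle_int_pint (u : R -> R) (g : cplx R -> \bar R) : continuous u ->
  (forall t, g (circ t) = (u t)%:E) ->
  circle_int g = ((2 * pi)^-1 * pint 0 u)%:E.
Proof.
move=> cu gu; rewrite /circle_int EFinM -(pint_EFin 0 cu) /period add0r; congr (_ * _)%E.
by apply: eq_integral => t _; rewrite gu.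
Qed.

Lemma circle_int_means a f r : ps_on a 0 1 f -> 0 <= r -> r < 1 ->
  circle_int (fun w => (cmod (f (real_complex R r * w)) ^+ 2)%:E) =
  ((2 * pi)^-1 * pint 0 (fun t => cmod (f (rc r * circ t)) ^+ 2))%:E.
Proof.
move=> af r0 r1; apply: circle_int_pint => //.
exact: (continuous_cmod2 (ps_circ_cont af r0 r1)).
Qed.

Lemma hardy_l2 f : hardy R f -> exists a T, ps_on a 0 1 f /\ l2le a T.
Proof.
move=> [anf [M hM]].
have [|a af] := @hol_disk_ps f; first by move=> z zD; exact: (analytic_hol anf zD).
exists a, M; split => //; apply: (@l2le_of_means a f M 0 af) => r /[dup] r01 /andP[r0 r1].
have := hM r r01; rewrite (circle_int_means af r0 r1) lee_fin.
by rewrite mulrC ler_pdivrMr ?twopi_gt0// mulrC.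
Qed.

Lemma l2_hardy a T f : ps_on a 0 1 f -> l2le a T -> hardy R f.
Proof.
move=> af aT; split.
  by apply: hol_analytic => w wD; apply: (ps_hol af); rewrite subr0.
exists T => r /andP[r0 r1]; rewrite (circle_int_means af r0 r1) lee_fin.
by rewrite mulrC ler_pdivrMr ?twopi_gt0// mulrC (means_of_l2le 0 af aT).
Qed.

(** By induction, keeping C^2 <= A B for the three sums: the new cross term 2 C x y is
  at most A y^2 + B x^2 because its square is at most 4 (A y^2) (B x^2). *)
Lemma cauchy_schwarz (I : Type) (s : seq I) (P : pred I) (u v : I -> R) :
  (\sum_(i <- s | P i) u i * v i) ^+ 2 <=
  (\sum_(i <- s | P i) u i ^+ 2) * (\sum_(i <- s | P i) v i ^+ 2).
Proof.
pose K (A B C : R) := [/\ 0 <= A, 0 <= B & C ^+ 2 <= A * B].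
suff [] : K (\sum_(i <- s | P i) u i ^+ 2) (\sum_(i <- s | P i) v i ^+ 2) (\sum_(i <- s | P i) u i * v i) by [].
elim: s => [|i s [A0 B0 CAB]]; first by rewrite !big_nil /K expr0n mul0r lexx.
rewrite !big_cons; case: ifP => // _.
set A := \sum_(_ <- _ | _) _ in A0 CAB *; set B := \sum_(_ <- _ | _) v _ ^+ 2 in B0 CAB *.
set C := \sum_(_ <- _ | _) _ * _ in CAB *; set x := u i; set y := v i.
split; rewrite ?addr_ge0 ?sqr_ge0//.
have h0 : 0 <= A * y ^+ 2 + B * x ^+ 2 by rewrite addr_ge0// mulr_ge0// sqr_ge0.
have h1 : (2 * C * x * y) ^+ 2 <= (A * y ^+ 2 + B * x ^+ 2) ^+ 2.
  have e1 : (2 * C * x * y) ^+ 2 = 4 * (x * y) ^+ 2 * C ^+ 2 by ring.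
  have e2 : (A * y ^+ 2 + B * x ^+ 2) ^+ 2 =
     4 * (x * y) ^+ 2 * (A * B) + (A * y ^+ 2 - B * x ^+ 2) ^+ 2 by ring.
  rewrite e1 e2 (@le_trans _ _ (4 * (x * y) ^+ 2 * (A * B)))//.
    by rewrite ler_wpM2l// mulr_ge0// sqr_ge0.
  by rewrite lerDl sqr_ge0.
have h2 : 2 * C * x * y <= A * y ^+ 2 + B * x ^+ 2.
  by rewrite (le_trans (ler_norm _))// -(@ler_pXn2r _ 2)// ?nnegrE// real_normK ?num_real.
by move: h2 CAB; clear; nra.
Qed.

(** Point evaluations are bounded: |f z|^2 <= T / (1 - |z|^2), for partial sums. *)
Lemma ps_point_bound a T z N : l2le a T ->
  cmod (\sum_(i < N) a i * z ^+ i) ^+ 2 <= T * \sum_(i < N) (cmod z ^+ 2) ^+ i.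
Proof.
move=> aT.
apply: (@le_trans _ _ ((\sum_(i < N) cmod (a i) * cmod z ^+ i) ^+ 2)).
  rewrite lerXn2r ?nnegrE ?cmod_ge0//.
    by apply: sumr_ge0 => i _; rewrite mulr_ge0 ?exprn_ge0 ?cmod_ge0.
  apply: le_trans (cmod_sum _ _ _) _; apply: ler_sum => i _.
  by rewrite cmodM cmodX.
apply: le_trans (cauchy_schwarz _ _ _ _) _.
have -> : \sum_(i < N) (cmod z ^+ 2) ^+ i = \sum_(i < N) (cmod z ^+ i) ^+ 2.
  by apply: eq_bigr => i _; rewrite -!exprM mulnC.
by apply: ler_wpM2r; [apply: sumr_ge0 => i _; exact: sqr_ge0|exact: aT].
Qed.

End PowerSeriesCircle.

(** * A Poisson type estimate *)

Section Chord.
Variable R : realType.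
Implicit Types (x y s t : R).
Notation circ := (@circle_pt R).

Lemma cos_sqr_ge x : 0 <= x -> x <= pi / 4 -> 2^-1 <= cos x ^+ 2.
Proof.
move=> x0 x1; have := @cos_ge0_pihalf R (x *+ 2); rewrite cos_mulr2n => h.
have {}h : 0 <= cos x ^+ 2 *+ 2 - 1.
  apply: h; have p0 := pi_gt0 R; apply/andP; split; lra.
by lra.
Qed.

Lemma sin_sqr_ge x : 0 <= x -> x <= pi / 4 -> x ^+ 2 / 2 <= sin x ^+ 2.
Proof.
move=> x0 x1; have [->|xn] := eqVneq x 0; first by rewrite sin0 expr0n mul0r.
have xp : 0 < x by rewrite lt_neqAle eq_sym xn.
have [|c] := @MVT R (@sin R) (@cos R) 0 x xp (fun y _ => is_derive_sin y).
  by apply: continuous_subspaceT => y; exact: continuous_sin.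
rewrite in_itv/= => /andP[c0 cx]; rewrite sin0 !subr0 => ->.
rewrite exprMn mulrC ler_wpM2r ?sqr_ge0// cos_sqr_ge ?(ltW c0)//.
by rewrite (le_trans (ltW cx)).
Qed.

(** Halving the angle twice, 1 - cos s = 8 sin(s/4)^2 cos(s/4)^2, where s/4 is
  at most pi/4. *)
Lemma cos_chord s : `|s| <= pi -> s ^+ 2 / 8 <= 1 - cos s.
Proof.
move=> sp; rewrite -cos_norm -real_normK ?num_real//.
have := normr_ge0 s; move: (`|s|) sp => x xp x0.
pose y := x / 4.
have y0 : 0 <= y by rewrite divr_ge0.
have y1 : y <= pi / 4 by rewrite /y; lra.
have -> : x = y *+ 2 *+ 2 by rewrite /y; field.
rewrite cos_mulr2n cos2sin2 sin_mulr2n.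
have := cos_sqr_ge y0 y1; have := sin_sqr_ge y0 y1; have := sqr_ge0 y.
by nra.
Qed.

Lemma circ_chord t s : `|t - s| <= pi -> `|t - s| / 2 <= cmod (circ t - circ s).
Proof.
move=> /cos_chord h; rewrite -(@ler_pXn2r _ 2)// ?nnegrE ?divr_ge0 ?cmod_ge0//.
rewrite cmod_sqr !(cReD, cReN, cImD, cImN) /= expr_div_n real_normK ?num_real//.
rewrite cosB in h.
have := cos2Dsin2 t; have := cos2Dsin2 s.
by rewrite !expr2; rewrite expr2 in h; lra.
Qed.
End Chord.

Section Poisson.
Variable R : realType.
Implicit Types (x y e r s t p : R) (z w c v k h : cplx R) (f g : cplx R -> cplx R).
Notation circ := (@circle_pt R).

Lemma hol_at_affine c v w : hol_at (fun w => v - c * w) w.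
Proof.
exists (fun=> - c), 1, 0 => // z h _ _.
by rewrite (_ : _ - _ - _ = 0) ?cmod0 ?mul0r//; ring.
Qed.

Lemma hol_at_inv v : v != 0 -> hol_at (fun w : cplx R => w^-1) v.
Proof.
move=> v0; have b0 : 0 < cmod v by rewrite cmod_gt0.
exists (fun w => - (w ^+ 2)^-1), (cmod v / 4), ((cmod v / 2) ^- 3); first by rewrite divr_gt0.
move=> z h zv hv.
have z1 : cmod v / 2 <= cmod z.
  by have := cmod_sub v z; rewrite cmodB; lra.
have z2 : cmod v / 2 <= cmod (z + h).
  have := cmod_sub v (z + h); rewrite cmodB (_ : z + h - v = (z - v) + h); last by ring.
  by have := cmodD (z - v) h; lra.
have b2 : 0 < cmod v / 2 by rewrite divr_gt0.
have z0 : z != 0 by rewrite -cmod_gt0 (lt_le_trans b2).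
have zh0 : z + h != 0 by rewrite -cmod_gt0 (lt_le_trans b2).
have -> : (z + h)^-1 - z^-1 - - (z ^+ 2)^-1 * h = h ^+ 2 / (z ^+ 2 * (z + h)).
  by field; rewrite z0 zh0.
rewrite cmodM cmodX cmodV mulrC ler_wpM2r ?sqr_ge0// cmodM cmodX.
have P : 0 < cmod z ^+ 2 * cmod (z + h).
  by rewrite mulr_gt0 ?exprn_gt0// (lt_le_trans b2).
rewrite lef_pV2 ?posrE ?exprn_gt0//.
rewrite exprSr ler_pM ?exprn_ge0 ?(ltW b2)// lerXn2r ?nnegrE ?cmod_ge0 ?(ltW b2)//.
Qed.

(** Cauchy's formula for G w = g(w)^2 / (1 - conj(z) w). On the one hand
  |G z| = |g z|^2 / (1 - |z|^2); on the other hand |1 - conj(z) zeta| = |zeta - z|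
  on the circle, so the Cauchy integrand has modulus |g|^2 / |zeta - z|^2. *)
Lemma poisson_bound g r0 p z : (forall w, cmod w < r0 -> hol_at g w) -> 1 < r0 ->
  cmod z < 1 ->
  pi * cmod (g z) ^+ 2 <=
  (1 - cmod z ^+ 2) * pint p (fun t => cmod (g (circ t)) ^+ 2 / cmod (circ t - z) ^+ 2).
Proof.
move=> holg r01 z1.
pose r1 := Num.min r0 (2 / (1 + cmod z)).
have z0 := cmod_ge0 z.
have r11 : 1 < r1 by rewrite lt_min r01 /= ltr_pdivlMr; lra.
have n0 w : cmod w < r1 -> 1 - cconj z * w != 0.
  rewrite lt_min => /andP[_]; rewrite ltr_pdivlMr; last by lra.
  move=> h; apply/eqP => /eqP; rewrite subr_eq0 => /eqP e.
  have : cmod (cconj z * w) = 1 by rewrite -e cmod1.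
  by rewrite cmodM cmod_conj; have := cmod_ge0 w; nra.
pose G w := g w * g w * (1 - cconj z * w)^-1.
have holG w : cmod w < r1 -> hol_at G w.
  move=> wr; have hg : hol_at g w by apply: holg; apply: lt_le_trans wr _; rewrite ge_min lexx.
  apply: hol_atM; first exact: hol_atM.
  apply: (@hol_at_comp R (fun w => w^-1) (fun w => 1 - cconj z * w)).
    exact: hol_at_inv (n0 _ wr).
  exact: hol_at_affine.
have := cauchy_formula p holG ltr01 r11 z1.
have rz t : circ t - z != 0.
  by rewrite -cmod_gt0; have := cmod_sub (circ t) z; rewrite cmod_circ; lra.
have cg : continuous (fun t => g (circ t)).
  move=> t; apply: (cvg_comp circ g (@circ_cont R t)).
  by apply: hol_at_continuous; apply: holg; rewrite cmod_circ.
have cz : continuous (fun t => circ t - z) by exact: (cplx_contD (@circ_cont R) (cplx_cont_cst (- z))).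
have cU : continuous (fun t => G (rc 1 * circ t) * (rc 1 * circ t / (rc 1 * circ t - z))).
  have -> : (fun t => G (rc 1 * circ t) * (rc 1 * circ t / (rc 1 * circ t - z))) =
      (fun t => G (circ t) * (circ t / (circ t - z))).
    by apply/funext => t; rewrite rc1 mul1r.
  have cG : continuous (fun t => G (circ t)).
    move=> t; apply: (cvg_comp circ G (@circ_cont R t)).
    by apply: hol_at_continuous; apply: holG; rewrite cmod_circ.
  exact: (cplx_contM cG (cplx_contM (@circ_cont R) (cplx_contV cz rz))).
have cV : continuous (fun t => cmod (g (circ t)) ^+ 2 / cmod (circ t - z) ^+ 2 : R).
  have h1 := continuous_cmod2 cg; have h2 := continuous_cmod2 cz.
  move=> t; apply: cvgM; first exact: h1.
  by apply: cvgV; [rewrite sqrf_eq0 gt_eqF// cmod_gt0|exact: h2].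
move=> E.
have H : cmod (cint p (fun t => G (rc 1 * circ t) * (rc 1 * circ t / (rc 1 * circ t - z)))) <=
    2 * pint p (fun t => cmod (g (circ t)) ^+ 2 / cmod (circ t - z) ^+ 2).
  apply: (cint_le cU cV) => t _; rewrite rc1 mul1r /G !cmodM !cmodV cmod_circ mul1r.
  have -> : cmod (1 - cconj z * circ t) = cmod (circ t - z).
    rewrite -[RHS]cmod_conj -[RHS]mulr1 -(cmod_circ t) -cmodM; congr cmod.
    have -> : cconj (circ t - z) = (circ t)^-1 - cconj z.
      by rewrite -conj_circ /cconj rmorphB.
    by rewrite mulrBl mulVf ?circ_neq0.
  by rewrite -mulrA -invfM -!expr2.
rewrite E in H.
have zz : 0 < 1 - cmod z ^+ 2 by rewrite subr_gt0 expr_lt1.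
have Gz : cmod (G z) = cmod (g z) ^+ 2 / (1 - cmod z ^+ 2).
  rewrite /G !cmodM cmodV -expr2; congr (_ / _).
  rewrite mulrC mulcconj (_ : 1 - _ = rc (1 - cmod z ^+ 2)); last first.
    by apply: cplxP; rewrite ?(cReD, cImD, cReN, cImN) /=; ring.
  by rewrite cmod_rc gtr0_norm.
rewrite cmodM cmod_rc gtr0_norm ?twopi_gt0// Gz mulrA ler_pdivrMr// in H.
by rewrite mulrC; lra.
Qed.

End Poisson.

(** * The Hardy-Littlewood maximal function *)

Section Maximal.
Variable R : realType.
Implicit Types (x y r s t p d m c T : R) (h k G : R -> R).
Notation circ := (@circle_pt R).
Notation mu := (@lebesgue_measure R).

(** With J + 1 chosen minimal for s, the last term alone suffices: |s| >= 2^J d gives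
  d / s^2 <= 1 / (4^J d) = 4 / 4^(J+1) / d. *)
Lemma dyadic_cover d s J : 0 < d -> `|s| < 2 ^+ J * d ->
  d / Num.max d `|s| ^+ 2 <=
  \sum_(j < J.+1) (if `|s| < 2 ^+ j * d then 4 / 4 ^+ j / d else 0).
Proof.
move=> d0; have t0 j : 0 <= (if `|s| < 2 ^+ j * d then 4 / 4 ^+ j / d else 0).
  by case: ifP => // _; rewrite !divr_ge0 ?exprn_ge0// ltW.
elim: J => [|J IH].
  rewrite expr0 mul1r => sd; rewrite big_ord_recl big_ord0 addr0 expr0 mul1r sd expr0 divr1.
  rewrite max_l ?(ltW sd)// expr2 invfM mulrA divff ?gt_eqF// mul1r.
  by rewrite ler_pdivlMr// mulVf ?gt_eqF// ler1n.
move=> sJ; have [sJ'|sJ'] := ltP `|s| (2 ^+ J * d).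
  by rewrite big_ord_recr /= (le_trans (IH sJ'))// lerDl.
rewrite big_ord_recr /= sJ; apply: (@le_trans _ _ (4 / 4 ^+ J.+1 / d)); last first.
  by rewrite lerDr sumr_ge0.
have P : 0 < 2 ^+ J * d by rewrite mulr_gt0// exprn_gt0.
rewrite ler_pdivlMr// mulrAC ler_pdivrMr; last first.
  by rewrite exprn_gt0// lt_max d0.
have -> : 4 / 4 ^+ J.+1 = (4 ^+ J)^-1 :> R.
  by rewrite exprS invfM mulrA divff ?mul1r// pnatr_eq0.
rewrite [leRHS]mulrC ler_pdivlMr ?exprn_gt0//.
have -> : d * d * 4 ^+ J = (2 ^+ J * d) ^+ 2.
  have -> : (4 : R) ^+ J = 2 ^+ J * 2 ^+ J by rewrite -exprMn; congr (_ ^+ _); ring.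
  by ring.
rewrite lerXn2r ?nnegrE ?(ltW P)//.
  by rewrite le_max normr_ge0 orbT.
by rewrite le_max sJ' orbT.
Qed.

Lemma HL_ball G x m r : (HL_maximal G x <= m%:E)%E -> 0 < r ->
  (\int[mu]_(t in ball x r) `|(G t)%:E| <= (2 * r * m)%:E)%E.
Proof.
move=> Gm r0; have : (iavg G (ball x r) <= m%:E)%E.
  apply: le_trans Gm; apply: ereal_sup_ubound; exists r => //.
  by rewrite /= in_itv/= r0.
rewrite /iavg (lebesgue_measure_ball _ (ltW r0)) inver mulrn_eq0/= gt_eqF//.
by rewrite lee_pdivrMl ?mulrn_wgt0// -EFinM mulr_natl.
Qed.

(** Contains every window [x - pi, x + pi] with x in [0, 2 pi]. *)
Definition big_period : set R := `[- pi, 3 * pi]%classic.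

Lemma measurable_big_period : measurable (big_period : set (measurableTypeR R)).
Proof. exact: measurable_itv. Qed.

Lemma patch_loc_int h : continuous h -> locally_integrable setT (h \_ big_period).
Proof.
move=> ch; apply: open_integrable_locally; first exact: openT.
have /(integrable_mkcond _ measurable_big_period).1 : mu.-integrable big_period (EFin \o h).
  apply: continuous_compact_integrable; first exact: segment_compact.
  exact: continuous_subspaceT.
by rewrite -restrict_EFin.
Qed.

(** A kernel dominated by d / max(d, |t - x|)^2 is dominated by a combination of
  indicators of the balls of radius 2^j d around x, with weights 4 / 4^j / d
  ([dyadic_cover]). The integral of h over such a ball is at most 2 * 2^j d * m, and
  the sum of the products 8 m / 2^j is at most 16 m. *)
Lemma maximal_kernel h k x d m : continuous h -> (forall t, 0 <= h t) ->
  continuous k -> (forall t, 0 <= k t) -> 0 <= x <= 2 * pi -> 0 < d -> 0 <= m ->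
  (HL_maximal (h \_ big_period) x <= m%:E)%E ->
  (forall t, period (x - pi) t -> k t <= d / Num.max d `|t - x| ^+ 2) ->
  pint (x - pi) (fun t => h t * k t) <= 16 * m.
Proof.
move=> ch h0 ck k0 /andP[x0 x1] d0 m0 Gm kb.
pose G : R -> R := h \_ big_period.
have pi0 := pi_gt0 R.
have /boolp.cid[J hJ] : exists J, pi < 2 ^+ J * d.
  have [n hn] : exists n : nat, pi / d < n%:R.
    by exists (Num.truncn (pi / d)).+1; rewrite truncnS_gt.
  exists n; rewrite -ltr_pdivrMr// (lt_le_trans hn)// -natrX ler_nat ltnW// ltn_expl//.
pose c j : R := 4 / 4 ^+ j / d.
have c0 j : 0 <= c j by rewrite !divr_ge0 ?exprn_ge0// ltW.
pose B j : set R := ball x (2 ^+ j * d).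
have mB j : measurable (B j : set (measurableTypeR R)) by rewrite /B ball_itv; exact: measurable_itv.
have [mG _ _] := patch_loc_int ch; rewrite -/G in mG Gm.
have mG' : measurable_fun [set: measurableTypeR R] (fun t => `|(G t)%:E|%E).
  by apply: measurableT_comp => //; apply/measurable_EFinP.
pose phi j := (fun t => ((c j)%:E * `|(G t)%:E|)%E) \_ (B j).
have mphi0 j : measurable_fun [set: measurableTypeR R] (fun t => ((c j)%:E * `|(G t)%:E|)%E).
  exact: measurable_funeM.
have mphi j : measurable_fun [set: measurableTypeR R] (phi j).
  have h1 : measurable_fun (B j : set (measurableTypeR R)) (fun t => ((c j)%:E * `|(G t)%:E|)%E).
    exact: (measurable_funTS (mphi0 j)).
  exact: (measurable_restrictT _ (mB j)).1 h1.
have phi0 j t : (0 <= phi j t)%E.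
  by rewrite /phi /patch; case: ifP => // _; rewrite mule_ge0// lee_fin.
have chk : continuous (fun t => h t * k t) by move=> t; exact: (cvgM (ch t) (ck t)).
have mhk : measurable_fun (period (x - pi) : set (measurableTypeR R)) (fun t => (h t * k t)%:E).
  by have /integrableP[] := continuous_integrable (x - pi) chk.
rewrite -lee_fin -pint_EFin// integral_mkcond.
apply: (@le_trans _ _ (\int[mu]_t (\sum_(j <- index_iota 0 J.+1) phi j t))%E).
  apply: ge0_le_integral => //.
  - by move=> t _; rewrite /patch; case: ifP => // _; rewrite lee_fin mulr_ge0.
  - exact: (measurable_restrictT _ (measurable_period (x - pi))).1 mhk.
  - by apply: emeasurable_sum.
  move=> t _; rewrite /patch; case: ifPn => [|_]; last by apply: sume_ge0.
  rewrite inE => /[dup] tp; rewrite /period /= in_itv/= => /andP[t1 t2].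
  have tG : G t = h t.
    by rewrite /G /patch mem_set//= /big_period /= in_itv/=; apply/andP; split; lra.
  have ts : `|t - x| <= pi by rewrite ler_norml; apply/andP; split; lra.
  have tJ : `|t - x| < 2 ^+ J * d by apply: le_lt_trans ts hJ.
  rewrite (@le_trans _ _ (h t * \sum_(j < J.+1) (if `|t - x| < 2 ^+ j * d then c j else 0))%:E)//.
    by rewrite lee_fin ler_wpM2l// (le_trans (kb _ tp))// dyadic_cover.
  rewrite mulr_sumr -sumEFin big_mkord le_eqVlt; apply/orP; left; apply/eqP.
  apply: eq_bigr => j _; rewrite /phi /patch.
  have -> : ((t : R) \in B j) = (`|t - x| < 2 ^+ j * d).
    by apply/idP/idP; rewrite inE /B /ball /= distrC.
  case: ifP => _; last by rewrite mulr0.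
  by rewrite tG /= ger0_norm// mulrC EFinM.
rewrite ge0_integral_sum//.
apply: (@le_trans _ _ (\sum_(j < J.+1) (8 * m * (2^-1) ^+ j)%:E)%E).
  rewrite big_mkord; apply: lee_sum => j _.
  rewrite /phi -integral_mkcond ge0_integralZl_EFin//; last exact: measurable_funTS.
  have := HL_ball Gm (_ : 0 < 2 ^+ j * d); rewrite mulr_gt0 ?exprn_gt0// => /(_ isT) hB.
  apply: le_trans (lee_wpmul2l _ hB) _; first by rewrite lee_fin.
  rewrite -EFinM lee_fin /c le_eqVlt; apply/orP; left; apply/eqP.
  have -> : (4 : R) ^+ j = 2 ^+ j * 2 ^+ j by rewrite -exprMn; congr (_ ^+ _); ring.
  by rewrite exprVn; field; rewrite (gt_eqF d0) ?expf_neq0 // ?pnatr_eq0.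
rewrite sumEFin lee_fin -mulr_sumr.
have := @geo_le R 2^-1 J.+1; rewrite invr_ge0 ler0n invf_lt1// ltr1n => /(_ isT isT).
have -> : (1 - 2^-1)^-1 = 2 :> R by field.
move=> h2; have h3 : 0 <= 8 * m by rewrite mulr_ge0.
by apply: le_trans (ler_wpM2l h3 h2) _; lra.
Qed.

End Maximal.

(** * The weak-type estimate on Stolz angles *)

Section WeakType.
Variable R : realType.
Implicit Types (x y r s t p d m c T : R) (z w : cplx R) (f g : cplx R -> cplx R) (a b : nat -> cplx R).
Notation circ := (@circle_pt R).
Notation mu := (@lebesgue_measure R).

Definition circle_sqr g t : R := cmod (g (circ t)) ^+ 2.

(** In a Stolz angle at the point of argument x, |zeta t - z| is at least a constant
  times max(1 - |z|, |t - x|), so that the kernel of [poisson_bound] satisfies the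
  hypothesis of [maximal_kernel]. *)
Lemma stolz_maximal g r0 x al z m : (forall w, cmod w < r0 -> hol_at g w) -> 1 < r0 ->
  0 <= x <= 2 * pi -> 0 < al -> stolz al (circ x) z -> 0 <= m ->
  (HL_maximal (circle_sqr g \_ (@big_period R)) x <= m%:E)%E ->
  cmod (g z) ^+ 2 <= 64 * (1 + al) ^+ 2 * m.
Proof.
move=> holg r01 x01 al0 [z1 zx] m0 Gm; rewrite /disk /= in z1.
pose d := 1 - cmod z; have d0 : 0 < d by rewrite subr_gt0.
(* |t - x| / 2 <= |zeta t - w| <= |zeta t - z| + al (1 - |z|), with w the vertex,
   and 1 - |z| <= |zeta t - z|; this gives |t - x| <= A |zeta t - z|. *)
pose A := 2 * (1 + al); have A0 : 0 < A by rewrite /A; lra.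
have rz t : d <= cmod (circ t - z).
  by have := cmod_sub (circ t) z; rewrite cmod_circ.
have rz0 t : 0 < cmod (circ t - z) by exact: lt_le_trans (rz t).
have cg : continuous (fun t => g (circ t)).
  move=> t; apply: (cvg_comp circ g (@circ_cont R t)).
  by apply: hol_at_continuous; apply: holg; rewrite cmod_circ.
have cz : continuous (fun t => circ t - z) by exact: (cplx_contD (@circ_cont R) (cplx_cont_cst (- z))).
pose h t : R := cmod (g (circ t)) ^+ 2.
pose k t : R := d / A ^+ 2 * (cmod (circ t - z) ^+ 2)^-1.
have ch : continuous h by exact: (continuous_cmod2 cg).
have ck : continuous k.
  move=> t; apply: cvgM; first exact: cvg_cst.
  by apply: cvgV; [rewrite sqrf_eq0 gt_eqF|exact: (continuous_cmod2 cz (x := t))].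
have h0 t : 0 <= h t by exact: sqr_ge0.
have k0 t : 0 <= k t by rewrite mulr_ge0 ?invr_ge0 ?divr_ge0 ?sqr_ge0// ltW.
have kb t : period (x - pi) t -> k t <= d / Num.max d `|t - x| ^+ 2.
  rewrite /period /= in_itv/= => /andP[t1 t2].
  have ts : `|t - x| <= pi by rewrite ler_norml; apply/andP; split; lra.
  have sb : `|t - x| <= A * cmod (circ t - z).
    have := circ_chord ts; have := cmodD (circ t - z) (z - circ x).
    have -> : circ t - z + (z - circ x) = circ t - circ x by ring.
    have := rz t; rewrite /A -/d in zx * => h1 h2 h3.
    have : al * d <= al * cmod (circ t - z) by rewrite ler_wpM2l// ltW.
    by nra.
  have db : d <= A * cmod (circ t - z).
    by apply: le_trans (rz t) _; rewrite ler_peMl ?(ltW (rz0 t))// /A; lra.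
  rewrite /k -mulrA -invfM -exprMn ler_wpM2l ?(ltW d0)//.
  have mx : 0 < Num.max d `|t - x| by rewrite lt_max d0.
  have Az : 0 < A * cmod (circ t - z) by rewrite mulr_gt0.
  rewrite lef_pV2 ?posrE ?exprn_gt0// lerXn2r ?nnegrE ?(ltW mx) ?(ltW Az)//.
  by rewrite ge_max db.
have H := maximal_kernel ch h0 ck k0 x01 d0 m0 Gm kb.
have P := poisson_bound (x - pi) holg r01 z1.
set I := pint _ _ in P.
have E : pint (x - pi) (fun t => h t * k t) = d / A ^+ 2 * I.
  have -> : (fun t => h t * k t) = (fun t => d / A ^+ 2 * (h t / cmod (circ t - z) ^+ 2)).
    by apply/funext => t; rewrite /k; ring.
  rewrite pintZ// => t; apply: cvgM; first exact: ch.
  by apply: cvgV; [rewrite sqrf_eq0 gt_eqF|exact: (continuous_cmod2 cz (x := t))].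
rewrite E in H.
have I0 : 0 <= I by apply: pint_ge0 => t; rewrite divr_ge0 ?sqr_ge0.
have dI : d * I <= 16 * m * A ^+ 2.
  by rewrite -ler_pdivrMr ?exprn_gt0// mulrAC.
have z2 : 1 - cmod z ^+ 2 <= 2 * d.
  by rewrite /d; have := cmod_ge0 z; nra.
have P2 : (1 - cmod z ^+ 2) * I <= 2 * d * I by rewrite ler_wpM2r.
have g0 := sqr_ge0 (cmod (g z)); have pi2 := pi_ge2 R.
have : 2 * cmod (g z) ^+ 2 <= pi * cmod (g z) ^+ 2 by rewrite ler_wpM2r.
have -> : 64 * (1 + al) ^+ 2 * m = 16 * m * A ^+ 2 by rewrite /A; ring.
by lra.
Qed.

Lemma integral_big_period (h : R -> R) : continuous h -> (forall t, 0 <= h t) ->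
  (\int[mu]_t `|((h \_ (@big_period R)) t)%:E| <= (pint (- pi) h + pint pi h)%:E)%E.
Proof.
move=> ch h0; have E p : (\int[mu]_(t in period p) (h t)%:E = \int[mu]_t ((fun t => (h t)%:E) \_ (period p)) t)%E.
  exact: integral_mkcond.
rewrite EFinD -!(pint_EFin _ ch) !E.
have mp p : measurable_fun [set: measurableTypeR R] ((fun t => (h t)%:E) \_ (period p)).
  have h1 : measurable_fun (period p : set (measurableTypeR R)) (fun t => (h t)%:E).
    by have /integrableP[] := continuous_integrable p ch.
  exact: (measurable_restrictT _ (measurable_period p)).1 h1.
have p0 p t : (0 <= ((fun t => (h t)%:E) \_ (period p)) t)%E.
  by rewrite /patch; case: ifP => // _; rewrite lee_fin.
rewrite -ge0_integralD//.
have [mG _ _] := patch_loc_int ch.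
apply: ge0_le_integral => //.
- by apply: measurableT_comp => //; apply/measurable_EFinP.
- exact: emeasurable_funD.
move=> t _; rewrite {1}/patch; case: ifPn => [|_]; last first.
  by rewrite [X in (X <= _)%E](_ : _ = 0%E) ?adde_ge0// /= normr0.
rewrite inE /big_period /= in_itv/= => /andP[t1 t2].
rewrite ger0_norm//; have [tp|tp] := leP t pi.
  rewrite [X in (X + _)%E](_ : _ = (h t)%:E) ?leeDl//.
  rewrite /patch mem_set// /period /= in_itv/=; apply/andP; split => //; lra.
rewrite [X in (_ + X)%E](_ : _ = (h t)%:E) ?leeDr//.
by rewrite /patch mem_set// /period /= in_itv/=; apply/andP; split; [exact: ltW|lra].
Qed.

Lemma hol_at_dil f r w : hol_at f (rc r * w) -> hol_at (fun w => f (rc r * w)) w.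
Proof.
move=> hf; apply: (@hol_at_comp R f (fun w => rc r * w)) => //.
exists (fun=> rc r), 1, 0 => // z h _ _.
by rewrite (_ : _ - _ - _ = 0) ?cmod0 ?mul0r//; ring.
Qed.

(** [stolz_maximal] needs functions that are holomorphic across the circle, so it
  is applied to the dilates f (r_k z) with r_k increasing to 1. Since f (r_k z) tends
  to f z, a point x at which f is large on the Stolz angle lies in all but finitely
  many of the exceptional sets of the dilates, and the limit inferior of these sets
  satisfies their common bound: 3 / c from the maximal inequality, times 2 pi T for
  each of the two periods in [big_period]. *)
Lemma weak_type a f T c al : ps_on a 0 1 f -> l2le a T -> 0 < c -> 0 < al ->
  exists A : set R, [/\ measurable (A : set (measurableTypeR R)),
    (mu A <= (12 * pi * T / c)%:E)%E &
    forall x, 0 <= x <= 2 * pi -> ~ A x -> forall z, stolz al (circ x) z ->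
      cmod (f z) ^+ 2 <= 64 * (1 + al) ^+ 2 * c].
Proof.
move=> af aT c0 al0.
pose r k : R := 1 - k.+2%:R^-1.
have r0 k : 0 < r k by rewrite subr_gt0 invf_lt1// ltr1n.
have r1 k : r k < 1 by rewrite gtrBl invr_gt0.
pose h k t : R := cmod (f (rc (r k) * circ t)) ^+ 2.
have ch k : continuous (h k).
  exact: (continuous_cmod2 (ps_circ_cont af (ltW (r0 k)) (r1 k))).
have h0 k t : 0 <= h k t by exact: sqr_ge0.
pose G k : R -> R := (h k) \_ (@big_period R).
pose E k : set R := [set x | (c%:E < HL_maximal (G k) x)%E].
have lG k : locally_integrable setT (G k) by exact: patch_loc_int.
have mE k : measurable (E k : set (measurableTypeR R)).
  rewrite /E -[X in measurable X]setTI; apply: emeasurable_fun_o_infty => //.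
  exact: measurable_HL_maximal.
have muE k : (mu (E k) <= (12 * pi * T / c)%:E)%E.
  apply: le_trans (maximal_inequality (lG k) c0) _.
  have c3 : (0%R <= (3 / c)%:E)%E by rewrite lee_fin divr_ge0// ltW.
  apply: le_trans (lee_wpmul2l c3 (integral_big_period (ch k) (h0 k))) _.
  rewrite -EFinM lee_fin.
  have b p : pint p (h k) <= 2 * pi * T.
    exact: (means_of_l2le p af aT (ltW (r0 k)) (r1 k)).
  have := b (- pi); have := b pi => h1 h2.
  rewrite mulrAC ler_wpM2r ?invr_ge0 ?(ltW c0)//.
  by lra.
pose B n : set R := \bigcap_(k in [set k | (n <= k)%N]) E k.
have mB n : measurable (B n : set (measurableTypeR R)).
  by apply: bigcap_measurable => [|k _]; [exists n => /=|exact: mE].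
have mBU : measurable (\bigcup_n B n : set (measurableTypeR R)).
  by apply: bigcup_measurable => n _; exact: mB.
exists (\bigcup_n B n); split => //.
- have ndB : nondecreasing_seq B.
    move=> m n mn; apply/subsetPset => x Bx k /= nk; apply: Bx.
    exact: leq_trans mn nk.
  have cv := nondecreasing_cvg_mu (mu := mu) mB mBU ndB.
  rewrite -(cvg_lim _ cv)//; apply: lime_le; first by apply/cvg_ex; eexists; exact: cv.
  apply: nearW => n /=; apply: le_trans (muE n); apply: le_measure; rewrite ?inE//.
  by move=> x Bx; apply: Bx => /=.
move=> x x01 nB z zs.
have fr n : exists2 k, (n <= k)%N & cmod (f (rc (r k) * z)) ^+ 2 <= 64 * (1 + al) ^+ 2 * c.
  have [k nk nE] : exists2 k, (n <= k)%N & ~ E k x.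
    apply: contrapT => H; apply: nB; exists n => // k /= nk.
    by apply: contrapT => nE; apply: H; exists k.
  exists k => //; have rk : 1 < (r k)^-1 by rewrite invf_gt1.
  have hh w : cmod w < (r k)^-1 -> hol_at (fun w => f (rc (r k) * w)) w.
    move=> wr; apply: hol_at_dil; apply: (ps_hol af); rewrite subr0 cmodM cmod_rc gtr0_norm//.
    by rewrite mulrC -ltr_pdivlMr// mul1r.
  apply: (@stolz_maximal (fun w => f (rc (r k) * w)) _ x al z c hh rk x01 al0 zs (ltW c0)).
  by move/negP: nE; rewrite -leNgt.
have cf : cmod (f (rc (r k) * z)) ^+ 2 @[k --> \oo] --> cmod (f z) ^+ 2.
  have rz : rc (r k) * z @[k --> \oo] --> z.
    apply/cvg_cplx_modP.
    have -> : (fun k => cmod (rc (r k) * z - z)) = (fun k => k.+2%:R^-1 * cmod z).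
      apply/funext => k; rewrite /r (_ : _ - z = rc (- k.+2%:R^-1) * z).
        by rewrite cmodM cmod_rc normrN ger0_norm ?invr_ge0.
      by apply: cplxP; rewrite ?(cReD, cReM, cReN, cImD, cImM, cImN) /=; ring.
    rewrite -[X in _ --> X](mul0r (cmod z)); apply: cvgM; last exact: cvg_cst.
    have hh := @cvg_harmonic R; rewrite -cvg_shiftS in hh; exact: hh.
  have hz : hol_at f z by apply: (ps_hol af); rewrite subr0; case: zs.
  have fz : f (rc (r k) * z) @[k --> \oo] --> f z.
    exact: (cvg_comp (fun k => rc (r k) * z) f rz (hol_at_continuous hz)).
  have h1 : cmod (f (rc (r k) * z)) @[k --> \oo] --> cmod (f z) by apply: cvg_cmod; exact: fz.
  exact: (cvgM h1 h1).
rewrite leNgt; apply/negP => lt.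
have : \forall k \near \oo, 64 * (1 + al) ^+ 2 * c < cmod (f (rc (r k) * z)) ^+ 2.
  exact: (cvgr_gt _ cf).
move=> [n _ hn]; have [k nk hk] := fr n.
by have := hn k nk; rewrite /= ltNge hk.
Qed.

End WeakType.

(** * Tails of power series *)

Section Tails.
Variable R : realType.
Implicit Types (x y r s t p d m c T e : R) (z w l : cplx R) (f g : cplx R -> cplx R) (a b : nat -> cplx R).

Definition tail a N n : cplx R := if (n < N)%N then 0 else a n.

Lemma l2_tail a T : l2le a T -> exists tau : nat -> R,
  [/\ tau @ \oo --> (0 : R), forall N, 0 <= tau N & forall N, l2le (tail a N) (tau N)].
Proof.
move=> aT; pose S N := \sum_(i < N) cmod (a i) ^+ 2.
have ndS : nondecreasing_seq S.
  by apply/nondecreasing_seqP => N; rewrite /S big_ord_recr lerDl sqr_ge0.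
have cS : cvgn S.
  by apply: nondecreasing_is_cvgn => //; exists T => _ [N _ <-]; exact: aT.
exists (fun N => limn S - S N); split.
- rewrite -[X in _ --> X](subrr (limn S)); apply: cvgB; first exact: cvg_cst.
  exact: cS.
- by move=> N; rewrite subr_ge0; exact: nondecreasing_cvgn_le.
move=> N M; rewrite lerBrDr.
apply: (@le_trans _ _ (S (maxn M N))); last exact: nondecreasing_cvgn_le.
have -> : S (maxn M N) = S N + \sum_(N <= i < maxn M N) cmod (a i) ^+ 2.
  rewrite /S -!(big_mkord xpredT (fun i => cmod (a i) ^+ 2)).
  by rewrite (big_cat_nat (n := N) (p := maxn M N)) ?leq_maxr.
rewrite addrC lerD2l -(big_mkord xpredT (fun i => cmod (tail a N i) ^+ 2)).
have [MN|NM] := leqP M N.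
  rewrite big_nat big1 ?sumr_ge0//; first by move=> i _; exact: sqr_ge0.
  by move=> i /andP[_ iM]; rewrite /tail (leq_trans iM MN) cmod0 expr0n.
rewrite (big_cat_nat (n := N)) ?(ltnW NM)//= big_nat big1 ?add0r; last first.
  by move=> i /andP[_ iN]; rewrite /tail iN cmod0 expr0n.
rewrite big_nat [leRHS]big_nat; apply: ler_sum => i /andP[Ni _].
by rewrite /tail ltnNge Ni.
Qed.

Definition psum a N z : cplx R := \sum_(i < N) a i * z ^+ i.

Lemma ps_tail a f N : ps_on a 0 1 f -> ps_on (tail a N) 0 1 (fun z => f z - psum a N z).
Proof.
move=> af z z1; have := af z z1; rewrite subr0 in z1 *.
move=> /cvgnP h; apply/cvgnP => e /h[K hK]; exists (maxn K N) => n.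
rewrite geq_max => /andP[Kn Nn]; have := hK n Kn.
rewrite /series /= (big_cat_nat (n := N) (p := n))//= => h1.
have E0 : \sum_(0 <= i < N) tail a N i * z ^+ i = 0.
  by rewrite big_nat big1// => i /andP[_ iN]; rewrite /tail iN mul0r.
rewrite (big_cat_nat (n := N) (p := n))//= E0 add0r.
rewrite (_ : \sum_(N <= i < n) tail a N i * z ^+ i = \sum_(N <= i < n) a i * z ^+ i); last first.
  rewrite big_nat [RHS]big_nat; apply: eq_bigr => i /andP[Ni _].
  by rewrite /tail ltnNge Ni.
rewrite /psum -(big_mkord xpredT (fun i => a i * z ^+ i)) opprB.
by apply: le_lt_trans h1; rewrite le_eqVlt; apply/orP; left; apply/eqP; congr cmod; ring.
Qed.

Lemma psum_hol a N z : hol_at (psum a N) z.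
Proof.
apply: (@ps_hol R (fun n => if (n < N)%N then a n else 0) 0 (cmod z + 1)); last by rewrite subr0 ltrDl.
move=> w _; apply/cvgnP => e e0; exists N => n Nn.
have E0 : \sum_(N <= i < n) (if (i < N)%N then a i else 0) * (w - 0) ^+ i = 0.
  by rewrite big_nat big1// => i /andP[Ni _]; rewrite ltnNge Ni /= mul0r.
have E1 : \sum_(0 <= i < N) (if (i < N)%N then a i else 0) * (w - 0) ^+ i = psum a N w.
  rewrite /psum -(big_mkord xpredT (fun i => a i * w ^+ i)) [LHS]big_nat [RHS]big_nat.
  by apply: eq_bigr => i /andP[_ ->]; rewrite subr0.
by rewrite /series /= (big_cat_nat (n := N))//= E0 E1 addr0 subrr cmod0.
Qed.

End Tails.

(** * Fatou's theorem on nontangential limits *)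

Section Nontangential.
Variable R : realType.
Implicit Types (x y r s t p d m c T e al : R) (z w l : cplx R) (f g : cplx R -> cplx R) (a b : nat -> cplx R).
Notation circ := (@circle_pt R).
Notation mu := (@lebesgue_measure R).

#[global] Instance nontangential_filter w : Filter (nontangential w).
Proof.
split.
- by move=> al _; exact: filterT.
- by move=> P Q hP hQ al h; apply: filterI; [exact: hP|exact: hQ].
- by move=> P Q PQ hP al h; apply: filterS PQ _; exact: hP.
Qed.

Lemma nontangentialP w (A : set (cplx R)) : nontangential w A <->
  forall al, 1 < al -> exists2 d, 0 < d & forall z, stolz al w z -> cmod (z - w) < d -> A z.
Proof.
split=> [H al al1|H al al1].
  have := H al al1; rewrite /within /= => /nbhs_cplxP[d d0 hd].
  by exists d => // z zs zd; exact: hd.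
have [d d0 hd] := H al al1; rewrite /within /=; apply/nbhs_cplxP.
by exists d => // z zd zs; exact: hd.
Qed.

Lemma radial_stolz al t r : 1 < al -> 0 <= r -> r < 1 -> stolz al (circ t) (rc r * circ t).
Proof.
move=> al1 r0 r1; have h : cmod (rc r * circ t) = r by exact: cmod_rcirc.
split; first by change (cmod (rc r * circ t) < 1); rewrite h.
rewrite h (_ : _ - _ = rc (- (1 - r)) * circ t); last first.
  by apply: cplxP; rewrite ?(cReD, cReM, cReN, cImD, cImM, cImN) /=; ring.
rewrite cmodM cmod_circ mulr1 cmod_rc normrN ger0_norm ?subr_ge0 ?ltW//.
by rewrite ltr_pMl ?subr_gt0.
Qed.

Definition rad n : R := 1 - n.+2%:R^-1.
Lemma rad_ge0 n : 0 <= rad n.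
Proof. by rewrite subr_ge0 invf_le1// ler1n. Qed.
Lemma rad_lt1 n : rad n < 1.
Proof. by rewrite gtrBl invr_gt0. Qed.
Lemma rad_cvg : rad @ \oo --> (1 : R).
Proof.
rewrite -[X in _ --> X]subr0; apply: cvgB; first exact: cvg_cst.
by have hh := @cvg_harmonic R; rewrite -cvg_shiftS in hh; exact: hh.
Qed.

Lemma rad_circ_cvg t : rc (rad n) * circ t @[n --> \oo] --> circ t.
Proof.
apply/cvg_cplx_modP.
have -> : (fun k => cmod (rc (rad k) * circ t - circ t)) = (fun k => `|rad k - 1|).
  apply/funext => k; rewrite (_ : _ - _ = rc (rad k - 1) * circ t).
    by rewrite cmodM cmod_circ mulr1 cmod_rc.
  by apply: cplxP; rewrite ?(cReD, cReM, cReN, cImD, cImM, cImN) /=; ring.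
rewrite -(normr0 R) -(subrr (1 : R)); apply: cvg_norm; apply: cvgB; first exact: rad_cvg.
exact: cvg_cst.
Qed.

#[global] Instance nontangential_proper t : ProperFilter (nontangential (circ t)).
Proof.
apply: Build_ProperFilter_ex => A /nontangentialP/(_ 2 (ltr1n _ 2))[d d0 hd].
have /cvgnP/(_ d d0)[N hN] := @rad_circ_cvg t.
exists (rc (rad N) * circ t); apply: hd; last exact: hN.
by apply: radial_stolz; rewrite ?rad_ge0 ?rad_lt1 ?ltr1n.
Qed.

Lemma nontangential_radial f t l : f z @[z --> nontangential (circ t)] --> l ->
  f (rc (rad n) * circ t) @[n --> \oo] --> l.
Proof.
move=> /cvg_cplxP h; apply/cvgnP => e /h/nontangentialP/(_ 2 (ltr1n _ 2))[d d0 hd].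
have /cvgnP/(_ d d0)[N hN] := @rad_circ_cvg t.
exists N => n Nn; apply: hd; last exact: hN.
by apply: radial_stolz; rewrite ?rad_ge0 ?rad_lt1 ?ltr1n.
Qed.

Lemma cplx_complete (u : nat -> cplx R) :
  (forall e, 0 < e -> exists c : cplx R, exists N, forall n, (N <= n)%N -> cmod (u n - c) < e) ->
  exists l, u @ \oo --> l.
Proof.
move=> H.
have cr : cvgn (fun n => Re (u n)).
  apply/cauchy_cvgP/cauchy_exP => e /H[c [N hN]]; exists (Re c); exists N => // n /= /hN.
  by rewrite /ball /= distrC; apply: le_lt_trans; rewrite -cReN -cReD Re_le.
have ci : cvgn (fun n => Im (u n)).
  apply/cauchy_cvgP/cauchy_exP => e /H[c [N hN]]; exists (Im c); exists N => // n /= /hN.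
  by rewrite /ball /= distrC; apply: le_lt_trans; rewrite -cImN -cImD Im_le.
exists (Complex (limn (fun n => Re (u n))) (limn (fun n => Im (u n)))).
by apply: cvg_ReIm.
Qed.

(** The values along the radius form a Cauchy sequence, as they stay within e of values
  tending to [S N (circ t)]; its limit is the limit on every Stolz angle, since the
  radius ends up in each of them. *)
Lemma nontangential_cvg f t (S : nat -> cplx R -> cplx R) :
  (forall n, S n z @[z --> circ t] --> S n (circ t)) ->
  (forall al e, 1 < al -> 0 < e -> exists N, forall z, stolz al (circ t) z ->
     cmod (f z - S N z) <= e) ->
  exists l, f z @[z --> nontangential (circ t)] --> l.
Proof.
move=> cS H.
have [l hl] : exists l, f (rc (rad n) * circ t) @[n --> \oo] --> l.
  apply: cplx_complete => e e0.
  have e2 : 0 < e / 2 by rewrite divr_gt0.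
  have [N hN] := H 2 _ (ltr1n _ 2) e2.
  have /cvgnP/(_ _ e2)[K hK] : S N (rc (rad n) * circ t) @[n --> \oo] --> S N (circ t).
    exact: (cvg_comp (fun n => rc (rad n) * circ t) (S N) (@rad_circ_cvg t) (cS N)).
  exists (S N (circ t)), K => n Kn.
  have st : stolz 2 (circ t) (rc (rad n) * circ t).
    by apply: radial_stolz; rewrite ?rad_ge0 ?rad_lt1 ?ltr1n.
  rewrite -[f _](subrK (S N (rc (rad n) * circ t))) -addrA (splitr e).
  by apply: le_lt_trans (cmodD _ _) _; apply: ler_ltD; [exact: hN|exact: hK].
exists l; apply/cvg_cplxP => e e0; apply/nontangentialP => al al1.
have e4 : 0 < e / 4 by rewrite divr_gt0.
have [N hN] := H al _ al1 e4.
have /cvg_cplx_atP/(_ _ e4)[d d0 hd] := cS N.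
have Sl : cmod (l - S N (circ t)) <= e / 4.
  have h1 : f (rc (rad n) * circ t) + - S N (rc (rad n) * circ t) @[n --> \oo] --> l + - S N (circ t).
    have h2 : S N (rc (rad n) * circ t) @[n --> \oo] --> S N (circ t).
      exact: (cvg_comp (fun n => rc (rad n) * circ t) (S N) (@rad_circ_cvg t) (cS N)).
    exact: (cvgn_cplxD hl (cvgn_cplxN h2)).
  apply: (cvgn_cmod_le h1) => n; apply: hN.
  by apply: radial_stolz; rewrite ?rad_ge0 ?rad_lt1.
exists d => // z zs zd.
have h1 := hN z zs; have h2 := hd z zd.
rewrite (_ : f z - l = (f z - S N z) + ((S N z - S N (circ t)) - (l - S N (circ t)))); last by ring.
apply: le_lt_trans (cmodD _ _) _.
have h3 := cmodD (S N z - S N (circ t)) (- (l - S N (circ t))).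
by rewrite cmodN in h3; lra.
Qed.

Lemma stolz_mono al be w : al <= be -> stolz al w `<=` stolz be w.
Proof.
move=> ab z [zD zw]; split => //; apply: lt_le_trans zw _.
by rewrite ler_wpM2r// subr_ge0 ltW.
Qed.

(** Fix an aperture and an error 1 / (n + 1). By [weak_type] for the tail of order N,
  outside a set of measure O(tau N) the partial sum of order N approximates f within
  that error on the whole Stolz angle. As tau N tends to 0, almost every point admits
  such an N, and [nontangential_cvg] applies outside a countable union of null sets. *)
Theorem fatou_nontangential a f T : ps_on a 0 1 f -> l2le a T ->
  {ae mu, forall t, 0 <= t <= 2 * pi ->
    f z @[z --> nontangential (circ t)] --> boundary f (circ t)}.
Proof.
move=> af aT; have [tau [tau0 tau_ge0 htau]] := l2_tail aT.
pose al j : R := j.+2%:R.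
pose c j n : R := (n.+1%:R^-1) ^+ 2 / (64 * (1 + al j) ^+ 2).
have al0 j : 0 < al j by [].
have c0 j n : 0 < c j n.
  by rewrite divr_gt0 ?exprn_gt0 ?invr_gt0// mulr_gt0// exprn_gt0// addr_gt0.
have W (j n N : nat) := @weak_type R _ _ _ (c j n) (al j) (@ps_tail R a f N af) (htau N) (c0 j n) (al0 j).
pose A j n N : set R := projT1 (boolp.cid (W j n N)).
have mA j n N : measurable (A j n N : set (measurableTypeR R)).
  by rewrite /A; case: boolp.cid => /= X [].
have muA j n N : (mu (A j n N) <= (12 * pi * tau N / c j n)%:E)%E.
  by rewrite /A; case: boolp.cid => /= X [].
have hA j n N x : 0 <= x <= 2 * pi -> ~ A j n N x -> forall z, stolz (al j) (circ x) z ->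
    cmod (f z - psum a N z) <= n.+1%:R^-1.
  move=> x01; rewrite /A; case: boolp.cid => /= X [_ _ hX] nX z zs.
  have := hX x x01 nX z zs.
  rewrite /c mulrC divfK; last by rewrite gt_eqF// mulr_gt0// exprn_gt0// addr_gt0.
  by rewrite ler_pXn2r// ?nnegrE ?cmod_ge0 ?invr_ge0.
pose D j n : set R := \bigcap_N A j n N.
have nD j n : mu.-negligible (D j n).
  have mD : measurable (D j n : set (measurableTypeR R)).
    by apply: bigcap_measurable => [|k _]; [exists 0%N|exact: mA].
  apply/negligibleP => //; apply/eqP; rewrite eq_le measure_ge0 andbT.
  have cv : (fun N => (12 * pi * tau N / c j n)%:E) @ \oo --> 0%:E.
    have h : (fun N => 12 * pi / c j n * tau N) @ \oo --> (0 : R).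
      by rewrite -[X in _ --> X](mulr0 (12 * pi / c j n)); exact: (cvgM (cvg_cst _) tau0).
    have -> : (fun N => (12 * pi * tau N / c j n)%:E) = (fun N => (12 * pi / c j n * tau N)%:E).
      by apply/funext => N; rewrite mulrAC.
    by apply: cvg_EFin => //; exact: nearW.
  change (mu (D j n) <= 0%:E)%E; rewrite -(cvg_lim _ cv)//; apply: lime_ge; first by apply/cvg_ex; eexists; exact: cv.
  apply: nearW => N; apply: le_trans (muA j n N).
  by apply: le_measure; rewrite ?inE// => x Dx; exact: Dx.
apply: (@negligibleS _ _ _ mu (\bigcup_j \bigcup_n D j n)); last first.
  by apply: negligible_bigcup => j; apply: negligible_bigcup => n; exact: nD.
move=> t /= Ht; apply: contrapT => nt; apply: Ht => t01.
have [l hl] : exists l, f z @[z --> nontangential (circ t)] --> l.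
  apply: (@nontangential_cvg f t (psum a)) => [n|be e be1 e0].
    exact: hol_at_continuous (psum_hol _ _ _).
  have [j hj] : exists j, be <= al j.
    exists (Num.truncn be); have := truncnS_gt be => h.
    by rewrite (le_trans (ltW h))// ler_nat.
  have [n hn] : exists n : nat, n.+1%:R^-1 < e.
    exists (Num.truncn e^-1); rewrite -[ltRHS]invrK ltf_pV2 ?posrE ?invr_gt0//.
    exact: truncnS_gt.
  have [N nA] : exists N, ~ A j n N t.
    apply: contrapT => H; apply: nt; exists j => //; exists n => // N _.
    by apply: contrapT => nA; apply: H; exists N.
  exists N => z zs; apply: le_trans (ltW hn).
  by apply: (hA j n N t t01 nA); apply: stolz_mono zs.
by rewrite /boundary (lim_cplxP hl).
Qed.

End Nontangential.

(** * Integrals of functions known almost everywhere *)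

Section IntegralComparison.
Local Open Scope ereal_scope.
Context d (X : measurableType d) (R : realType) (mu : {measure set X -> \bar R}).
Implicit Types (D : set X) (f g : X -> \bar R).

Lemma ge0_le_integral_any D f g : (forall x, D x -> 0 <= f x) ->
  (forall x, D x -> f x <= g x) -> \int[mu]_(x in D) f x <= \int[mu]_(x in D) g x.
Proof.
move=> f0 fg; rewrite integral_mkcond (integral_mkcond D g).
rewrite !ge0_integralTE/=; last 2 first.
- by move=> x; rewrite /patch; case: ifPn => // /[!inE] Dx; exact: le_trans (f0 _ Dx) (fg _ Dx).
- by move=> x; rewrite /patch; case: ifPn => // /[!inE]; exact: f0.
apply: ereal_sup_le => _ [h /= hf <-]; exists h => //= x.
apply: le_trans (hf x) _; rewrite /patch; case: ifPn => // /[!inE]; exact: fg.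
Qed.

(** The boundary function of an element of the Hardy space is pinned down only outside
  a null set, which leaves its measurability undecided. Its integral is therefore
  compared, here and in [ae_ge_integral], with integrals of measurable functions. *)
Lemma ae_le_integral D f g : measurable D -> measurable_fun D g ->
  (forall x, D x -> 0 <= f x) -> (forall x, D x -> 0 <= g x) ->
  {ae mu, forall x, D x -> f x <= g x} ->
  \int[mu]_(x in D) f x <= \int[mu]_(x in D) g x.
Proof.
move=> mD mg f0 g0 [N [mN muN fgN]].
rewrite (@ge0_negligible_integral _ _ _ mu D N g)//.
have mDN : measurable (D `\` N) by exact: measurableD.
rewrite integral_mkcond.
have mgN : measurable_fun [set: X] (g \_ (D `\` N)).
  apply: (measurable_restrictT _ mDN).1.
  by apply: measurable_funS mg => // x [].
have mcN : measurable_fun [set: X] ((cst +oo : X -> \bar R) \_ N).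
  by apply: (measurable_restrictT _ mN).1; exact: measurable_cst.
have gN0 x : 0 <= (g \_ (D `\` N)) x.
  by rewrite /patch; case: ifPn => // /[!inE] -[Dx _]; exact: g0.
have cN0 x : 0 <= ((cst +oo : X -> \bar R) \_ N) x.
  by rewrite /patch; case: ifPn => // _; exact: leey.
(* The majorant is infinite on N, which does not change its integral. *)
apply: (@le_trans _ _ (\int[mu]_x ((g \_ (D `\` N)) x + ((cst +oo : X -> \bar R) \_ N) x))).
  apply: ge0_le_integral_any => x _.
    by rewrite /patch; case: ifPn => // /[!inE]; exact: f0.
  rewrite {1}/patch; case: ifPn => [/[!inE] Dx|_]; last exact: adde_ge0.
  have [Nx|Nx] := pselect (N x).
    rewrite [X in _ <= _ + X](_ : _ = +oo) ?addey ?leey//; last first.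
      by rewrite /patch mem_set.
    by rewrite gt_eqF// (lt_le_trans _ (gN0 x)).
  rewrite [X in _ <= X + _](_ : _ = g x); last by rewrite /patch mem_set.
  rewrite [X in _ <= _ + X](_ : _ = 0) ?adde0; last by rewrite /patch memNset.
  by have := contra_notP (@fgN x) Nx; apply.
by rewrite ge0_integralD// -!integral_mkcond integral_cst// muN mule0 adde0.
Qed.

Lemma ae_ge_integral D f g : measurable D -> measurable_fun D f ->
  (forall x, D x -> 0 <= f x) -> (forall x, D x -> 0 <= g x) ->
  {ae mu, forall x, D x -> f x <= g x} ->
  \int[mu]_(x in D) f x <= \int[mu]_(x in D) g x.
Proof.
move=> mD mf f0 g0 [N [mN muN fgN]].
rewrite (@ge0_negligible_integral _ _ _ mu D N f)//.
rewrite integral_mkcond [leRHS]integral_mkcond.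
apply: ge0_le_integral_any => x _.
  by rewrite /patch; case: ifPn => // /[!inE] -[Dx _]; exact: f0.
rewrite /patch; case: ifPn => [/[!inE] -[Dx Nx]|_].
  rewrite mem_set//.
  by have := contra_notP (@fgN x) Nx; apply.
by case: ifPn => // /[!inE]; exact: g0.
Qed.

Lemma measurable_limn_einf D (f : nat -> X -> \bar R) :
  (forall n, measurable_fun D (f n)) -> measurable_fun D (fun x => limn_einf (f ^~ x)).
Proof.
move=> mf.
have -> : (fun x => limn_einf (f ^~ x)) = (fun x => - limn_esup ((fun n x => - f n x) ^~ x)).
  by apply/funext => x; rewrite -limn_einfN; congr limn_einf; apply/funext => n /=; rewrite oppeK.
apply: measurableT_comp => //.
by apply: measurable_fun_limn_esup => n; apply: measurableT_comp.
Qed.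

End IntegralComparison.

Section CircleLiminf.
Variable R : realType.
Implicit Types (x y r s t p m c T e : R) (z w l : cplx R) (f g : cplx R -> cplx R) (a b : nat -> cplx R).
Notation circ := (@circle_pt R).
Notation mu := (@lebesgue_measure R).

(** A measurable stand-in for a radial limit, defined at every point. *)
Definition circle_liminf (v : nat -> R -> R) t : \bar R := limn_einf (fun k => (v k t)%:E).

Lemma circle_liminf_ge0 (v : nat -> R -> R) t : (forall k, 0 <= v k t) -> (0 <= circle_liminf v t)%E.
Proof.
move=> v0; rewrite /circle_liminf limn_einf_lim; apply: lime_ge; first exact: is_cvg_einfs.
by apply: nearW => n; apply: le_ereal_inf_tmp => _ [k _ <-]; rewrite lee_fin.
Qed.

Lemma measurable_circle_liminf (v : nat -> R -> R) p : (forall k, continuous (v k)) ->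
  measurable_fun (period p : set (measurableTypeR R)) (circle_liminf v).
Proof.
move=> cv; apply: (@measurable_limn_einf _ (measurableTypeR R) R (period p) (fun k t => (v k t)%:E)) => k.
by have /integrableP[] := continuous_integrable p (cv k).
Qed.

Lemma circle_liminf_cvg (v : nat -> R -> R) t x : v k t @[k --> \oo] --> x -> circle_liminf v t = x%:E.
Proof.
move=> h; apply: (cvg_limn_einf_sup _).1; apply: cvg_EFin; first exact: nearW.
exact: h.
Qed.

Lemma circle_liminf_fatou (v : nat -> R -> R) p m : (forall k, continuous (v k)) ->
  (forall k t, 0 <= v k t) -> (forall k, pint p (v k) <= m) ->
  (\int[mu]_(t in period p) circle_liminf v t <= m%:E)%E.
Proof.
move=> cv v0 vm.
apply: le_trans (@fatou _ (measurableTypeR R) R mu (period p) (measurable_period p)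
  (fun k t => (v k t)%:E) _ _) _.
- by move=> k; have /integrableP[] := continuous_integrable p (cv k).
- by move=> k t _; rewrite lee_fin.
rewrite limn_einf_lim; apply: lime_le; first exact: is_cvg_einfs.
apply: nearW => n; apply: (@le_trans _ _ (\int[mu]_(t in period p) (v n t)%:E)%E).
  by apply: ereal_inf_lbound; exists n => //=.
by rewrite pint_EFin// lee_fin.
Qed.

End CircleLiminf.

(** * The Hardy norm controls the coefficients *)

Section HardyNorm.
Variable R : realType.
Implicit Types (x y r s t p m c T M e : R) (z w l : cplx R) (f : cplx R -> cplx R) (a b : nat -> cplx R).
Notation circ := (@circle_pt R).
Notation mu := (@lebesgue_measure R).

Lemma ae_imp (P Q : R -> Prop) : (forall t, P t -> Q t) ->
  {ae mu, forall t, P t} -> {ae mu, forall t, Q t}.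
Proof. by move=> PQ; apply: negligibleS => t /= nQ Pt; apply: nQ; exact: PQ. Qed.

Lemma period0E : period 0 = `[0, 2 * pi]%classic :> set R.
Proof. by rewrite /period add0r. Qed.

Lemma circle_int_ge (u : R -> \bar R) (g : cplx R -> \bar R) :
  measurable_fun (period 0 : set (measurableTypeR R)) u ->
  (forall t, 0 <= u t)%E -> (forall w, 0 <= g w)%E ->
  {ae mu, forall t, 0 <= t <= 2 * pi -> (u t <= g (circ t))%E} ->
  ((2 * pi)^-1%:E * \int[mu]_(t in period 0) u t <= circle_int g)%E.
Proof.
move=> mu' u0 g0 ug; rewrite /circle_int -period0E.
apply: lee_wpmul2l; first by rewrite lee_fin invr_ge0 ltW// twopi_gt0.
apply: ae_ge_integral => //; first exact: measurable_period.
apply: ae_imp ug => t h; rewrite period0E /= in_itv/=; exact: h.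
Qed.

Lemma circle_int_le (u : R -> \bar R) (g : cplx R -> \bar R) :
  measurable_fun (period 0 : set (measurableTypeR R)) u ->
  (forall t, 0 <= u t)%E -> (forall w, 0 <= g w)%E ->
  {ae mu, forall t, 0 <= t <= 2 * pi -> (g (circ t) <= u t)%E} ->
  (circle_int g <= (2 * pi)^-1%:E * \int[mu]_(t in period 0) u t)%E.
Proof.
move=> mu' u0 g0 ug; rewrite /circle_int -period0E.
apply: lee_wpmul2l; first by rewrite lee_fin invr_ge0 ltW// twopi_gt0.
apply: ae_le_integral => //; first exact: measurable_period.
apply: ae_imp ug => t h; rewrite period0E /= in_itv/=; exact: h.
Qed.

Definition norm2 f : \bar R := circle_int (fun w => (cmod (boundary f w) ^+ 2)%:E).

Lemma norm2_ge0 f : (0 <= norm2 f)%E.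
Proof.
apply: mule_ge0; first by rewrite lee_fin invr_ge0 ltW// twopi_gt0.
by apply: integral_ge0 => t _; rewrite lee_fin sqr_ge0.
Qed.

Lemma hardy_norm_sqr f : (hardy_norm f ^+ 2)%E = norm2 f.
Proof.
rewrite /hardy_norm -/(norm2 f); have := norm2_ge0 f; case: (norm2 f) => [x| |]//.
- rewrite lee_fin => x0; rewrite poweR_EFin -EFin_expe powR12_sqrt// sqr_sqrtr//.
- by move=> _; rewrite poweRyr ?invr_eq0// expe2 mulyy.
Qed.

Lemma hardy_norm_le f M : (hardy_norm f <= M%:E)%E -> (norm2 f <= (M ^+ 2)%:E)%E.
Proof.
move=> h; rewrite -hardy_norm_sqr EFin_expe.
have h0 : (0 <= hardy_norm f)%E by exact: poweR_ge0.
by rewrite !expe2 lee_pmul.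
Qed.

Definition radial_sqr f k t : R := cmod (f (rc (rad R k) * circ t)) ^+ 2.

Lemma norm2_liminf a f T : ps_on a 0 1 f -> l2le a T ->
  ((2 * pi)^-1%:E * \int[mu]_(t in period 0)
    circle_liminf (radial_sqr f) t <= norm2 f)%E.
Proof.
move=> af aT.
have cv k : continuous (radial_sqr f k).
  exact: (continuous_cmod2 (ps_circ_cont af (rad_ge0 R k) (rad_lt1 R k))).
apply: circle_int_ge.
- exact: measurable_circle_liminf.
- by move=> t; apply: circle_liminf_ge0 => k; exact: sqr_ge0.
- by move=> w; rewrite lee_fin sqr_ge0.
apply: ae_imp (fatou_nontangential af aT) => t h t01.
rewrite (@circle_liminf_cvg _ _ _ (cmod (boundary f (circ t)) ^+ 2))//.
have h1 : cmod (f (rc (rad R n) * circ t)) @[n --> \oo] --> cmod (boundary f (circ t)).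
  by apply: cvg_cmod; exact: nontangential_radial (h t01).
exact: (cvgM h1 h1).
Qed.

Lemma sqr_cmod_le z w : cmod z ^+ 2 <= 2 * cmod w ^+ 2 + 2 * cmod (w - z) ^+ 2.
Proof.
have := cmodD w (- (w - z)); rewrite cmodN (_ : w - (w - z) = z); last by ring.
have := cmod_ge0 z; have := cmod_ge0 w; have := cmod_ge0 (w - z).
move: (cmod z) (cmod w) (cmod (w - z)) => u v q q0 v0 u0 h.
apply: (@le_trans _ _ ((v + q) ^+ 2)); first by rewrite lerXn2r ?nnegrE ?addr_ge0.
by have := sqr_ge0 (v - q); nra.
Qed.

(** Let S be a partial sum of f. Almost everywhere on the circle
  |S|^2 <= 2 |f|^2 + 2 |f - S|^2. The integral of |S|^2 is given by Parseval's identity,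
  and by Fatou's lemma along the radii that of |f - S|^2 is at most 2 pi times the tail
  of the coefficients, which tends to 0. The exact identity would replace 2 M by M;
  the factor is harmless for compactness. *)
Lemma l2le_norm2 a f T M : ps_on a 0 1 f -> l2le a T -> (norm2 f <= M%:E)%E ->
  l2le a (2 * M).
Proof.
move=> af aT fM; have [tau [tau0 tau_ge0 htau]] := l2_tail aT.
have pi2 := twopi_gt0 R.
suff H N : \sum_(i < N) cmod (a i) ^+ 2 <= 2 * M + 2 * tau N.
  move=> K; have cvt : (fun N => 2 * M + 2 * tau N) @ \oo --> 2 * M.
    rewrite -[X in _ --> X]addr0; apply: cvgD; first exact: cvg_cst.
    by rewrite -[X in _ --> X](mulr0 2); apply: cvgM => //; exact: cvg_cst.
  apply: (@closed_cvg _ _ \oo _ _ [set x | \sum_(i < K) cmod (a i) ^+ 2 <= x] _ _ _ cvt).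
    exact: closed_ge.
  exists K => // N /= KN; apply: le_trans (H N).
  rewrite -!(big_mkord xpredT (fun i => cmod (a i) ^+ 2)).
  by rewrite [leRHS](big_cat_nat (n := K))//= lerDl sumr_ge0// => i _; exact: sqr_ge0.
pose v := radial_sqr f.
pose vN k t : R := cmod (f (rc (rad R k) * circ t) - psum a N (rc (rad R k) * circ t)) ^+ 2.
have cv k : continuous (v k).
  exact: (continuous_cmod2 (ps_circ_cont af (rad_ge0 R k) (rad_lt1 R k))).
have afN := @ps_tail R a f N af.
have cvN k : continuous (vN k).
  exact: (continuous_cmod2 (ps_circ_cont afN (rad_ge0 R k) (rad_lt1 R k))).
have L0 t : (0 <= circle_liminf v t)%E by apply: circle_liminf_ge0 => k; exact: sqr_ge0.
have LN0 t : (0 <= circle_liminf vN t)%E by apply: circle_liminf_ge0 => k; exact: sqr_ge0.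
have mL := @measurable_circle_liminf R v 0 cv.
have mLN := @measurable_circle_liminf R vN 0 cvN.
have iL : (\int[mu]_(t in period 0) circle_liminf v t <= (2 * pi * M)%:E)%E.
  have := le_trans (norm2_liminf af aT) fM.
  by rewrite lee_pdivrMl// -EFinM.
have iLN : (\int[mu]_(t in period 0) circle_liminf vN t <= (2 * pi * tau N)%:E)%E.
  apply: circle_liminf_fatou => // [k t|k]; first exact: sqr_ge0.
  exact: (means_of_l2le 0 afN (htau N) (rad_ge0 R k) (rad_lt1 R k)).
have cS : continuous (fun t => psum a N (circ t)) by exact: cont_tpoly.
have mS : measurable_fun (period 0 : set (measurableTypeR R)) (fun t => (cmod (psum a N (circ t)) ^+ 2)%:E).
  by have /integrableP[] := continuous_integrable 0 (continuous_cmod2 cS).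
have two0 : (0%R <= 2%:E :> \bar R)%E by rewrite lee_fin.
have : (\int[mu]_(t in period 0) (cmod (psum a N (circ t)) ^+ 2)%:E <=
    \int[mu]_(t in period 0) (2%:E * circle_liminf v t + 2%:E * circle_liminf vN t))%E.
  apply: (@ae_ge_integral _ (measurableTypeR R) R mu (period 0) _ _ (measurable_period 0) mS).
  - by move=> t _; rewrite lee_fin sqr_ge0.
  - by move=> t _; rewrite adde_ge0// mule_ge0.
  apply: ae_imp (fatou_nontangential af aT) => t h tp.
  have {h}h := h _; have t01 : 0 <= t <= 2 * pi by move: tp; rewrite period0E /= in_itv.
  have {h}hf := nontangential_radial (h t01).
  have hS : psum a N (rc (rad R n) * circ t) @[n --> \oo] --> psum a N (circ t).
    exact: (cvg_comp (fun n => rc (rad R n) * circ t) (psum a N) (@rad_circ_cvg R t)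
      (hol_at_continuous (psum_hol a N (circ t)))).
  have h1 : cmod (f (rc (rad R n) * circ t)) @[n --> \oo] --> cmod (boundary f (circ t)).
    by apply: cvg_cmod; exact: hf.
  have h2 : cmod (f (rc (rad R n) * circ t) + - psum a N (rc (rad R n) * circ t)) @[n --> \oo] -->
      cmod (boundary f (circ t) + - psum a N (circ t)).
    by apply: cvg_cmod; exact: (cvgn_cplxD hf (cvgn_cplxN hS)).
  rewrite (circle_liminf_cvg (v := v) (cvgM h1 h1)) (circle_liminf_cvg (v := vN) (cvgM h2 h2)).
  by rewrite -!EFinM -EFinD lee_fin -!expr2 sqr_cmod_le.
rewrite (pint_EFin 0 (continuous_cmod2 cS)) parseval_poly.
have m2 (u : R -> \bar R) : measurable_fun (period 0 : set (measurableTypeR R)) u ->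
    measurable_fun (period 0 : set (measurableTypeR R)) (fun t => 2%:E * u t)%E.
  by move=> h; exact: measurable_funeM.
rewrite (@ge0_integralD _ (measurableTypeR R) R mu (period 0) (measurable_period 0) _ _ _ (m2 _ mL) _ (m2 _ mLN)); last 2 first.
- by move=> t _; rewrite mule_ge0.
- by move=> t _; rewrite mule_ge0.
rewrite (@ge0_integralZl_EFin _ (measurableTypeR R) R mu (period 0) (measurable_period 0) _ _ mL)//.
rewrite (@ge0_integralZl_EFin _ (measurableTypeR R) R mu (period 0) (measurable_period 0) _ _ mLN)//.
move=> h; have {h}h := le_trans h (leeD (lee_wpmul2l two0 iL) (lee_wpmul2l two0 iLN)).
rewrite -!EFinM -EFinD lee_fin in h.
by rewrite -(ler_pM2l pi2); lra.
Qed.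

End HardyNorm.

(** * Bounded sequences of square summable coefficients *)

Section SequenceSpace.
Variable R : realType.
Implicit Types (x y r s t p m T B e : R) (z w l : cplx R) (f : cplx R -> cplx R) (a b c d : nat -> cplx R).

Lemma l2le_coef a T n : l2le a T -> cmod (a n) <= T + 1.
Proof.
move=> /(_ n.+1); rewrite big_ord_recr /= => h.
have h2 : cmod (a n) ^+ 2 <= T by apply: le_trans h; rewrite lerDr sumr_ge0// => i _; exact: sqr_ge0.
by have := sqr_ge0 (cmod (a n) - 1); nra.
Qed.

Lemma l2leB a b T : l2le a T -> l2le b T -> l2le (fun n => a n - b n) (4 * T).
Proof.
move=> aT bT N; apply: (@le_trans _ _ (\sum_(i < N) (2 * cmod (a i) ^+ 2 + 2 * cmod (b i) ^+ 2))).
  apply: ler_sum => i _; have := sqr_cmod_le (a i - b i) (a i).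
  by rewrite (_ : a i - (a i - b i) = b i); last ring.
by rewrite big_split /= -!mulr_sumr; have := aT N; have := bT N; lra.
Qed.

Lemma l2_ps c T : l2le c T ->
  ps_on c 0 1 (fun z => lim (series (fun n => c n * z ^+ n) @ \oo)).
Proof.
move=> cT z; rewrite subr0 => z1.
have [|l hl] := @abs_cvg_series R (fun n => c n * z ^+ n) ((T + 1) * (1 - cmod z)^-1).
  move=> N; apply: (@le_trans _ _ (\sum_(i < N) (T + 1) * cmod z ^+ i)).
    apply: ler_sum => i _; rewrite cmodM cmodX ler_wpM2r ?exprn_ge0 ?cmod_ge0//.
    exact: l2le_coef cT.
  rewrite -mulr_sumr ler_wpM2l ?geo_le ?cmod_ge0//.
  by apply: le_trans (l2le_coef 0 cT); exact: cmod_ge0.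
by rewrite (lim_cplxP hl).
Qed.

Lemma ultra_bounded (U : set_system nat) (v : nat -> R) B : UltraFilter U ->
  (forall k, `|v k| <= B) -> exists l : R, v k @[k --> U] --> l.
Proof.
move=> UU vB.
have [|l [_ cl]] := @segment_compact R (- B) B (v @ U) _.
  have -> : (v @ U) `[(- B), B]%classic = U setT; last exact: filterT.
  congr U; apply/seteqP; split=> // k _ /=; rewrite in_itv/=.
  by have := vB k; rewrite ler_norml.
exists l => N /= Nl; have [//|nN] := in_ultra_setVsetC (v @^-1` N) UU.
by have [y []] := cl (~` N) N nN Nl.
Qed.

(** Along an ultrafilter finer than the filter of neighbourhoods of infinity all the
  coefficients converge at once. Near-limits for the first j + 1 coefficients are then
  realised at arbitrarily large indices, from which an increasing sequence is picked. *)
Lemma l2_subsequence (a : nat -> nat -> cplx R) T : (forall k, l2le (a k) T) ->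
  exists (c : nat -> cplx R) (kap : nat -> nat), [/\ {homo kap : m n / (m < n)%N}, l2le c T &
    forall n, a (kap j) n @[j --> \oo] --> c n].
Proof.
move=> aT; have [U [UU sU]] := ultraFilterLemma (_ : ProperFilter \oo).
have hc n : exists z : cplx R, a k n @[k --> U] --> z.
  have bnd k := l2le_coef n (aT k).
  have [lr hr] := @ultra_bounded U (fun k => Re (a k n)) (T + 1) UU
    (fun k => le_trans (Re_le _) (bnd k)).
  have [li hi] := @ultra_bounded U (fun k => Im (a k n)) (T + 1) UU
    (fun k => le_trans (Im_le _) (bnd k)).
  by exists (Complex lr li); apply: cvg_ReIm.
have [c hcc] := boolp.choice hc.
have near_c j K : exists k, (K <= k)%N /\ forall n, (n <= j)%N -> cmod (a k n - c n) < j.+1%:R^-1.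
  have h1 : U [set k | (K <= k)%N] by apply: sU; exists K.
  have h2 J : U [set k | forall n, (n <= J)%N -> cmod (a k n - c n) < j.+1%:R^-1].
    have hn n : U [set k | cmod (a k n - c n) < j.+1%:R^-1].
      exact: (@cvg_cplxP R _ U _ (fun k => a k n) (c n)).1 (hcc n) _ _.
    elim: J => [|J IH].
      by apply: filterS (hn 0%N) => k /= h n; rewrite leqn0 => /eqP ->.
    apply: filterS2 IH (hn J.+1) => k /= h3 h4 n; rewrite leq_eqVlt => /orP[/eqP->//|].
    by rewrite ltnS; exact: h3.
  by have [k [k1 k2]] := filter_ex (filterI h1 (h2 j)); exists k.
pose pick j K := projT1 (boolp.cid (near_c j K)).
have pickP j K : (K <= pick j K)%N /\ forall n, (n <= j)%N -> cmod (a (pick j K) n - c n) < j.+1%:R^-1.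
  by rewrite /pick; case: boolp.cid.
pose kap := fix kap j := if j is j'.+1 then pick j (kap j').+1 else pick 0%N 0%N.
have kapP j n : (n <= j)%N -> cmod (a (kap j) n - c n) < j.+1%:R^-1.
  by case: j => [|j] /=; [exact: (pickP 0%N 0%N).2|exact: (pickP j.+1 _).2].
have cv n : a (kap j) n @[j --> \oo] --> c n.
  apply/cvgnP => e e0; exists (maxn n (Num.truncn e^-1)) => j; rewrite geq_max => /andP[nj ej].
  apply: lt_trans (kapP j n nj) _; rewrite -[ltRHS]invrK ltf_pV2 ?posrE ?invr_gt0//.
  by rewrite (lt_le_trans (truncnS_gt _))// ler_nat.
exists c, kap; split => //.
- apply: homo_ltn => [|j] /=; first exact: ltn_trans.
  exact: (pickP j.+1 (kap j).+1).1.
move=> N.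
have h : \sum_(i < N) cmod (a (kap j) i) ^+ 2 @[j --> \oo] --> \sum_(i < N) cmod (c i) ^+ 2.
  apply: (@cvg_fsum R (fun i j => cmod (a (kap j) i) ^+ 2) (fun i => cmod (c i) ^+ 2)) => i.
  have h1 : cmod (a (kap j) i) @[j --> \oo] --> cmod (c i) by apply: cvg_cmod; exact: cv.
  exact: (cvgM h1 h1).
apply: (@closed_cvg _ _ \oo _ _ [set x | x <= T] _ _ _ h); first exact: closed_le.
by apply: nearW => j /=; exact: aT.
Qed.

End SequenceSpace.

(** * Composition with psi *)

Section Composition.
Variable R : realType.
Implicit Types (x y r s t p m T B e : R) (z w l : cplx R) (f h : cplx R -> cplx R) (a b c d : nat -> cplx R).
Notation circ := (@circle_pt R).
Notation mu := (@lebesgue_measure R).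
Variable psi : cplx R -> cplx R.
Hypothesis psi_an : analytic_on (disk R) psi.
Hypothesis psi_disk : forall z, disk R z -> disk R (psi z).

Definition psipow n z : cplx R := psi z ^+ n.

Lemma psipow_hol n z : disk R z -> hol_at (psipow n) z.
Proof.
move=> zD; elim: n => [|n IH].
  exists (fun=> 0), 1, 0 => // w k _ _.
  by rewrite /psipow !expr0 subrr mul0r subr0 cmod0 mul0r.
have -> : psipow n.+1 = fun z => psi z * psipow n z.
  by apply/funext => w; rewrite /psipow exprS.
exact: hol_atM (analytic_hol psi_an zD) IH.
Qed.

Lemma disk_circ r t : 0 <= r -> r < 1 -> disk R (rc r * circ t).
Proof.
by move=> r0 r1; change (cmod (rc r * circ t) < 1); rewrite cmod_rcirc.
Qed.

Lemma psipow_ps n : exists b, ps_on b 0 1 (psipow n) /\ l2le b 1.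
Proof.
have [b hb] := hol_disk_ps (psipow_hol n).
exists b; split => //; apply: (@l2le_of_means R b (psipow n) 1 0 hb) => r /andP[r0 r1].
apply: (@le_trans _ _ (pint 0 (fun _ : R => 1 : R))); last by rewrite pint_cst mul1r mulr1.
apply: pint_le.
- exact: (continuous_cmod2 (ps_circ_cont hb r0 r1)).
- by move=> t; exact: cvg_cst.
move=> t _; rewrite /psipow cmodX -exprM exprn_ile1// ltW//.
exact: (psi_disk (disk_circ t r0 r1)).
Qed.

Lemma boundary_pow n t l : psi z @[z --> nontangential (circ t)] --> l ->
  psipow n z @[z --> nontangential (circ t)] --> l ^+ n.
Proof.
move=> h; elim: n => [|n IH].
  have -> : psipow 0 = fun=> 1 by apply/funext => z; rewrite /psipow expr0.
  exact: cvg_cst.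
have -> : psipow n.+1 = fun z => psi z * psipow n z.
  by apply/funext => w; rewrite /psipow exprS.
by rewrite exprS; exact: (cvgM h IH).
Qed.

Hypothesis psi_sum : (\sum_(0 <= n <oo) norm2 (psipow n) < +oo)%E.

Lemma norm2_pow_fin n : norm2 (psipow n) = (fine (norm2 (psipow n)))%:E.
Proof.
rewrite fineK// ge0_fin_numE ?norm2_ge0//; apply: le_lt_trans psi_sum.
have h := @nneseries_lim_ge R (fun n => norm2 (psipow n)) xpredT 0 n.+1 (fun n _ _ => norm2_ge0 _).
by apply: le_trans h; rewrite big_nat_recr//= leeDr// sume_ge0// => i _; exact: norm2_ge0.
Qed.

Lemma norm2_pow_sum : exists S, forall N, \sum_(i < N) fine (norm2 (psipow i)) <= S.
Proof.
have S0 : (0 <= \sum_(0 <= n <oo) norm2 (psipow n))%E by apply: nneseries_ge0 => *; exact: norm2_ge0.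
exists (fine (\sum_(0 <= n <oo) norm2 (psipow n)))%E => N.
rewrite -lee_fin fineK ?ge0_fin_numE// -sumEFin.
under eq_bigr do rewrite -norm2_pow_fin.
rewrite -(big_mkord xpredT (fun i => norm2 (psipow i))).
by apply: nneseries_lim_ge => n _ _; exact: norm2_ge0.
Qed.

Lemma psipow_means n r p : 0 <= r -> r < 1 ->
  pint p (fun t => cmod (psipow n (rc r * circ t)) ^+ 2) <=
  2 * pi * (2 * fine (norm2 (psipow n))).
Proof.
move=> r0 r1; have [b [hb b1]] := psipow_ps n.
apply: (means_of_l2le p hb _ r0 r1); apply: (l2le_norm2 hb b1).
by rewrite -norm2_pow_fin.
Qed.

Lemma comp_hol f z : (forall w, disk R w -> hol_at f w) -> disk R z -> hol_at (f \o psi) z.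
Proof.
move=> hf zD; apply: hol_at_comp; first exact: hf (psi_disk zD).
exact: analytic_hol psi_an zD.
Qed.

(** On a circle of radius r < 1, |f (psi)|^2 is at most T times the sum of the
  |psi|^(2n), whose integral is controlled by the hypothesis on psi because the means of
  psi^n grow with r up to the boundary norm. Fatou's lemma passes from the partial sums
  of f to f. *)
Lemma comp_l2 a T f : ps_on a 0 1 f -> l2le a T ->
  exists b S, ps_on b 0 1 (f \o psi) /\ l2le b S.
Proof.
move=> af aT; have [S hS] := norm2_pow_sum.
have holf w : disk R w -> hol_at f w by move=> wD; apply: (ps_hol af); rewrite subr0.
have [|b hb] := @hol_disk_ps R (f \o psi); first by move=> z zD; exact: comp_hol.
have T0 : 0 <= T by apply: le_trans (aT 0%N); rewrite big_ord0.
exists b, (T * (2 * S)); split => //.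
apply: (@l2le_of_means R b (f \o psi) (T * (2 * S)) 0 hb) => r /andP[r0 r1].
have cf : continuous (fun t => (f \o psi) (rc r * circ t)) by exact: (ps_circ_cont hb r0 r1).
have [b1 [hb1 _]] := psipow_ps 1.
have cpsi n : continuous (fun t => psipow n (rc r * circ t)).
  by have [bn [hbn _]] := psipow_ps n; exact: (ps_circ_cont hbn r0 r1).
have cv N : continuous (fun t => psum a N (psi (rc r * circ t))).
  apply: (@cplx_cont_sum R 'I_N _ (fun (i : 'I_N) t => a i * psipow i (rc r * circ t))) => i.
  exact: (cplx_contM (cplx_cont_cst (a i)) (cpsi i)).
have ub N : pint 0 (fun t => cmod (psum a N (psi (rc r * circ t))) ^+ 2) <= 2 * pi * (T * (2 * S)).
  have csum M : continuous (fun t => \sum_(i < M) cmod (psipow i (rc r * circ t)) ^+ 2 : R) /\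
     pint 0 (fun t => \sum_(i < M) cmod (psipow i (rc r * circ t)) ^+ 2) <=
     2 * pi * (2 * \sum_(i < M) fine (norm2 (psipow i))).
    elim: M => [|M [cM IH]].
      have -> : (fun t => \sum_(i < 0) cmod (psipow i (rc r * circ t)) ^+ 2) = (fun=> 0).
        by apply/funext => t; rewrite big_ord0.
      by rewrite pint_cst big_ord0 mul0r !mulr0; split => // t; exact: cvg_cst.
    have -> : (fun t => \sum_(i < M.+1) cmod (psipow i (rc r * circ t)) ^+ 2) =
       (fun t => \sum_(i < M) cmod (psipow i (rc r * circ t)) ^+ 2 + cmod (psipow M (rc r * circ t)) ^+ 2).
      by apply/funext => t; rewrite big_ord_recr.
    have cM1 := continuous_cmod2 (cpsi M).
    split; first by move=> t; exact: (cvgD (cM t) (cM1 t)).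
    have E (X Y : R) : 2 * pi * (2 * (X + Y)) = 2 * pi * (2 * X) + 2 * pi * (2 * Y) by ring.
    rewrite (pintD 0 cM cM1) big_ord_recr /= E.
    by apply: lerD => //; exact: psipow_means.
  have [cN hN] := csum N.
  have cTN : continuous (fun t => T * \sum_(i < N) cmod (psipow i (rc r * circ t)) ^+ 2 : R).
    by move=> t; exact: (cvgM (cvg_cst T) (cN t)).
  apply: le_trans (pint_le (continuous_cmod2 (cv N)) cTN _) _.
    move=> t _; apply: le_trans (ps_point_bound _ N aT) _; rewrite ler_wpM2l//.
    by rewrite le_eqVlt; apply/orP; left; apply/eqP; apply: eq_bigr => i _;
       rewrite /psipow cmodX -!exprM mulnC.
  rewrite (pintZ 0 T cN) mulrCA ler_wpM2l//; apply: le_trans hN _.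
  by rewrite !ler_wpM2l// ?(ltW (twopi_gt0 R)).
have F := @circle_liminf_fatou R (fun N t => cmod (psum a N (psi (rc r * circ t))) ^+ 2) 0
  _ (fun N => continuous_cmod2 (cv N)) (fun N t => sqr_ge0 _) ub.
rewrite -lee_fin -(pint_EFin 0 (continuous_cmod2 cf)); apply: le_trans F.
rewrite le_eqVlt; apply/orP; left; apply/eqP; apply: eq_integral => t _.
rewrite (@circle_liminf_cvg _ _ _ (cmod ((f \o psi) (rc r * circ t)) ^+ 2))//.
have h0 : psum a N (psi (rc r * circ t)) @[N --> \oo] --> f (psi (rc r * circ t)).
  have := af (psi (rc r * circ t)); rewrite subr0 => /(_ (psi_disk (disk_circ t r0 r1))).
  have -> // : series (fun n => a n * psi (rc r * circ t) ^+ n) = fun N => psum a N (psi (rc r * circ t)).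
  by apply/funext => N; rewrite /series /psum /= big_mkord.
have h1 : cmod (psum a N (psi (rc r * circ t))) @[N --> \oo] --> cmod (f (psi (rc r * circ t))).
  by apply: cvg_cmod; exact: h0.
exact: (cvgM h1 h1).
Qed.

Lemma comp_hardy f : hardy R f -> hardy R (comp_op psi f).
Proof.
move=> /hardy_l2[a [T [af aT]]]; have [b [S [hb bS]]] := comp_l2 af aT.
exact: l2_hardy hb bS.
Qed.

(** The first K terms are bounded one by one, the others by Cauchy-Schwarz. *)
Lemma block_bound d D z K N : (K <= N)%N -> l2le d D -> cmod z <= 1 ->
  cmod (psum d N z) ^+ 2 <=
  2 * (\sum_(i < K) cmod (d i)) ^+ 2 + 2 * D * \sum_(K <= i < N) (cmod z ^+ 2) ^+ i.
Proof.
move=> KN dD z1.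
have E : psum d N z = psum d K z + \sum_(K <= i < N) d i * z ^+ i.
  rewrite /psum -!(big_mkord xpredT (fun i => d i * z ^+ i)).
  by rewrite (big_cat_nat (n := K) (p := N)).
have hd : cmod (psum d K z) ^+ 2 <= (\sum_(i < K) cmod (d i)) ^+ 2.
  rewrite lerXn2r ?nnegrE ?cmod_ge0 ?sumr_ge0//.
  apply: le_trans (cmod_sum _ _ _) _; apply: ler_sum => i _.
  by rewrite cmodM cmodX ler_piMr ?cmod_ge0// exprn_ile1 ?cmod_ge0.
have dn : \sum_(K <= i < N) cmod (d i) ^+ 2 <= D.
  apply: le_trans (dD N); rewrite -(big_mkord xpredT (fun i => cmod (d i) ^+ 2)).
  by rewrite [leRHS](big_cat_nat (n := K))//= lerDr sumr_ge0// => i _; exact: sqr_ge0.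
have g0 : 0 <= \sum_(K <= i < N) (cmod z ^+ 2) ^+ i.
  by apply: sumr_ge0 => i _; rewrite exprn_ge0// sqr_ge0.
have tl : cmod (\sum_(K <= i < N) d i * z ^+ i) ^+ 2 <= D * \sum_(K <= i < N) (cmod z ^+ 2) ^+ i.
  apply: (@le_trans _ _ ((\sum_(K <= i < N) cmod (d i) * cmod z ^+ i) ^+ 2)).
    rewrite lerXn2r ?nnegrE ?cmod_ge0//.
      by apply: sumr_ge0 => i _; rewrite mulr_ge0 ?exprn_ge0 ?cmod_ge0.
    apply: le_trans (cmod_sum _ _ _) _; apply: ler_sum => i _.
    by rewrite cmodM cmodX.
  apply: le_trans (cauchy_schwarz _ _ _ _) _.
  have -> : \sum_(K <= i < N) (cmod z ^+ 2) ^+ i = \sum_(K <= i < N) (cmod z ^+ i) ^+ 2.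
    by apply: eq_bigr => i _; rewrite -!exprM mulnC.
  by apply: ler_wpM2r => //; apply: sumr_ge0 => i _; exact: sqr_ge0.
have := sqr_cmod_le (psum d N z) (psum d K z).
rewrite (_ : psum d K z - psum d N z = - \sum_(K <= i < N) d i * z ^+ i); last by rewrite E; ring.
by rewrite cmodN; lra.
Qed.

(** Almost everywhere this is |psi|^(2n) on the circle. *)
Definition psi_liminf n t : \bar R := circle_liminf (radial_sqr (psipow n)) t.

(** [block_bound] at the boundary value p of psi, integrated over the circle. At a point
  with |p| < 1 the boundary value of h o psi is h p. *)
Lemma norm2_comp_bound d D h K : ps_on d 0 1 h -> l2le d D -> 0 < D ->
  (norm2 (h \o psi) <= (2 * (\sum_(i < K) cmod (d i)) ^+ 2)%:E +
     (2 * D)%:E * \sum_(K <= n <oo) norm2 (psipow n))%E.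
Proof.
move=> dh dD D0; set A := 2 * _ ^+ 2.
have A0 : 0 <= A by rewrite mulr_ge0// sqr_ge0.
have Q0 n t : (0 <= psi_liminf n t)%E by apply: circle_liminf_ge0 => k; exact: sqr_ge0.
have mQ n : measurable_fun (period 0 : set (measurableTypeR R)) (psi_liminf n).
  apply: measurable_circle_liminf => k; have [b [hb _]] := psipow_ps n.
  exact: (continuous_cmod2 (ps_circ_cont hb (rad_ge0 R k) (rad_lt1 R k))).
pose V t : \bar R := (\sum_(n <oo) psi_liminf (n + K)%N t)%E.
have V0 t : (0 <= V t)%E by apply: nneseries_ge0 => *.
have mV : measurable_fun (period 0 : set (measurableTypeR R)) V.
  by apply: ge0_emeasurable_sum => // k _; exact: mQ.
have D2 : (0 <= (2 * D)%:E)%E by rewrite lee_fin mulr_ge0// ltW.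
have A1 : (0 <= A%:E)%E by rewrite lee_fin.
pose u t : \bar R := (A%:E + (2 * D)%:E * V t)%E.
have mDV : measurable_fun (period 0 : set (measurableTypeR R)) (fun t => ((2 * D)%:E * V t)%E).
  exact: measurable_funeM.
have mcst : measurable_fun (period 0 : set (measurableTypeR R)) (fun _ : R => A%:E).
  exact: measurable_cst.
have mu' : measurable_fun (period 0 : set (measurableTypeR R)) u by exact: emeasurable_funD.
have u0 t : (0 <= u t)%E by rewrite adde_ge0// mule_ge0.
apply: (@le_trans _ _ ((2 * pi)^-1%:E * \int[mu]_(t in period 0) u t)%E).
  apply: (circle_int_le mu' u0) => [w|]; first by rewrite lee_fin sqr_ge0.
  have [b1 [hb1 l1]] := psipow_ps 1.
  have psi1 : psipow 1 = psi by apply/funext => z; rewrite /psipow expr1.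
  rewrite psi1 in hb1.
  apply: ae_imp (fatou_nontangential hb1 l1) => t Ht t01.
  have {Ht}Ht := Ht t01; set p := boundary psi (circ t) in Ht *.
  have Qp n : psi_liminf n t = ((cmod p ^+ 2) ^+ n)%:E.
    have h1 := nontangential_radial (@boundary_pow n t p Ht).
    have h2 : cmod (psipow n (rc (rad R k) * circ t)) @[k --> \oo] --> cmod (p ^+ n).
      by apply: cvg_cmod; exact: h1.
    rewrite /psi_liminf (circle_liminf_cvg (v := radial_sqr (psipow n)) (cvgM h2 h2)).
    by rewrite cmodX -expr2 -!exprM mulnC.
  have Vp N : ((\sum_(K <= i < N) (cmod p ^+ 2) ^+ i)%:E <= V t)%E.
    have -> : V t = (\sum_(K <= n <oo) psi_liminf n t)%E.
      exact: (@nneseries_addn _ (fun n => psi_liminf n t) K (fun n => Q0 n t)).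
    rewrite -sumEFin; under eq_bigr do rewrite -Qp.
    by apply: nneseries_lim_ge => n _ _; exact: Q0.
  have [p1|p1] := ltP (cmod p) 1.
    have hp : hol_at h p by apply: (ps_hol dh); rewrite subr0.
    have ch : (h \o psi) z @[z --> nontangential (circ t)] --> h p.
      exact: (cvg_comp psi h Ht (hol_at_continuous hp)).
    have -> : boundary (h \o psi) (circ t) = h p by exact: lim_cplxP ch.
    have hN : psum d N p @[N --> \oo] --> h p.
      have := dh p; rewrite subr0 => /(_ p1).
      have -> // : series (fun n => d n * p ^+ n) = fun N => psum d N p.
      by apply/funext => N; rewrite /series /psum /= big_mkord.
    have h1 : cmod (psum d N p) @[N --> \oo] --> cmod (h p) by apply: cvg_cmod; exact: hN.
    have h2 : (cmod (psum d N p) ^+ 2)%:E @[N --> \oo] --> (cmod (h p) ^+ 2)%:E.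
      by apply: cvg_EFin; [exact: nearW|exact: (cvgM h1 h1)].
    rewrite -(cvg_lim _ h2)//; apply: lime_le; first by apply/cvg_ex; eexists; exact: h2.
    exists K => // N /= KN; apply: (@le_trans _ _ (A + 2 * D * \sum_(K <= i < N) (cmod p ^+ 2) ^+ i)%:E).
      by rewrite lee_fin block_bound// ltW.
    by rewrite EFinD (EFinM (2 * D)); apply: leeD2l; apply: lee_wpmul2l => //; exact: Vp.
  (* Where |p| >= 1 the series of the |p|^(2n) diverges, so the bound is infinite. *)
  have VT : V t = +oo%E.
    apply/eqyP => B B0; pose n := (Num.truncn B).+1.
    apply: le_trans (Vp (K + n)%N); rewrite lee_fin.
    apply: (@le_trans _ _ (\sum_(K <= i < K + n) 1)).
      by rewrite sumr_const_nat addnC addnK ltW// truncnS_gt.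
    by apply: ler_sum => i _; rewrite -exprM exprn_ege1.
  by rewrite /u VT gt0_muley ?lte_fin ?mulr_gt0// addey ?leey.
rewrite (@ge0_integralD _ (measurableTypeR R) R mu (period 0) (measurable_period 0) _ _ _ mcst _ mDV)//; last first.
  by move=> t _; rewrite mule_ge0.
have D20 : 0 <= 2 * D by rewrite mulr_ge0// ltW.
rewrite (@ge0_integralZl_EFin _ (measurableTypeR R) R mu (period 0) (measurable_period 0) _ (fun t _ => V0 t) mV _ D20).
rewrite (@integral_nneseries _ (measurableTypeR R) R mu (period 0) (measurable_period 0)
  (fun n => psi_liminf (n + K)%N) (fun n => mQ _) (fun n t _ => Q0 _ t)).
have pi2 := twopi_gt0 R.
have pV0 : (0 <= (2 * pi)^-1%:E :> \bar R)%E by rewrite lee_fin invr_ge0 ltW.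
have -> : (\int[mu]_(t in period 0) A%:E = (A * (2 * pi))%:E)%E.
  rewrite -(@pint_cst R 0 A); apply: (@pint_EFin R 0 (fun=> A)) => t; exact: cvg_cst.
rewrite ge0_muleDr ?mule_ge0//; last 2 first.
- by rewrite lee_fin mulr_ge0// ltW.
- by apply: nneseries_ge0 => n _ _; exact: integral_ge0.
apply: leeD; first by rewrite -EFinM lee_fin mulrCA mulVf ?mulr1// gt_eqF.
rewrite muleCA; apply: lee_wpmul2l => //.
rewrite -nneseriesZl; last by move=> n _; exact: integral_ge0.
have -> : (\sum_(K <= n <oo) norm2 (psipow n) = \sum_(n <oo) norm2 (psipow (n + K)%N))%E.
  exact: (esym (@nneseries_addn _ (fun n => norm2 (psipow n)) K (fun n => norm2_ge0 _))).
apply: lee_nneseries => [n _ _|n _].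
  by rewrite mule_ge0// integral_ge0.
have [b [hb bl]] := psipow_ps (n + K)%N.
exact: norm2_liminf hb bl.
Qed.

End Composition.

(** * Compactness *)

Section NormConvergence.
Variable R : realType.
Implicit Types (e : R) (f : cplx R -> cplx R).

Lemma cvg_ereal0 (u : nat -> \bar R) : (forall n, 0 <= u n)%E ->
  (forall e, 0 < e -> exists N, forall n, (N <= n)%N -> (u n <= e%:E)%E) ->
  u @ \oo --> 0%E.
Proof.
move=> u0 H; have fin e n : (u n <= e%:E)%E -> u n \is a fin_num.
  by move=> h; rewrite ge0_fin_numE// (le_lt_trans h)// ltry.
apply/fine_cvgP; split.
  by have [N hN] := H _ ltr01; exists N => // n /hN/fin.
apply/cvgrPdist_le => e e0; have [N hN] := H _ e0; exists N => // n /= /hN h.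
by rewrite sub0r normrN ger0_norm ?fine_ge0// -lee_fin fineK// (fin _ _ h).
Qed.

Lemma ereal_cvg0 (u : nat -> \bar R) e : u @ \oo --> 0%E -> 0 < e ->
  exists N, forall n, (N <= n)%N -> (u n <= e%:E)%E.
Proof.
move=> /fine_cvgP[[N1 _ h1] /cvgrPdist_le h2] e0; have [N2 _ h3] := h2 _ e0.
exists (maxn N1 N2) => n; rewrite geq_max => /andP[n1 n2].
have := h3 n n2; rewrite /= sub0r normrN => h4.
by rewrite -(fineK (h1 n n1)) lee_fin (le_trans (ler_norm _)).
Qed.

Lemma hardy_norm_le_sqrt f e : 0 <= e -> (norm2 f <= (e ^+ 2)%:E)%E -> (hardy_norm f <= e%:E)%E.
Proof.
move=> e0; rewrite /hardy_norm -/(norm2 f); have := norm2_ge0 f; case: (norm2 f) => [x| |]//.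
rewrite poweR_EFin !lee_fin => x0 xe; rewrite powR12_sqrt//.
by rewrite -[leRHS](ger0_norm e0) -sqrtr_sqr ler_wsqrtr.
Qed.

End NormConvergence.

Theorem corollary2p6 (R : realType) (psi : cplx R -> cplx R)
    (psi_analytic : analytic_on (disk R) psi)
    (psi_disk : forall z, disk R z -> disk R (psi z))
    (psi_sum :
      (\sum_(0 <= n <oo) hardy_norm (fun z => psi z ^+ n)%R ^+ 2 < +oo)%E) :
  compact_operator (hardy R) (@hardy_norm R) (comp_op psi).

Proof.
have sum2 : (\sum_(0 <= n <oo) norm2 (psipow psi n) < +oo)%E.
  by under eq_eseriesr do rewrite -hardy_norm_sqr.
split=> [f hf|f hf [M fM]]; first exact: (comp_hardy psi_analytic psi_disk sum2 hf).
pose T := 2 * M ^+ 2.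
have hps k : exists a : nat -> cplx R, ps_on a 0 1 (f k) /\ l2le a T.
  have [a [S [ha aS]]] := hardy_l2 (hf k).
  by exists a; split => //; apply: (l2le_norm2 ha aS); exact: hardy_norm_le.
have [a ha] := boolp.choice hps.
have [c [kap [kap_mono cT kap_cvg]]] := l2_subsequence (fun k => (ha k).2).
pose F z : cplx R := lim (series (fun n => c n * z ^+ n) @ \oo).
have cF : ps_on c 0 1 F by exact: l2_ps cT.
have hF : hardy R (comp_op psi F).
  exact: (comp_hardy psi_analytic psi_disk sum2 (l2_hardy cF cT)).
exists kap, (comp_op psi F); split; [exact: kap_mono|exact: hF|].
pose d n i := a (kap n) i - c i.
pose h n z := f (kap n) z - F z.
have T0 : 0 <= T by rewrite mulr_ge0// sqr_ge0.
pose D := 4 * T + 1; have D0 : 0 < D by rewrite ltr_wpDl// mulr_ge0.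
have dD n : l2le (d n) D.
  by move=> N; apply: le_trans (l2leB (ha (kap n)).2 cT N) _; rewrite /D lerDl.
have dh n : ps_on (d n) 0 1 (h n).
  move=> z z1; have := cvgn_cplxD ((ha (kap n)).1 z z1) (cvgn_cplxN (cF z z1)).
  have -> : series (fun i => d n i * (z - 0) ^+ i) = (fun N =>
     series (fun i => a (kap n) i * (z - 0) ^+ i) N + - series (fun i => c i * (z - 0) ^+ i) N).
    by apply/funext => N; rewrite /series /= -sumrB; apply: eq_bigr => i _; rewrite mulrBl.
  exact.
have d0 K : \sum_(i < K) cmod (d n i) @[n --> \oo] --> (0 : R).
  have hd i : cmod (d n i) @[n --> \oo] --> (0 : R).
    exact: (cvg_cplx_modP (fun n => a (kap n) i) (c i)).1 (kap_cvg i).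
  by have := @cvg_fsum R (fun i n => cmod (d n i)) (fun=> 0) K hd; rewrite big1.
apply: cvg_ereal0 => [n|e e0]; first exact: poweR_ge0.
(* K makes the tail of the series at most e^2 / (4 D), which contributes e^2 / 2;
   then n makes the first K coefficients small enough for another e^2 / 2. *)
have tl := nneseries_tail_cvg sum2 (fun k _ => norm2_ge0 (psipow psi k)).
have e4 : 0 < e ^+ 2 / (4 * D) by rewrite divr_gt0 ?exprn_gt0// mulr_gt0.
have [K /(_ K (leqnn K)) hK] := ereal_cvg0 tl e4.
have e2 : 0 < e / 2 by rewrite divr_gt0.
have /cvgrPdist_le/(_ _ e2)[N _ hN] := d0 K.
exists N => n Nn; apply: hardy_norm_le_sqrt; first exact: ltW.
have -> : comp_op psi (f (kap n)) - comp_op psi F = h n \o psi by [].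
have B := norm2_comp_bound psi_analytic psi_disk K (dh n) (dD n) D0.
apply: le_trans B _.
have D2 : (0 <= (2 * D)%:E)%E by rewrite lee_fin mulr_ge0// ltW.
apply: le_trans (leeD (_ : _ <= (e ^+ 2 / 2)%:E)%E (lee_wpmul2l D2 hK)) _.
  have := hN n Nn; rewrite /= sub0r normrN ger0_norm; last by rewrite sumr_ge0.
  move=> hs; rewrite lee_fin; have s0 : 0 <= \sum_(i < K) cmod (d n i) by rewrite sumr_ge0.
  by move: hs s0; move: (\sum_(i < K) _) => s; nra.
rewrite -EFinM -EFinD lee_fin le_eqVlt; apply/orP; left; apply/eqP.
by field; rewrite gt_eqF.
Qed.
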